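(* For $d\in\mathbb{N}$ with $d\geq 2$, let $\Omega\subset\mathbb{R}^d$ denote some bounded Lipschitz domain. Moreover, let $s>0$ and $1<p<\infty$, as well as $\ell\in\mathbb{N}_0$, $0<\alpha\leq 1$, and $0<\gamma < \ell + \alpha + 1/p$. Define $$\sigma^* = \begin{cases} \ell + \alpha &\text{if } 0 < \gamma < \frac{\ell+\alpha}{d} + \frac{1}{p},\\[1ex] \frac{d}{d-1} \left( \ell + \alpha + \frac{1}{p} - \gamma \right) &\text{if } \frac{\ell+\alpha}{d} + \frac{1}{p} \leq \gamma < \ell + \alpha + \frac{1}{p}. \end{cases}$$ Then for all $$0 < \sigma < \min\left\{ \sigma^*, \frac{d}{d-1}\, s \right\} \qquad\text{and}\qquad \frac{1}{\tau} = \frac{\sigma}{d} + \frac{1}{p}$$ we have the continuous embedding $$B^{s}_p(L_p(\Omega)) \cap C^{\ell,\alpha}_{\gamma,\mathrm{loc}}(\Omega) \hookrightarrow B^{\sigma}_{\tau}(L_{\tau}(\Omega)),$$ i.e., there is a constant $C>0$ such that for all $u\in B^{s}_p(L_p(\Omega)) \cap C^{\ell,\alpha}_{\gamma,\mathrm{loc}}(\Omega)$ it holds $$\| u \,|\, B^{\sigma}_{\tau}(L_{\tau}(\Omega))\| \leq C \max\left\{ \| u \,|\, B^{s}_p(L_p(\Omega))\|, |u|_{C^{\ell,\alpha}_{\gamma,\mathrm{loc}}} \right\}.$$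
   Context: A domain is an open connected set; a Lipschitz domain is a domain with Lipschitz boundary. Besov spaces. For $r\in\mathbb{N}$, $h\in\mathbb{R}^d$ let $\Omega_{r,h}$ be the set of all $x\in\Omega$ such that the segment $[x,x+rh]$ lies in $\Omega$, and for $x\in\Omega_{r,h}$ let $\Delta_h^r(g,x)=\sum_{k=0}^r(-1)^{r-k}\binom{r}{k}g(x+kh)$. For $0<p\le\infty$, $g\in L_p(\Omega)$, $t>0$ put $\omega_r(g,t,\Omega)_p=\sup_{|h|\le t}\|\Delta_h^r(g,\cdot)\,|\,L_p(\Omega_{r,h})\|$. For $s>0$ and $0<p,q\le\infty$ the space $B^s_q(L_p(\Omega))$ consists of all $g\in L_p(\Omega)$ with finite semi-norm $$|g|_{B^s_q(L_p(\Omega))}=\Big(\int_0^\infty[t^{-s}\omega_r(g,t,\Omega)_p]^q\,\frac{dt}{t}\Big)^{1/q}\ (q<\infty),\qquad |g|_{B^s_\infty(L_p(\Omega))}=\sup_{t>0}t^{-s}\omega_r(g,t,\Omega)_p,$$ where $r\in\mathbb{N}$ with $r\ge\lfloor s\rfloor+1$ (different choices give equivalent quasi-norms), with quasi-norm $\|g\,|\,B^s_q(L_p(\Omega))\|=\|g\,|\,L_p(\Omega)\|+|g|_{B^s_q(L_p(\Omega))}$. Locally weighted Hölder spaces. For a closed ball $K\subset\Omega$, $C^{\ell}(K)$ is the space of real functions all of whose partial derivatives of order $\le\ell$ are uniformly continuous and bounded on $K$; $|g|_{C^{\ell,\alpha}(K)}=\sum_{|\nu|=\ell}\sup_{x\ne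 y\in K}\frac{|\partial^\nu g(x)-\partial^\nu g(y)|}{|x-y|^\alpha}$, and $C^{\ell,\alpha}(K)$ consists of those $g\in C^\ell(K)$ with $|g|_{C^{\ell,\alpha}(K)}<\infty$. Fix a constant $c>1$ and let $\mathcal{K}$ be the set of all closed balls $B_r(x_0)\subset\Omega$ ($x_0\in\Omega$, $r>0$) such that the open ball with center $x_0$ and radius $cr$ is contained in $\Omega$. With $\delta_K=\mathrm{dist}(K,\partial\Omega)$, for $\gamma>0$, $$C^{\ell,\alpha}_{\gamma,\mathrm{loc}}(\Omega)=\Big\{g:\Omega\to\mathbb{R}\ \Big|\ g\in C^{\ell,\alpha}(K)\text{ for all }K\in\mathcal{K},\ |g|_{C^{\ell,\alpha}_{\gamma,\mathrm{loc}}}=\sup_{K\in\mathcal{K}}\delta_K^\gamma|g|_{C^{\ell,\alpha}(K)}<\infty\Big\};$$ this space does not depend on the choice of $c>1$. *)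

(* Defs.v *)
From HB Require Import structures.
From mathcomp Require Import all_boot all_order all_algebra.
From mathcomp Require Import all_classical all_reals all_analysis.

Set Implicit Arguments.
Unset Strict Implicit.
Unset Printing Implicit Defensive.
Import Order.TTheory GRing.Theory Num.Theory.
Import numFieldNormedType.Exports.

Local Open Scope classical_set_scope.
Local Open Scope ring_scope.

(* The points of R^d are row vectors. The library norm `|x| on 'rV[R]_d is the
   maximum norm; it induces the usual topology and bounded sets, but balls,
   distances and Hoelder quotients below use the Euclidean norm enorm. *)

Definition rV_display : measure_display -> measure_display.
Proof. exact. Qed.

Section measurable_rV.
Context {R : realType} {n : nat}.

Definition rV_coord (i : 'I_n) (x : 'rV[R]_n) : R := x 0 i.

Let rV_set0 : g_sigma_preimage rV_coord set0.
Proof. exact: sigma_algebra0. Qed.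

Let rV_setC A : g_sigma_preimage rV_coord A ->
  g_sigma_preimage rV_coord (~` A).
Proof. exact: sigma_algebraC. Qed.

Let rV_bigcup (F : (set 'rV[R]_n)^nat) :
  (forall i, g_sigma_preimage rV_coord (F i)) ->
  g_sigma_preimage rV_coord (\bigcup_i F i).
Proof. exact: sigma_algebra_bigcup. Qed.

(* The product sigma-algebra, i.e. the Borel sets of R^n. *)
HB.instance Definition _ :=
  @isMeasurable.Build (rV_display default_measure_display)
    'rV[R]_n (g_sigma_preimage rV_coord) rV_set0 rV_setC rV_bigcup.

Lemma measurable_rV_coord (i : 'I_n) : measurable_fun [set: 'rV[R]_n] (rV_coord i).
Proof.
move=> _ Y mY; rewrite setTI; apply: sub_sigma_algebra => /=.
rewrite -bigcup_seq/=; exists i => /=; first by rewrite mem_index_enum.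
by exists Y => //; rewrite setTI.
Qed.

Lemma measurable_fun_rVP d (T : measurableType d) (f : T -> 'rV[R]_n) :
  (forall i, measurable_fun [set: T] (rV_coord i \o f)) ->
  measurable_fun [set: T] f.
Proof.
move=> mf _ A mA; rewrite setTI.
pose G : set (set 'rV[R]_n) := [set B | measurable (f @^-1` B)].
suff : @measurable _ 'rV[R]_n `<=` G by exact.
apply: smallest_sub.
  split.
  - by rewrite /G/= preimage_set0; exact: measurable0.
  - by move=> B mB; rewrite /G/= setTD preimage_setC; exact: measurableC.
  - by move=> F mF; rewrite /G/= preimage_bigcup; apply: bigcup_measurable => k _; exact: mF.
move=> B; rewrite -bigcup_seq/= => -[i _ [C mC <-]].
by rewrite /G/= setTI -comp_preimage -[X in measurable X]setTI; exact: mf.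
Qed.

End measurable_rV.

Section lebesgue_rV.
Context {R : realType}.

Definition rV_cons n (z : R * 'rV[R]_n) : 'rV[R]_n.+1 :=
  row_mx z.1%:M z.2 : 'rV[R]_(1 + n).

Definition rV_uncons n (x : 'rV[R]_n.+1) : R * 'rV[R]_n :=
  (x 0 ord0, rsubmx (x : 'rV[R]_(1 + n))).

Lemma rV_consK n : cancel (@rV_cons n) (@rV_uncons n).
Proof.
move=> [a v]; rewrite /rV_uncons /rV_cons row_mxKr; congr pair => /=.
transitivity (row_mx (a%:M : 'M[R]_1) v 0 (lshift n 0)).
  by congr (fun_of_matrix _ _ _); exact: val_inj.
by rewrite row_mxEl mxE eqxx.
Qed.

Lemma measurable_rV_cons n : measurable_fun [set: R * 'rV[R]_n] (@rV_cons n).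
Proof.
apply: measurable_fun_rVP => i.
have [j|j] := split_ordP (i : 'I_(1 + n)) => ->.
  have -> : rV_coord (lshift n j) \o (@rV_cons n) = fst.
    by apply/funext => z; rewrite /= /rV_coord row_mxEl ord1 mxE eqxx.
  exact: measurable_fst.
have -> : rV_coord (rshift 1 j) \o (@rV_cons n) = rV_coord j \o snd.
  by apply/funext => z; rewrite /= /rV_coord row_mxEr.
by apply: measurableT_comp => //; exact: measurable_rV_coord.
Qed.

Lemma measurable_rV_uncons n : measurable_fun [set: 'rV[R]_n.+1] (@rV_uncons n).
Proof.
apply/measurable_fun_pairP; split; first exact: measurable_rV_coord.
apply: measurable_fun_rVP => i.
have -> : rV_coord i \o (snd \o @rV_uncons n) =
    rV_coord (rshift 1 i : 'I_n.+1).
  by apply/funext => z; rewrite /= /rV_coord mxE.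
exact: measurable_rV_coord.
Qed.

Section step.
Context {n : nat}.
Variable mu : {sigma_finite_measure set 'rV[R]_n -> \bar R}.

Definition lebesgue_rV_step : set 'rV[R]_n.+1 -> \bar R :=
  pushforward (lebesgue_measure \x mu)%E (@rV_cons n).

Let step0 : (lebesgue_rV_step set0 = 0)%E.
Proof. by rewrite /lebesgue_rV_step /pushforward preimage_set0 measure0. Qed.

Let step_ge0 A : (0 <= lebesgue_rV_step A)%E.
Proof. by rewrite /lebesgue_rV_step /pushforward. Qed.

Let step_sigma_additive : semi_sigma_additive lebesgue_rV_step.
Proof.
apply: measure_semi_sigma_additive; exact: measurable_rV_cons.
Qed.

HB.instance Definition _ := isMeasure.Build _ _ _
  lebesgue_rV_step step0 step_ge0 step_sigma_additive.

Let step_sigma_finite : sigma_finite setT lebesgue_rV_step.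
Proof.
have /sigma_finiteP[F [TF ndF Foo]] := sigma_finiteT (@lebesgue_measure R).
have /sigma_finiteP[G [TG ndG Goo]] := sigma_finiteT mu.
exists (fun k => @rV_uncons n @^-1` (F k `*` G k)).
  rewrite -preimage_bigcup (_ : \bigcup_k _ = setT) ?preimage_setT//.
  apply/seteqP; split => // -[a v] _.
  have [i _ Fa] : (\bigcup_k F k) a by rewrite -TF.
  have [j _ Gv] : (\bigcup_k G k) v by rewrite -TG.
  exists (maxn i j) => //; split => /=.
    by move: a Fa; exact/subsetPset/ndF/leq_maxl.
  by move: v Gv; exact/subsetPset/ndG/leq_maxr.
move=> k; have [mF Fk] := Foo k; have [mG Gk] := Goo k; split.
  rewrite -[X in measurable X]setTI; apply: measurable_rV_uncons => //.
  exact: measurableX.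
rewrite /lebesgue_rV_step /pushforward -comp_preimage.
rewrite (_ : _ \o _ = id); last by apply/funext => z; rewrite /= rV_consK.
by rewrite preimage_id product_measure1E// lte_mul_pinfty// ge0_fin_numE.
Qed.

HB.instance Definition _ := Measure_isSigmaFinite.Build _ _ _
  lebesgue_rV_step step_sigma_finite.

End step.

Fixpoint lebesgue_rV (n : nat) : {sigma_finite_measure set 'rV[R]_n -> \bar R} :=
  match n with
  | 0 => \d_(0 : 'rV[R]_0)
  | m.+1 => lebesgue_rV_step (lebesgue_rV m)
  end.

Lemma lebesgue_rV_box n (A : 'I_n -> set R) :
  (forall i, measurable (A i)) ->
  (lebesgue_rV n [set x : 'rV[R]_n | forall i, A i (x 0%R i)] =
   \prod_(i < n) lebesgue_measure (A i))%E.
Proof.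
elim: n A => [|n IHn] A mA.
  by rewrite big_ord0 /= diracE mem_set// => -[].
rewrite big_ord_recl -IHn; last by move=> i; exact: mA.
rewrite -product_measure1E; [|exact: mA|].
2: {
  rewrite (_ : [set _ | _] = \big[setI/setT]_(i < n)
      (rV_coord i @^-1` A (lift ord0 i))).
    apply: bigsetI_measurable => i _.
    by rewrite -[X in measurable X]setTI; exact: measurable_rV_coord.
  rewrite -bigcap_seq; apply/seteqP; split => x /= Ax i; last first.
    by apply: Ax => /=; rewrite mem_index_enum.
  by move=> _; exact: Ax. }
rewrite /= /lebesgue_rV_step /pushforward.
have E (a : R) (v : 'rV[R]_n) : rV_cons (a, v) 0 ord0 = a.
  by have /(congr1 fst) := rV_consK (a, v).
have E' (a : R) (v : 'rV[R]_n) i : rV_cons (a, v) 0 (lift ord0 i) = v 0 i.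
  rewrite -[in RHS](row_mxEr (a%:M : 'M[R]_1)).
  by congr (fun_of_matrix _ _ _); exact: val_inj.
suff -> : @rV_cons n @^-1` [set x : 'rV[R]_n.+1 | forall i, A i (x 0%R i)] =
    A ord0 `*` [set x : 'rV[R]_n | forall i, A (lift ord0 i) (x 0%R i)] by [].
apply/seteqP; split => -[a v] /=.
  by move=> Aav; split => [|i] /=; [rewrite -(E a v)|rewrite -(E' a v i)]; exact: Aav.
move=> [/= Aa Av] i; have [j ->|->] := unliftP ord0 i; last by rewrite E.
by rewrite E'; exact: Av.
Qed.

End lebesgue_rV.

Definition enorm {R : realType} {d : nat} (x : 'rV[R]_d) : R :=
  Num.sqrt (\sum_(i < d) x 0 i ^+ 2).

Definition eball {R : realType} {d : nat} (x : 'rV[R]_d) (r : R) :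
    set 'rV[R]_d :=
  [set y | enorm (y - x) < r].

Definition closed_eball {R : realType} {d : nat} (x : 'rV[R]_d) (r : R) :
    set 'rV[R]_d :=
  [set y | enorm (y - x) <= r].

Definition boundary {T : topologicalType} (A : set T) : set T :=
  closure A `\` interior A.

(* Near each boundary point, in suitable Cartesian coordinates z = y *m Q, the
   set is the strict epigraph, in the direction of the j-th coordinate, of a
   Lipschitz function of the other d - 1 coordinates col' j z. *)
Definition lipschitz_boundary {R : realType} {d : nat} (Omega : set 'rV[R]_d) :
    Prop :=
  forall x, boundary Omega x ->
    exists (eps : R) (Q : 'M[R]_d) (j : 'I_d) (phi : 'rV[R]_d.-1 -> R),
      [/\ 0 < eps, Q *m Q^T = 1%:M, lipschitz phi &
        forall y, eball x eps y ->
          (Omega y <-> phi (col' j (y *m Q)) < (y *m Q) 0 j)].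

Definition domain {R : realType} {d : nat} (Omega : set 'rV[R]_d) : Prop :=
  open Omega /\ connected Omega.

Definition lipschitz_domain {R : realType} {d : nat} (Omega : set 'rV[R]_d) :
    Prop :=
  domain Omega /\ lipschitz_boundary Omega.

(* A function on a set is represented by a function on all of R^d whose values
   outside the set are irrelevant: f \_ A extends f|_A by zero. *)
Definition Lp_norm {R : realType} {d : nat} (A : set 'rV[R]_d) (p : \bar R)
    (f : 'rV[R]_d -> R) : \bar R :=
  ('N[lebesgue_rV d]_p [EFin \o (f \_ A)])%E.

Definition segment_dom {R : realType} {d : nat} (Omega : set 'rV[R]_d)
    (r : nat) (h : 'rV[R]_d) : set 'rV[R]_d :=
  [set x | forall t : R, 0 <= t <= 1 -> Omega (x + (t * r%:R) *: h)].

Definition fdiff {R : realType} {d : nat} (r : nat) (h : 'rV[R]_d)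
    (g : 'rV[R]_d -> R) (x : 'rV[R]_d) : R :=
  \sum_(0 <= k < r.+1) (-1) ^+ (r - k) * 'C(r, k)%:R * g (x + k%:R *: h).

Definition modulus {R : realType} {d : nat} (Omega : set 'rV[R]_d) (r : nat)
    (p : \bar R) (g : 'rV[R]_d -> R) (t : R) : \bar R :=
  ereal_sup [set Lp_norm (segment_dom Omega r h) p (fdiff r h g) |
             h in [set h : 'rV[R]_d | enorm h <= t]].

(* s : smoothness, p : integrability, q : fine index, r : order of the
   differences; the value for q = -oo is junk. *)
Definition besov_seminorm {R : realType} {d : nat} (Omega : set 'rV[R]_d)
    (r : nat) (s : R) (p q : \bar R) (g : 'rV[R]_d -> R) : \bar R :=
  let w := fun t : R => ((t `^ (- s))%:E * modulus Omega r p g t)%E in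
  match q with
  | q'%:E =>
    ((\int[lebesgue_measure]_(t in `]0%R, +oo[) (w t `^ q' * (t^-1)%:E))
      `^ q'^-1)%E
  | +oo%E => ereal_sup [set w t | t in `]0, +oo[]
  | -oo%E => 0%E
  end.

Definition besov_norm {R : realType} {d : nat} (Omega : set 'rV[R]_d)
    (r : nat) (s : R) (p q : \bar R) (g : 'rV[R]_d -> R) : \bar R :=
  (Lp_norm Omega p g + besov_seminorm Omega r s p q g)%E.

Definition besov {R : realType} {d : nat} (Omega : set 'rV[R]_d)
    (r : nat) (s : R) (p q : \bar R) : set ('rV[R]_d -> R) :=
  [set g | [/\ measurable_fun Omega g, (Lp_norm Omega p g < +oo)%E &
             (besov_seminorm Omega r s p q g < +oo)%E]].

Definition basis_vec {R : realType} {d : nat} (i : 'I_d) : 'rV[R]_d :=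
  delta_mx 0 i.

Definition pderiv {R : realType} {d : nat} (w : seq 'I_d)
    (g : 'rV[R]_d -> R) : 'rV[R]_d -> R :=
  foldr (fun i f => 'D_(basis_vec i) f) g w.

(* the word with nu i letters i *)
Definition word_of {d : nat} (nu : 'I_d -> nat) : seq 'I_d :=
  flatten [seq nseq (nu i) i | i <- enum 'I_d].

(* C^l(K) for functions given on a neighbourhood of K; partial derivatives are
   two-sided, also at boundary points of K. *)
Definition Ck {R : realType} {d : nat} (l : nat) (K : set 'rV[R]_d) :
    set ('rV[R]_d -> R) :=
  [set g |
    (forall (w : seq 'I_d) (i : 'I_d) x, (size w < l)%N -> K x ->
       derivable (pderiv w g) x (basis_vec i)) /\
    (forall w : seq 'I_d, (size w <= l)%N ->
       unif_continuous (pderiv w g : subspace K -> R) /\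
       [bounded pderiv w g x | x in K])].

Definition holder_quot_sup {R : realType} {d : nat} (alpha : R)
    (K : set 'rV[R]_d) (f : 'rV[R]_d -> R) : \bar R :=
  ereal_sup [set (`|f z.1 - f z.2| / enorm (z.1 - z.2) `^ alpha)%:E |
             z in [set z : 'rV[R]_d * 'rV[R]_d |
                   [/\ K z.1, K z.2 & z.1 != z.2]]].

(* 'I_l.+1 is just a finite type containing all components of a multi-index
   of order l. *)
Definition holder_seminorm {R : realType} {d : nat} (l : nat) (alpha : R)
    (K : set 'rV[R]_d) (g : 'rV[R]_d -> R) : \bar R :=
  (\sum_(nu : {ffun 'I_d -> 'I_l.+1} | (\sum_(i < d) nu i)%N == l)
    holder_quot_sup alpha K (pderiv (word_of (fun i => nu i : nat)) g))%E.

Definition holder {R : realType} {d : nat} (l : nat) (alpha : R)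
    (K : set 'rV[R]_d) : set ('rV[R]_d -> R) :=
  [set g | Ck l K g /\ (holder_seminorm l alpha K g < +oo)%E].

Definition admissible_balls {R : realType} {d : nat} (c : R)
    (Omega : set 'rV[R]_d) : set (set 'rV[R]_d) :=
  [set K | exists (x : 'rV[R]_d) (r : R),
    [/\ Omega x, 0 < r, K = closed_eball x r, K `<=` Omega &
        eball x (c * r) `<=` Omega]].

Definition set_dist {R : realType} {d : nat} (A B : set 'rV[R]_d) : R :=
  inf [set enorm (z.1 - z.2) | z in A `*` B].

Definition holder_loc_seminorm {R : realType} {d : nat} (c : R)
    (Omega : set 'rV[R]_d) (l : nat) (alpha gamma : R) (g : 'rV[R]_d -> R) :
    \bar R :=
  ereal_sup [set (((set_dist K (boundary Omega)) `^ gamma)%:E *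
                  holder_seminorm l alpha K g)%E |
             K in admissible_balls c Omega].

Definition holder_loc {R : realType} {d : nat} (c : R)
    (Omega : set 'rV[R]_d) (l : nat) (alpha gamma : R) :
    set ('rV[R]_d -> R) :=
  [set g | (forall K, admissible_balls c Omega K -> holder l alpha K g) /\
           (holder_loc_seminorm c Omega l alpha gamma g < +oo)%E].

Definition sigma_star {R : realType} (d l : nat) (alpha p gamma : R) : R :=
  if gamma < (l%:R + alpha) / d%:R + p^-1 then l%:R + alpha
  else d%:R / (d%:R - 1) * (l%:R + alpha + p^-1 - gamma).

(* Main.v *)
(** Moduli of smoothness are estimated directly. Put L = l + alpha and fix a
    large order N. Where the ball B(x, eps) lies in Omega and eps is large
    compared with t, the Hoelder hypothesis gives
    |Delta_h^N u(x)| <= C t^L eps^(-gamma) for |h| <= t. The points at distance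
    at most eps from the boundary form a set of measure at most C eps, so that a
    sum over dyadic eps bounds the interior part of omega_N(u, t)_tau by t^L or
    t^(L - gamma + 1/tau), whichever is larger, up to an arbitrarily small loss
    in the exponent. On the remaining layer of width about t, Hoelder's
    inequality and the L_p modulus give t^(s + 1/tau - 1/p) = t^(s + sigma/d).
    The bound on sigma says that all these exponents exceed sigma; hence
    omega_N(u, t)_tau = O(t^eta) for some eta > sigma, and the integral defining
    the Besov semi-norm converges. A Marchaud inequality, obtained by moving
    into the domain along the directions of the boundary cones, lowers N to the
    prescribed order r' > eta. *)
From HB Require Import structures.
Require Import Defs.
From mathcomp Require Import all_boot all_order all_algebra.
From mathcomp Require Import all_classical all_reals all_analysis.
From mathcomp Require Import measurable_realfun.
From mathcomp Require Import zify ring lra.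

Set Implicit Arguments.
Unset Strict Implicit.
Unset Printing Implicit Defensive.
Import Order.TTheory GRing.Theory Num.Theory.
Import numFieldNormedType.Exports.

Local Open Scope classical_set_scope.
Local Open Scope ring_scope.

(** Since 1/tau = sigma/d + 1/p, the index [tau] may lie below 1, where the triangle inequality
    fails. All estimates are therefore made for [tau]-th powers of quasi-norms, using only finite
    differences and translations. A dyadic shell at distance eps contributes about t^(L tau) eps^(1
    - gamma tau), so the sign of gamma tau - 1 decides which end of the sum dominates. A positive
    growth rate (L - eta) tau above gamma tau - 1 settles both cases and the critical one at once.
    The order N must exceed [l] for the Hoelder bound and be at least [r] for the [L_p] modulus,
    whereas [r'] need only exceed [sigma] and may be smaller than both; hence the order has to be
    lowered at the end. Lowering it uses differences at points far beyond the given segment, which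
    near the boundary may leave the domain. A difference of the higher order in an inward direction
    first trades x for points with enough room. The comparison is with steps n h, n large, rather
    than 2 h, because the constants of the quasi-norm and of the inward move have to be beaten by
    n^(-k tau). *)

Section integral_mono.
Context d (T : measurableType d) (R : realType).
Variable mu : {measure set T -> \bar R}.
Local Open Scope ereal_scope.

(* Unlike [ge0_le_integral], no measurability is required. *)
Lemma ge0_integral_mono (D1 D2 : set T) (f1 f2 : T -> \bar R) :
  D1 `<=` D2 -> (forall x, D1 x -> 0 <= f1 x <= f2 x) ->
  (forall x, D2 x -> 0 <= f2 x) ->
  \int[mu]_(x in D1) f1 x <= \int[mu]_(x in D2) f2 x.
Proof.
move=> D12 f12 f20.
rewrite !ge0_integralE//; last by move=> x /f12 /andP[].
apply: le_ereal_sup => _ [h hf <-]; exists h => //= x.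
apply: (le_trans (hf x)); rewrite /patch.
case: ifPn => [|_]; last by case: ifPn => //; rewrite inE => /f20.
by rewrite inE => D1x; rewrite mem_set ?(andP (f12 _ D1x)).2//; exact: D12.
Qed.

End integral_mono.

(** * Lebesgue measure on row vectors *)

Section translation.
Context {R : realType}.

Lemma lebesgue_measure_shift (a : R) (A : set R) : measurable A ->
  lebesgue_measure ((fun x => x + a) @^-1` A) = lebesgue_measure A.
Proof.
move=> mA.
have ma : measurable_fun [set: measurableTypeR R] (fun x : R => x + a).
  exact: measurable_funD.
apply/esym.
apply: (@lebesgue_measure_unique _
  (pushforward lebesgue_measure (fun x : measurableTypeR R => x + a : measurableTypeR R))) => //.
move=> _ [[b c]] _ <-; rewrite /pushforward/=.
rewrite [X in _ = lebesgue_measure X](_ : _ = `]b - a, c - a]%classic); last first.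
  by apply/seteqP; split => x /=; rewrite !in_itv/= ltrBlDr lerBrDr.
by rewrite !lebesgue_measure_itv/= !lte_fin ltrD2r -!EFinD; congr (if _ then _%:E else _); lra.
Qed.

Lemma measurable_rV_shift n (v : 'rV[R]_n) :
  measurable_fun [set: 'rV[R]_n] (fun x => x + v).
Proof.
apply: measurable_fun_rVP => i.
rewrite (_ : _ \o _ = fun x : 'rV[R]_n => rV_coord i x + v 0 i); last first.
  by apply/funext => x; rewrite /= /rV_coord mxE.
by apply: measurable_funD => //; exact: measurable_rV_coord.
Qed.

(** The measure is the image of a product measure under [rV_cons], which intertwines the shift by
    [v] with the shifts by [a] and [w] in the two factors. Uniqueness of the product measure reduces
    the claim to rectangles. *)
Lemma lebesgue_rV_shift n (v : 'rV[R]_n) (A : set 'rV[R]_n) : measurable A ->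
  lebesgue_rV n ((fun x => x + v) @^-1` A) = lebesgue_rV n A.
Proof.
elim: n v A => [|n IHn] v A mA.
  congr (lebesgue_rV 0 _); apply/seteqP.
  by split => x /=; rewrite (_ : x + v = x)// [LHS]thinmx0 [RHS]thinmx0.
rewrite /= /lebesgue_rV_step /pushforward.
pose a := v 0 ord0.
pose w : 'rV[R]_n := rsubmx (v : 'rV[R]_(1 + n)).
pose S (z : measurableTypeR R * 'rV[R]_n) : measurableTypeR R * 'rV[R]_n :=
  (z.1 + a, z.2 + w).
have mS : measurable_fun [set: measurableTypeR R * 'rV[R]_n] S.
  apply/measurable_fun_pairP; split.
    by apply: measurable_funD => //; exact: measurable_fst.
  by apply: (measurableT_comp (measurable_rV_shift w)); exact: measurable_snd.
have cS z : rV_cons (S z) = rV_cons z + v.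
  have := add_row_mx (z.1%:M : 'M[R]_1) z.2 (lsubmx (v : 'rV[R]_(1 + n))) w.
  rewrite hsubmxK /rV_cons /S /= => ->.
  congr (row_mx _ _ : 'rV[R]_(1 + n)).
  rewrite raddfD; congr (_ + _).
  by apply/matrixP => i j; rewrite !ord1 !mxE eqxx; congr (v _ _); exact: val_inj.
rewrite -comp_preimage.
have -> : (fun x => x + v) \o @rV_cons _ n = @rV_cons _ n \o S.
  by apply/funext => z /=; rewrite cS.
rewrite comp_preimage.
have mcA : measurable (@rV_cons R n @^-1` A).
  by rewrite -[X in measurable X]setTI; exact: measurable_rV_cons.
apply/esym.
pose S' : {mfun _ >-> _} := HB.pack S (isMeasurableFun.Build _ _ _ _ S mS).
apply: (product_measure_unique (T1 := measurableTypeR R)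
  (m' := pushforward (lebesgue_measure \x lebesgue_rV n)%E S')) => //.
move=> B C mB mC; rewrite /pushforward.
transitivity ((lebesgue_measure \x lebesgue_rV n)%E
  (((fun x => x + a) @^-1` B) `*` ((fun x => x + w) @^-1` C))); first by [].
have mBa : measurable ((fun x => x + a) @^-1` B).
  have h : measurable_fun [set: measurableTypeR R] (fun x : R => x + a).
    exact: measurable_funD.
  by rewrite -(setTI (_ @^-1` B)); exact: h.
have mCw : measurable ((fun x => x + w) @^-1` C).
  by rewrite -(setTI (_ @^-1` C)); exact: measurable_rV_shift.
rewrite product_measure1E//; congr (_ * _)%E; last exact: IHn.
exact: lebesgue_measure_shift.
Qed.

(** The sigma-algebra is generated by the coordinates, so [A] is written as the countable union of
    the boxes with rational centres and half-widths 1/(k + 1) that it contains, enumerated by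
    [unpickle]. *)
Lemma open_measurable_rV n (A : set 'rV[R]_n) : open A -> measurable A.
Proof.
move=> oA.
pose box (q : 'rV[rat]_n * nat) : set 'rV[R]_n :=
  [set y | forall i, `|y 0 i - ratr (q.1 0 i)| < (q.2.+1%:R)^-1].
have mbox q : measurable (box q).
  rewrite (_ : box q = \big[setI/setT]_(i < n) (rV_coord i @^-1`
      [set t | `|t - ratr (q.1 0 i)| < (q.2.+1%:R)^-1])).
    apply: bigsetI_measurable => i _.
    rewrite -[X in measurable X]setTI; apply: measurable_rV_coord => //.
    apply: open_measurable; rewrite (_ : [set _ | _] = ball (ratr (q.1 0 i) : R^o) (q.2.+1%:R^-1)).
      exact: ball_open.
    by apply/seteqP; split => t; rewrite -ball_normE /= distrC.
  rewrite -bigcap_seq; apply/seteqP; split => x /= Ax i; last first.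
    by apply: Ax => /=; rewrite mem_index_enum.
  by move=> _; exact: Ax.
pose F (k : nat) : set 'rV[R]_n :=
  if unpickle k is Some q then if `[< box q `<=` A >] then box q else set0 else set0.
rewrite (_ : A = \bigcup_k F k).
  apply: bigcup_measurable => k _; rewrite /F.
  by case: (unpickle k) => [q|]//; case: ifP.
apply/seteqP; split => [x Ax|x [k _]]; last first.
  by rewrite /F; case: unpickle => [q|]//; case: ifPn => // /asboolP; apply.
have /nbhs_ballP[e /= e0 eA] := open_nbhs_nbhs (conj oA Ax).
pose k := Num.trunc (2 / e).
have ke : 2 / k.+1%:R < e.
  have := truncnS_gt (2 / e); rewrite -/k.
  by rewrite ltr_pdivrMr// ltr_pdivrMr// [e * _]mulrC.
have Hq i : {q : rat | `|x 0 i - ratr q| < k.+1%:R^-1}.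
  apply: cid; have [|q] := @rat_in_itvoo R (x 0 i) (x 0 i + k.+1%:R^-1).
    by rewrite ltrDl invr_gt0.
  rewrite in_itv/= => /andP[h1 h2]; exists q.
  by rewrite ltr0_norm ?subr_lt0// opprB ltrBlDl.
pose q : 'rV[rat]_n := \row_i sval (Hq i).
have xq : box (q, k) x by move=> i; rewrite /= mxE; exact: (svalP (Hq i)).
exists (pickle (q, k)) => //; rewrite /F pickleK ifT//.
apply/asboolP => y yq; apply: eA; split => // i j; rewrite !ord1.
have := xq j; have := yq j => /= h1 h2.
rewrite -ball_normE /=.
apply: le_lt_trans ke.
have -> : x 0 j - y 0 j = (x 0 j - ratr (q 0 j)) - (y 0 j - ratr (q 0 j)) by ring.
apply: le_trans (ler_normB _ _) _.
have -> : 2 / k.+1%:R = k.+1%:R^-1 + k.+1%:R^-1 :> R by field.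
by rewrite lerD// ltW.
Qed.

Lemma lebesgue_rV_ball_lty n (x : 'rV[R]_n) (e : R) :
  (lebesgue_rV n (ball x e) < +oo)%E.
Proof.
have [e0|e0] := leP e 0; first by rewrite le0_ball0// measure0.
pose B : set 'rV[R]_n :=
  [set y | forall i, `[x 0 i - e, x 0 i + e]%classic (y 0 i)].
apply: (@le_lt_trans _ _ (lebesgue_rV n B)).
  apply: le_measure; rewrite ?inE.
  - by apply: open_measurable_rV; exact: ball_open.
  - rewrite (_ : B = \big[setI/setT]_(i < n)
      (rV_coord i @^-1` `[x 0 i - e, x 0 i + e])).
      apply: bigsetI_measurable => i _.
      by rewrite -[X in measurable X]setTI; exact: measurable_rV_coord.
    rewrite -bigcap_seq; apply/seteqP; split => y /= Ay i; last first.
      by apply: Ay => /=; rewrite mem_index_enum.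
    by move=> _; exact: Ay.
  - move=> y [_ /(_ 0) yx] i; have := yx i.
    rewrite -ball_normE /= ltr_norml /= in_itv/= => /andP[h1 h2].
    by apply/andP; split; lra.
rewrite (_ : lebesgue_rV n B = (\prod_(i < n)
  lebesgue_measure (`[(x 0 i - e)%R, (x 0 i + e)%R]%classic : set R))%E); last exact: lebesgue_rV_box.
under eq_bigr => i _ do rewrite lebesgue_measure_itv/= lte_fin ltrD2l gtrN// -EFinD.
by rewrite prodEFin ltry.
Qed.

End translation.

(** * Powers of [L_q] quasi-norms *)

Section power_integral.
Context {R : realType} {d : nat}.
Implicit Types (A B : set 'rV[R]_d) (f g : 'rV[R]_d -> R).

Lemma powR_le_nneg (q a b : R) : 0 <= q -> 0 <= a -> a <= b -> a `^ q <= b `^ q.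
Proof.
by move=> q0 a0 ab; rewrite ge0_ler_powR ?nnegrE// (le_trans a0).
Qed.

(** The sum is at most its length times its largest term, and the power of that term is one of the
    summands on the right. This treats [q < 1] and [q >= 1] alike. *)
Lemma powR_sum_le (I : eqType) (s : seq I) (q : R) (a : I -> R) :
  0 < q -> (forall i, 0 <= a i) ->
  (\sum_(i <- s) a i) `^ q <= (size s)%:R `^ q * \sum_(i <- s) a i `^ q.
Proof.
move=> q0 a0.
have [m [m0 ms sm]] : exists m, [/\ 0 <= m,
    \sum_(i <- s) a i <= (size s)%:R * m & m `^ q <= \sum_(i <- s) a i `^ q].
  elim: s => [|i s [m [m0 ms sm]]].
    by exists 0; rewrite !big_nil mul0r powR0 ?gt_eqF.
  have sq0 : 0 <= \sum_(j <- s) a j `^ q by apply: sumr_ge0 => j _; exact: powR_ge0.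
  exists (Num.max m (a i)); split.
  - by rewrite le_max m0.
  - rewrite big_cons /= -natr1 mulrDl mul1r addrC lerD//.
      by apply: (le_trans ms); rewrite ler_wpM2l// le_max lexx.
    by rewrite le_max lexx orbT.
  - rewrite big_cons; case: (leP m (a i)) => _; first by rewrite lerDl.
    by rewrite (le_trans sm)// lerDr powR_ge0.
apply: (@le_trans _ _ (((size s)%:R * m) `^ q)).
  by apply: powR_le_nneg ms; [exact: ltW|exact: sumr_ge0].
by rewrite powRM// ler_wpM2l// powR_ge0.
Qed.

(** The [q]-th power of the quasi-norm: additive in the set of integration, and subject to the same
    kind of quasi-triangle inequality on both sides of [q = 1]. *)
Definition Lpow A (q : R) f : \bar R :=
  (\int[lebesgue_rV d]_(x in A) (`|f x| `^ q)%:E)%E.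

Lemma Lpow_ge0 A q f : (0 <= Lpow A q f)%E.
Proof. by apply: integral_ge0 => x _; rewrite lee_fin powR_ge0. Qed.

Lemma Lp_normE A q f : q != 0 ->
  Lp_norm A q%:E f = ((Lpow A q f) `^ q^-1)%E.
Proof.
move=> q0; rewrite /Lp_norm unlock /Lpow; congr (_ `^ _)%E.
rewrite [RHS]integral_mkcond; apply: eq_integral => x _.
rewrite /patch /=; case: ifP => _; first by [].
by rewrite normr0 powR0.
Qed.

Lemma measurable_powR_norm A q f : measurable_fun setT f ->
  measurable_fun A (fun x => (`|f x| `^ q)%:E).
Proof.
move=> mf; apply/measurable_EFinP.
apply: (@measurableT_comp _ _ _ _ _ _ (fun y : R => y `^ q)).
  exact: measurable_powR.
by apply: measurableT_comp => //; apply: measurable_funTS.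
Qed.

Lemma Lpow_mono A B q f g : 0 <= q -> A `<=` B ->
  (forall x, A x -> `|f x| <= `|g x|) -> (Lpow A q f <= Lpow B q g)%E.
Proof.
move=> q0 AB fg; apply: ge0_integral_mono => // x Ax; rewrite !lee_fin ?powR_ge0//.
by rewrite powR_le_nneg// fg.
Qed.

Lemma Lpow_cover (I : Type) (s : seq I) (U : I -> set 'rV[R]_d) A q f :
  measurable A -> (forall i, measurable (U i)) -> measurable_fun setT f ->
  (forall x, A x -> (\big[setU/set0]_(i <- s) U i) x) ->
  (Lpow A q f <= \sum_(i <- s) Lpow (A `&` U i) q f)%E.
Proof.
move=> mA mU mf; elim: s A mA => [|i s IH] A mA Acov.
  rewrite big_nil (_ : A = set0) ?/Lpow ?integral_set0//.
  by apply/seteqP; split => // x /Acov; rewrite big_nil.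
rewrite big_cons.
have -> : Lpow A q f = (Lpow (A `&` U i) q f + Lpow (A `\` U i) q f)%E.
  rewrite /Lpow -ge0_integral_setU ?setUIDK//.
  - exact: measurableI.
  - exact: measurableD.
  - exact: measurable_powR_norm.
  - by rewrite disj_set2E setDE setIACA setICr setI0.
apply: leeD => //; apply: le_trans (IH _ _ _) _.
- exact: measurableD.
- by move=> x [/Acov + nUi]; rewrite big_cons => -[].
apply: lee_sum => j _; rewrite /Lpow; apply: ge0_integral_mono => [x [[]]//|x _|x _];
  by rewrite lee_fin ?lexx powR_ge0.
Qed.

Lemma Lpow_shift A B v q f : 0 <= q -> measurable B -> measurable_fun setT f ->
  (forall x, A x -> B (x + v)) ->
  (Lpow A q (fun x => f (x + v)%R) <= Lpow B q f)%E.
Proof.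
move=> q0 mB mf AB.
have mv := @measurable_rV_shift R d v.
have <- : Lpow [set x | B (x + v)] q (fun x => f (x + v)) = Lpow B q f.
  rewrite /Lpow; pose S : {mfun _ >-> _} := HB.pack (fun x : 'rV[R]_d => x + v)
    (isMeasurableFun.Build _ _ _ _ _ mv).
  transitivity (\int[pushforward (lebesgue_rV d) S]_(x in B) (`|f x| `^ q)%:E)%E.
    rewrite (@ge0_integral_pushforward _ _ _ _ _ _ mv)//.
    exact: measurable_powR_norm.
  apply: eq_measure_integral => C mC _.
  by rewrite /= /pushforward lebesgue_rV_shift.
exact: Lpow_mono.
Qed.

Lemma Lpow_sum (I : eqType) (s : seq I) A q g (F : I -> 'rV[R]_d -> R) :
  0 < q -> measurable A -> (forall i, measurable_fun setT (F i)) ->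
  (forall x, A x -> `|g x| <= \sum_(i <- s) `|F i x|) ->
  (Lpow A q g <= ((size s)%:R `^ q)%:E * \sum_(i <- s) Lpow A q (F i))%E.
Proof.
move=> q0 mA mF gF.
have mF' i : measurable_fun A (fun x => (`|F i x| `^ q)%:E).
  exact: measurable_powR_norm.
rewrite /Lpow -ge0_integral_sum//.
rewrite -ge0_integralZl//; first last.
- by move=> x _; apply: sume_ge0.
- exact: emeasurable_sum.
apply: ge0_integral_mono => // x Ax.
  rewrite lee_fin powR_ge0/= sumEFin -EFinM lee_fin.
  apply: le_trans (powR_sum_le _ q0 _) => //.
  by apply: powR_le_nneg (gF _ Ax) => //; exact: ltW.
by rewrite sumEFin -EFinM lee_fin mulr_ge0 ?powR_ge0// sumr_ge0// => i _; exact: powR_ge0.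
Qed.

Lemma Lpow_scale A q (c : R) f : measurable A -> measurable_fun setT f ->
  Lpow A q (fun x => c * f x) = ((`|c| `^ q)%:E * Lpow A q f)%E.
Proof.
move=> mA mf; rewrite /Lpow -ge0_integralZl//.
  by apply: eq_integral => x _; rewrite normrM powRM.
exact: measurable_powR_norm.
Qed.

Lemma Lpow_bound A q M f : 0 <= q -> measurable A ->
  (forall x, A x -> `|f x| <= M) ->
  (Lpow A q f <= (M `^ q)%:E * lebesgue_rV d A)%E.
Proof.
move=> q0 mA fM; rewrite -integral_cst//.
apply: ge0_integral_mono => // x Ax; rewrite ?lee_fin ?powR_ge0//=.
by rewrite powR_le_nneg// fM.
Qed.

(* Plays the role of Hoelder's inequality: the optimal [lam] balances the two
   terms. *)
Lemma Lpow_young A (q p lam : R) f : 0 < q -> q <= p -> 0 < lam ->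
  measurable A -> measurable_fun setT f ->
  (Lpow A q f <= (lam `^ q)%:E * lebesgue_rV d A +
    (lam `^ (q - p))%:E * Lpow A p f)%E.
Proof.
move=> q0 qp lam0 mA mf.
rewrite -integral_cst// {2}/Lpow -ge0_integralZl//; last first.
- by rewrite lee_fin powR_ge0.
- exact: measurable_powR_norm.
rewrite -ge0_integralD//; last first.
- by apply: measurable_funeM; exact: measurable_powR_norm.
- by move=> x _; rewrite -EFinM lee_fin mulr_ge0 ?powR_ge0.
- by move=> x _; rewrite lee_fin powR_ge0.
apply: ge0_integral_mono => // x Ax.
  rewrite lee_fin powR_ge0 -EFinM -EFinD lee_fin /=.
  have [flam|lamf] := leP `|f x| lam.
    by rewrite (le_trans (powR_le_nneg (ltW q0) _ flam))// lerDl mulr_ge0 ?powR_ge0.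
  have f0 : 0 < `|f x| by rewrite (lt_trans lam0).
  apply: (@le_trans _ _ (lam `^ (q - p) * `|f x| `^ p)); last by rewrite lerDr powR_ge0.
  have -> : `|f x| `^ q = `|f x| `^ (q - p) * `|f x| `^ p.
    by rewrite -powRD ?subrK// gt_eqF// implybT.
  rewrite ler_wpM2r ?powR_ge0// -[q - p]opprB !powRN lef_pV2 ?posrE ?powR_gt0//.
  by rewrite powR_le_nneg ?subr_ge0// ltW.
by rewrite -EFinM -EFinD lee_fin addr_ge0 ?mulr_ge0 ?powR_ge0.
Qed.

(** The form in which identities between finite differences reach the integrals: once all translates
    stay in [B], the constant depends on the coefficients alone, not on the sets or the shifts. *)
Lemma Lpow_shift_sum (I : finType) A B q g f (a : I -> R) (u : I -> 'rV[R]_d) :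
  0 < q -> measurable A -> measurable B -> measurable_fun setT f ->
  (forall i x, A x -> B (x + u i)) ->
  (forall x, A x -> `|g x| <= \sum_i `|a i * f (x + u i)|) ->
  (Lpow A q g <= (#|I|%:R `^ q * \sum_i `|a i| `^ q)%:E * Lpow B q f)%E.
Proof.
move=> q0 mA mB mf ABu gle.
have mF i : measurable_fun setT (fun x : 'rV[R]_d => f (x + u i)).
  exact: (measurableT_comp mf (measurable_rV_shift _)).
have sI : size (index_enum I) = #|I| by rewrite -sum1_size sum1_card.
apply: le_trans (@Lpow_sum _ (index_enum I) A q g (fun i x => a i * f (x + u i)) q0 mA _ gle) _.
  by move=> i; apply: measurable_funM.
rewrite sI EFinM -muleA; apply: lee_wpmul2l; first by rewrite lee_fin powR_ge0.
rewrite -sumEFin ge0_sume_distrl; last by move=> i _; rewrite lee_fin powR_ge0.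
apply: lee_sum => i _; rewrite [leLHS](Lpow_scale q (a i) mA (mF i)).
apply: lee_wpmul2l; first by rewrite lee_fin powR_ge0.
exact: (Lpow_shift (ltW q0) mB mf (ABu i)).
Qed.

End power_integral.

(** * Comparison of the maximum norm with the Euclidean norm *)

Section row_vector_norms.
Context {R : realType}.

Lemma coord_le_norm {d} (x : 'rV[R]_d) i : `|x 0 i| <= `|x|.
Proof.
rewrite [leRHS]/Num.norm /= mx_normrE; apply/bigmax_geP; right => /=.
by exists (0, i).
Qed.

Lemma rV_norm_le {d} (x : 'rV[R]_d) M : 0 <= M -> (forall i, `|x 0 i| <= M) -> `|x| <= M.
Proof.
move=> M0 xM; rewrite [leLHS]/Num.norm /= mx_normrE.
by apply/bigmax_leP; split => // -[i j] _; rewrite ord1.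
Qed.

Lemma enorm_ge0 {d} (x : 'rV[R]_d) : 0 <= enorm x.
Proof. exact: sqrtr_ge0. Qed.

Lemma norm_le_enorm {d} (x : 'rV[R]_d) : `|x| <= enorm x.
Proof.
apply: rV_norm_le (enorm_ge0 x) _ => i.
rewrite -sqrtr_sqr ler_wsqrtr// (bigD1 i)//= lerDl.
by apply: sumr_ge0 => j _; exact: sqr_ge0.
Qed.

Lemma enorm_le_norm {d} (x : 'rV[R]_d) : enorm x <= d%:R * `|x|.
Proof.
rewrite -[leRHS]ger0_norm ?mulr_ge0// -sqrtr_sqr ler_wsqrtr// exprMn.
apply: (@le_trans _ _ (d%:R * `|x| ^+ 2)).
  have -> : d%:R * `|x| ^+ 2 = \sum_(i < d) `|x| ^+ 2.
    by rewrite sumr_const card_ord mulr_natl.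
  apply: ler_sum => i _.
  by rewrite -[x 0 i ^+ 2]real_normK ?num_real// lerXn2r ?nnegrE// coord_le_norm.
rewrite ler_wpM2r ?sqr_ge0// -natrX ler_nat.
by case: d {x} => // n; rewrite expnS expn1 leq_pmulr.
Qed.

Lemma enormZ {d} (a : R) (x : 'rV[R]_d) : enorm (a *: x) = `|a| * enorm x.
Proof.
rewrite /enorm -sqrtr_sqr -sqrtrM ?sqr_ge0//; congr Num.sqrt.
by rewrite mulr_sumr; apply: eq_bigr => i _; rewrite mxE exprMn.
Qed.

Lemma ball_rVE {d} (x : 'rV[R]_d) e y : ball x e y = (`|y - x| < e) :> Prop.
Proof. by rewrite -ball_normE /= distrC. Qed.

Lemma norm_mulmx_le {m n} (Q : 'M[R]_(m, n)) :
  exists2 C : R, 0 <= C & forall x : 'rV[R]_m, `|x *m Q| <= C * `|x|.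
Proof.
exists (\sum_i \sum_j `|Q i j|) => [|x].
  by apply: sumr_ge0 => i _; apply: sumr_ge0.
apply: rV_norm_le => [|j].
  by rewrite mulr_ge0// sumr_ge0// => i _; apply: sumr_ge0.
rewrite mxE mulr_suml; apply: le_trans (ler_norm_sum _ _ _) _.
apply: ler_sum => i _; rewrite normrM mulrC ler_pM// ?coord_le_norm//.
by rewrite (bigD1 j)//= lerDl sumr_ge0.
Qed.

End row_vector_norms.

(** * Lipschitz domains *)

Section geometry.
Context {R : realType} {d : nat}.
Implicit Types (Omega : set 'rV[R]_d).

(* [e] points into [Omega] and [T], the height above the boundary graph,
   increases with unit speed along [e]. *)
Definition inward_chart Omega (U : set ('rV[R]_d)) (eps0 Lam : R) (e : 'rV[R]_d)
    (T : 'rV[R]_d -> R) :=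
  [/\ forall x y, U x -> `|y - x| < eps0 -> (Omega y <-> 0 < T y),
      forall y a, T (y + a *: e) = T y + a,
      forall y y', `|T y - T y'| <= Lam * `|y - y'| &
      `|e| <= Lam].

Lemma exists_inward_chart Omega x : (0 < d)%N -> open Omega ->
  lipschitz_boundary Omega -> closure Omega x ->
  exists (eps Lam : R) (e : 'rV[R]_d) (T : 'rV[R]_d -> R),
    0 < eps /\ inward_chart Omega [set x] eps Lam e T.
Proof.
move=> d0 oO lO cOx; have [Ox|nOx] := pselect (Omega x).
  have /nbhs_ballP[eps /= eps0 epsO] := open_nbhs_nbhs (conj oO Ox).
  pose i0 : 'I_d := Ordinal d0.
  (* At an interior point the height over a hyperplane that misses the ball is positive throughout
     and serves as a chart. *)
  exists eps, 1, (delta_mx 0 i0), (fun y => (y - x) 0 i0 + eps); split => //; split.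
  - move=> _ y -> yx; split => [_|_]; last by apply: epsO; rewrite ball_rVE.
    have := le_lt_trans (coord_le_norm (y - x) i0) yx.
    by rewrite ltr_norml => /andP[h _]; lra.
  - by move=> y a; rewrite !mxE !eqxx mulr1; ring.
  - move=> y y'; rewrite mul1r.
    have -> : (y - x) 0 i0 + eps - ((y' - x) 0 i0 + eps) = (y - y') 0 i0.
      by rewrite !mxE; ring.
    exact: coord_le_norm.
  - apply: rV_norm_le => // i; rewrite mxE; case: (_ && _) => /=.
      by rewrite normr1.
    by rewrite normr0.
have [eps [Q [j [phi [eps0 QQ lphi Ophi]]]]] : exists (eps : R) (Q : 'M[R]_d)
    (j : 'I_d) (phi : 'rV[R]_d.-1 -> R),
    [/\ 0 < eps, Q *m Q^T = 1%:M, lipschitz phi &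
      forall y, eball x eps y ->
        (Omega y <-> phi (col' j (y *m Q)) < (y *m Q) 0 j)].
  apply: lO; split => //; apply: contra_not nOx; exact: interior_subset.
have [k k0 kl] := pinfty_ex_gt0 lphi.
have {}kl u v : `|phi u - phi v| <= k * `|u - v| by exact: (kl (u, v)).
have [C C0 CQ] := norm_mulmx_le Q.
have QTQ : Q^T *m Q = 1%:M by exact: mulmx1C.
pose e : 'rV[R]_d := delta_mx 0 j *m Q^T.
pose T (y : 'rV[R]_d) := (y *m Q) 0 j - phi (col' j (y *m Q)).
have dd0 : 0 < (d%:R : R) by rewrite ltr0n.
(* Division by [d] fits the maximum-norm ball into the Euclidean one. [C * (1 + k)] is a Lipschitz
   constant of [T]; the norm of [e] is added because [Lam] bounds the direction as well. *)
exists (eps / d%:R), (C * (1 + k) + `|e|), e, T; split; first by rewrite divr_gt0.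
split.
- move=> _ y -> yx; rewrite /T subr_gt0; apply: Ophi; rewrite /eball /=.
  apply: le_lt_trans (enorm_le_norm _) _.
  by rewrite mulrC -ltr_pdivlMr.
- move=> y a; rewrite /T.
  have -> : (y + a *: e) *m Q = y *m Q + a *: delta_mx 0 j.
    by rewrite mulmxDl -scalemxAl /e -mulmxA QTQ mulmx1.
  have -> : col' j (y *m Q + a *: delta_mx 0 j) = col' j (y *m Q).
    apply/matrixP => i i'; rewrite !mxE /=.
    by rewrite [lift j i' == j]eq_sym (negbTE (neq_lift _ _)) andbF mulr0 addr0.
  by rewrite !mxE !eqxx mulr1; ring.
- move=> y y'.
  have h1 : `|(y *m Q) 0 j - (y' *m Q) 0 j| <= C * `|y - y'|.
    have -> : (y *m Q) 0 j - (y' *m Q) 0 j = ((y - y') *m Q) 0 j.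
      by rewrite mulmxBl !mxE.
    exact: le_trans (coord_le_norm _ _) (CQ _).
  have h2 : `|phi (col' j (y *m Q)) - phi (col' j (y' *m Q))| <= k * (C * `|y - y'|).
    apply: (le_trans (kl _ _)); rewrite ler_wpM2l ?(ltW k0)//.
    apply: le_trans (CQ (y - y')); apply: rV_norm_le => // i.
    have -> : (col' j (y *m Q) - col' j (y' *m Q)) 0 i = ((y - y') *m Q) 0 (lift j i).
      by rewrite mulmxBl !mxE.
    exact: coord_le_norm.
  have -> : T y - T y' = ((y *m Q) 0 j - (y' *m Q) 0 j) -
     (phi (col' j (y *m Q)) - phi (col' j (y' *m Q))) by rewrite /T; ring.
  apply: le_trans (ler_normB _ _) _; apply: le_trans (lerD h1 h2) _.
  have : 0 <= `|e| * `|y - y'| by rewrite mulr_ge0.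
  by rewrite !mulrDl; lra.
- by rewrite lerDr mulr_ge0// addr_ge0// ltW.
Qed.

(** One scale [eps0] and one constant [Lam] serve all charts. Each chart is valid within [eps0] of
    every point of its ball, so it still describes [Omega] at the shifted points of a difference
    that starts in the ball. *)
Definition atlas Omega (s : seq 'rV[R]_d) (rho : 'rV[R]_d -> R) (eps0 Lam : R)
    (e : 'rV[R]_d -> 'rV[R]_d) (T : 'rV[R]_d -> 'rV[R]_d -> R) :=
  [/\ 0 < eps0, 1 <= Lam,
      forall x, Omega x -> (\big[setU/set0]_(z <- s) ball z (rho z)) x &
      forall z, z \in s -> inward_chart Omega (ball z (rho z)) eps0 Lam (e z) (T z)].

Lemma closure_bounded_compact Omega : bounded_set Omega -> compact (closure Omega).
Proof.
move=> bO; apply: bounded_closed_compact; last exact: closed_closure.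
have [M M0 OM] := pinfty_ex_gt0 bO.
exists M; split => [|N MN x cx]; first exact: num_real.
apply: le_trans (ltW MN).
have : closed [set y : 'rV[R]_d | `|y| <= M].
  apply: (@closed_comp _ _ _ [set y : R | y <= M]); last exact: closed_le.
  by move=> y _; exact: norm_continuous.
by move=> /closure_id; rewrite predeqE => /(_ x)[_]; apply; exact: closureS _ _ cx.
Qed.

Lemma exists_atlas Omega : (0 < d)%N -> open Omega -> lipschitz_boundary Omega ->
  bounded_set Omega ->
  exists s rho eps0 Lam e T, atlas Omega s rho eps0 Lam e T.
Proof.
move=> d0 oO lO bO.
pose data := (R * R * 'rV[R]_d * ('rV[R]_d -> R))%type.
pose good x (D : data) := 0 < D.1.1.1 /\
  inward_chart Omega [set x] D.1.1.1 D.1.1.2 D.1.2 D.2.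
have [F FP] : exists F : 'rV[R]_d -> data, forall x, closure Omega x -> good x (F x).
  suff H x : exists D, closure Omega x -> good x D.
    by exists (fun x => sval (cid (H x))) => x; exact: (svalP (cid (H x))).
  have [cx|ncx] := pselect (closure Omega x); last by exists (0, 0, 0, cst 0).
  have [eps [Lam [e [T h]]]] := exists_inward_chart d0 oO lO cx.
  by exists (eps, Lam, e, T).
(* Only half the radius is used for the covering; the other half is the room [eps0] left around
   every point of the ball. *)
pose rho x := (F x).1.1.1 / 2.
have := closure_bounded_compact bO; rewrite compact_cover.
move=> /(_ _ (closure Omega) (fun x => ball x (rho x))) [].
- by move=> x _; exact: ball_open.
- by move=> x cx; exists x => //; apply: ballxx; have [h _] := FP _ cx; rewrite divr_gt0.
move=> D sD covD.
pose s := finmap.enum_fset D.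
have sP z : z \in s -> closure Omega z by move=> /sD; rewrite inE.
have [eps0 eps0_gt0 eps0P] : exists2 eps0, 0 < eps0 &
    forall z, z \in s -> eps0 <= rho z.
  elim: s sP => [|z s IH] sP; first by exists 1.
  have [|eps0 eps00 IH'] := IH; first by move=> y ys; apply: sP; rewrite inE ys orbT.
  exists (Num.min eps0 (rho z)).
    by rewrite lt_min eps00 divr_gt0//; have [] := FP z (sP z (mem_head _ _)).
  move=> y; rewrite inE => /orP[/eqP ->|/IH' h]; first by rewrite ge_min lexx orbT.
  by rewrite ge_min h.
have [Lam Lam1 LamP] : exists2 Lam, 1 <= Lam &
    forall z, z \in s -> (F z).1.1.2 <= Lam.
  elim: (s) => [|z t [Lam Lam1 IH]]; first by exists 1.
  exists (Num.max Lam (F z).1.1.2); first by rewrite le_max Lam1.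
  move=> y; rewrite inE => /orP[/eqP ->|/IH h]; first by rewrite le_max lexx orbT.
  by rewrite le_max h.
exists s, rho, eps0, Lam, (fun z => (F z).1.2), (fun z => (F z).2).
split => // [x Ox|z zs].
  have [z zD zx] := covD x (subset_closure Ox).
  by rewrite -bigcup_seq; exists z.
have [Fz0 [h1 h2 h3 h4]] := FP z (sP z zs).
split => //.
- move=> x y; rewrite ball_rVE => xz yx; apply: (h1 z) => //.
  have -> : y - z = (y - x) + (x - z) by rewrite addrA subrK.
  apply: le_lt_trans (ler_normD _ _) _.
  have := eps0P z zs; move: xz; rewrite /rho => xz.
  by have := lt_le_trans yx (eps0P z zs); rewrite /rho; lra.
- by move=> y y'; rewrite (le_trans (h3 _ _))// ler_wpM2r// LamP.
- exact: le_trans (LamP z zs).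
Qed.

(** Nearness to the boundary is expressed by a point outside [Omega] in the maximum-norm ball. The
    layer of an open set is then open, and at points of [Omega] off the layer [ball x eps] lies in
    [Omega]. *)
Definition layer Omega (eps : R) : set 'rV[R]_d :=
  [set x | Omega x /\ exists2 y, ball x eps y & ~ Omega y].

Lemma layer_measurable Omega eps : open Omega -> measurable (layer Omega eps).
Proof.
move=> oO; apply: open_measurable_rV.
rewrite (_ : layer _ _ = Omega `&` \bigcup_(y in ~` Omega) ball y eps).
  by apply: openI => //; apply: bigcup_open => y _; exact: ball_open.
apply/seteqP; split => x [Ox].
  by move=> [y xy nOy]; split => //; exists y => //; exact: ball_sym.
by move=> [y nOy xy]; split => //; exists y => //; exact: ball_sym.
Qed.

Lemma lipschitz_open_gt (Lam c : R) (T : 'rV[R]_d -> R) : 0 < Lam ->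
  (forall y y', `|T y - T y'| <= Lam * `|y - y'|) -> open [set y | c < T y].
Proof.
move=> L0 TL; rewrite openE => y /= cT.
apply/nbhs_ballP; exists ((T y - c) / Lam) => /=; first by rewrite divr_gt0// subr_gt0.
move=> y'; rewrite ball_rVE distrC ltr_pdivlMr// mulrC => yy'.
by have := le_lt_trans (TL y y') yy'; rewrite ltr_norml => /andP[_ h] /=; lra.
Qed.

(* The translates of the slab by multiples of [delta *: e] are disjoint. *)
Lemma slab_measure (z e : 'rV[R]_d) (rho Lam : R) (T : 'rV[R]_d -> R) : 0 < Lam ->
  (forall y a, T (y + a *: e) = T y + a) ->
  (forall y y', `|T y - T y'| <= Lam * `|y - y'|) ->
  exists2 C : R, 0 <= C & forall delta, 0 < delta ->
    (lebesgue_rV d (ball z rho `&` [set y | (0 < T y <= delta)%R]) <= (C * delta)%:E)%E.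
Proof.
move=> L0 Te TL.
pose B := ball z (rho + `|e|).
have Bfin : (lebesgue_rV d B \is a fin_num)%E.
  by rewrite ge0_fin_numE// lebesgue_rV_ball_lty.
pose V := fine (lebesgue_rV d B).
have V0 : 0 <= V by exact: fine_ge0.
exists (2 * V); first by rewrite mulr_ge0.
move=> delta delta0; pose S := ball z rho `&` [set y | 0 < T y <= delta].
have mS : measurable S.
  apply: measurableI; first by apply: open_measurable_rV; exact: ball_open.
  rewrite (_ : [set _ | _] = [set y | 0 < T y] `\` [set y | delta < T y]).
    by apply: measurableD; apply: open_measurable_rV; exact: (lipschitz_open_gt L0 TL).
  by apply/seteqP; split => y /= => [/andP[? ?]|[-> /negP]];
    [split => //; apply/negP; rewrite -leNgt|rewrite -leNgt].
have mB : measurable B by apply: open_measurable_rV; exact: ball_open.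
have [d1|d1] := leP delta 1; last first.
  apply: (@le_trans _ _ (lebesgue_rV d B)).
    apply: le_measure; rewrite ?inE// => y [zy _].
    by apply: le_ball zy; rewrite lerDl.
  by rewrite -(fineK Bfin) lee_fin -/V -mulrA mulrCA ler_peMr//; lra.
(* K delta <= 1 keeps all translates inside [B]; K >= 1 gives 2 K >= K + 1 > 1/delta, which explains
   the factor 2 in the constant. *)
pose K := Num.trunc delta^-1.
have K1 : 1 <= delta^-1 by rewrite invf_ge1.
have K0 : (0 < K)%N by rewrite truncn_gt0.
have Kd : K%:R <= delta^-1 by rewrite truncn_le// (le_trans _ K1).
have dK : delta^-1 < K.+1%:R by exact: truncnS_gt.
pose F (k : 'I_K) := [set y | S (y + (- (k%:R * delta)) *: e)].
have mF k : measurable (F k).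
  by rewrite /F -[X in measurable X]setTI; exact: measurable_rV_shift.
have muF k : lebesgue_rV d (F k) = lebesgue_rV d S by exact: lebesgue_rV_shift.
have tF : trivIset setT F.
  apply/trivIsetP => i j _ _ ij; apply/seteqP; split => // y [[_ /=]] + [_ /=].
  rewrite !Te => /andP[h1 h2] /andP[h3 h4].
  suff : (i : nat) = j by move=> /val_inj /eqP; rewrite (negbTE ij).
  have ltS (a b : nat) : a%:R * delta < b%:R * delta + delta -> (a <= b)%N.
    rewrite -{3}[delta]mul1r -mulrDl natr1 ltr_pM2r// ltr_nat ltnS //.
  by apply/eqP; rewrite eqn_leq; apply/andP; split; apply: ltS; lra.
have FB : \big[setU/set0]_(k < K) F k `<=` B.
  rewrite -bigcup_seq => y [k _ [+ _]] /=.
  rewrite /B !ball_rVE => h.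
  have -> : y - z = (y + - (k%:R * delta) *: e - z) + (k%:R * delta) *: e.
    by rewrite scaleNr addrAC subrK.
  apply: le_lt_trans (ler_normD _ _) _; rewrite ltr_leD//.
  rewrite normrZ ler_piMl// ger0_norm ?mulr_ge0 ?(ltW delta0)//.
  rewrite -ler_pdivlMr// div1r (le_trans _ Kd)// ler_nat ltnW//.
have : (\sum_(k < K) lebesgue_rV d (F k) <= V%:E)%E.
  rewrite fineK// -measure_bigsetU_ord//; apply: le_measure; rewrite ?inE//.
  exact: bigsetU_measurable.
have Sfin : lebesgue_rV d S \is a fin_num.
  rewrite ge0_fin_numE//; apply: le_lt_trans (lebesgue_rV_ball_lty z rho).
  apply: le_measure; rewrite ?inE//; last by move=> y [].
  by apply: open_measurable_rV; exact: ball_open.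
pose m := fine (lebesgue_rV d S).
have Sm : lebesgue_rV d S = m%:E by rewrite fineK.
under eq_bigr do rewrite muF Sm.
rewrite -/S Sm sumEFin !lee_fin sumr_const card_ord -mulr_natl => KS.
have m0 : 0 <= m by exact: fine_ge0.
have : 1 <= 2 * K%:R * delta.
  have : delta^-1 <= 2 * K%:R.
    rewrite (le_trans (ltW dK))// -natrM ler_nat mul2n -addnn -addn1 leq_add2l//.
  move=> h; have := ler_wpM2r (ltW delta0) h.
  by rewrite mulVf ?gt_eqF.
move=> h; apply: (@le_trans _ _ (m * (2 * K%:R * delta))); first by rewrite ler_peMr.
have -> : m * (2 * K%:R * delta) = 2 * (K%:R * m) * delta by ring.
by apply: ler_wpM2r; [exact: ltW|rewrite mulr_natl; lra].
Qed.

(** In a chart a point of the layer has positive height, while a point within [eps] of it has height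
    at most 0; its own height is thus at most [Lam * eps], and slabs cover the layer. For
    [eps >= eps0] the charts give nothing, and the measure of a ball containing [Omega] suffices. *)
Lemma layer_measure_le Omega s rho eps0 Lam e T :
  open Omega -> bounded_set Omega -> atlas Omega s rho eps0 Lam e T ->
  exists2 C : R, 0 < C & forall eps, 0 < eps ->
    (lebesgue_rV d (layer Omega eps) <= (C * eps)%:E)%E.
Proof.
move=> oO bO [eps00 Lam1 cov charts].
have L0 : 0 < Lam by rewrite (lt_le_trans _ Lam1).
have [M M0 OM] := pinfty_ex_gt0 bO.
pose B := ball (0 : 'rV[R]_d) (M + 1).
have mB : measurable B by apply: open_measurable_rV; exact: ball_open.
have OB : Omega `<=` B by move=> x /OM xM; rewrite /B ball_rVE subr0 (le_lt_trans xM)// ltrDl.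
have Bfin : (lebesgue_rV d B \is a fin_num)%E.
  by rewrite ge0_fin_numE// lebesgue_rV_ball_lty.
pose V := fine (lebesgue_rV d B).
have V0 : 0 <= V by exact: fine_ge0.
pose S z eps := ball z (rho z) `&` [set y | 0 < T z y <= Lam * eps].
have [C C0 CP] : exists2 C : R, 0 <= C & forall eps, 0 < eps ->
    (\sum_(z <- s) lebesgue_rV d (S z eps) <= (C * eps)%:E)%E.
  have {}charts z : z \in s -> exists2 C : R, 0 <= C & forall delta, 0 < delta ->
      (lebesgue_rV d (ball z (rho z) `&` [set y | (0 < T z y <= delta)%R]) <= (C * delta)%:E)%E.
    move=> zs; have [_ h2 h3 _] := charts _ zs.
    exact: slab_measure h2 h3.
  elim: (s) charts => [|z t IH] charts.
    by exists 0 => // eps _; rewrite big_nil mul0r.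
  have [y yt|C C0 IHC] := IH; first by apply: charts; rewrite inE yt orbT.
  have [C' C'0 h] := charts z (mem_head _ _).
  exists (C' * Lam + C) => [|eps e0].
    by rewrite addr_ge0// mulr_ge0// ltW.
  rewrite big_cons mulrDl EFinD leeD ?IHC// -mulrA; apply: h.
  by rewrite mulr_gt0.
exists (C + V / eps0 + 1).
  by rewrite ltr_wpDl// addr_ge0// divr_ge0// ltW.
move=> eps e0.
have mS z : z \in s -> measurable (S z eps).
  move=> zs; have [_ _ h3 _] := charts _ zs.
  apply: measurableI; first by apply: open_measurable_rV; exact: ball_open.
  rewrite (_ : [set _ | _] = [set y | 0 < T z y] `\` [set y | Lam * eps < T z y]).
    by apply: measurableD; apply: open_measurable_rV; exact: (lipschitz_open_gt L0 h3).
  by apply/seteqP; split => y /= => [/andP[? ?]|[-> /negP]];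
    [split => //; apply/negP; rewrite -leNgt|rewrite -leNgt].
have [ee|ee] := ltP eps eps0; last first.
  apply: (@le_trans _ _ (lebesgue_rV d B)).
    apply: le_measure; rewrite ?inE//; first exact: layer_measurable.
    by move=> x [/OB].
  rewrite -(fineK Bfin) lee_fin -/V.
  apply: (@le_trans _ _ (V / eps0 * eps)).
    by rewrite mulrAC ler_pdivlMr// ler_wpM2l.
  rewrite ler_wpM2r ?(ltW e0)//; lra.
apply: (@le_trans _ _ (C * eps)%:E); last first.
  rewrite lee_fin ler_wpM2r ?(ltW e0)// -addrA lerDl addr_ge0// divr_ge0//; exact: ltW.
apply: le_trans (CP _ e0).
have sub x : layer Omega eps x -> (\big[setU/set0]_(z <- s) S z eps) x.
  move=> [Ox [y]]; rewrite ball_rVE => xy nOy.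
  have := cov x Ox; rewrite -!bigcup_seq => -[z /= zs zx].
  exists z => //=.
  have [h1 h2 h3 h4] := charts _ zs; split => //=.
  have Tx : 0 < T z x by apply/(h1 x x zx) => //; rewrite subrr normr0.
  have Ty : T z y <= 0.
    by rewrite leNgt; apply/negP => /(h1 x y zx (lt_trans xy ee)).
  rewrite Tx /=; have := h3 x y; rewrite distrC.
  rewrite ler_norml => /andP[+ _].
  have : Lam * `|x - y| <= Lam * eps by rewrite ler_wpM2l ?(ltW L0)// distrC ltW.
  lra.
have subadd (t : seq 'rV[R]_d) : (forall z, z \in t -> measurable (S z eps)) ->
    measurable (\big[setU/set0]_(z <- t) S z eps) /\
    (lebesgue_rV d (\big[setU/set0]_(z <- t) S z eps) <=
     \sum_(z <- t) lebesgue_rV d (S z eps))%E.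
  elim: t => [|z t IH] mt; first by rewrite !big_nil measure0.
  have [|mU le] := IH; first by move=> y yt; apply: mt; rewrite inE yt orbT.
  have mz := mt z (mem_head _ _).
  rewrite !big_cons; split; first exact: measurableU.
  by apply: le_trans (measureU2 _ mz mU) _; rewrite leeD2l.
have [mU le] := subadd s mS.
by apply: le_trans le; apply: le_measure; rewrite ?inE//; exact: layer_measurable.
Qed.


End geometry.
(** * Finite differences *)

Section differences.
Context {R : realType} {d : nat}.
Implicit Types (P Q : {poly R}) (h v x : 'rV[R]_d) (g : 'rV[R]_d -> R).

(* The action of [P] on [g] when ['X] acts as the shift by [h]. *)
Definition pact P h g x : R := \sum_(i < size P) P`_i * g (x + i%:R *: h).

Lemma pact_widen n P h g x : (size P <= n)%N ->
  pact P h g x = \sum_(i < n) P`_i * g (x + i%:R *: h).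
Proof.
move=> Pn; rewrite /pact (big_ord_widen n (fun i => P`_i * g (x + i%:R *: h)) Pn).
rewrite big_mkcond; apply: eq_bigr => i _; case: ifPn => //.
by rewrite -leqNgt => /(nth_default 0) ->; rewrite mul0r.
Qed.

Lemma pactD P Q h g x : pact (P + Q) h g x = pact P h g x + pact Q h g x.
Proof.
rewrite !(@pact_widen (maxn (size P) (size Q))) ?leq_maxl ?leq_maxr ?size_polyD//.
by rewrite -big_split; apply: eq_bigr => i _; rewrite coefD mulrDl.
Qed.

Lemma pactZ a P h g x : pact (a *: P) h g x = a * pact P h g x.
Proof.
rewrite (@pact_widen (size P)) ?size_scale_leq// mulr_sumr.
by apply: eq_bigr => i _; rewrite coefZ mulrA.
Qed.

Lemma pact0 h g x : pact 0 h g x = 0.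
Proof. by rewrite /pact size_poly0 big_ord0. Qed.

Lemma pactB P Q h g x : pact (P - Q) h g x = pact P h g x - pact Q h g x.
Proof. by rewrite -scaleN1r pactD pactZ mulN1r. Qed.

Lemma pact_sum (I : Type) (s : seq I) (F : I -> {poly R}) h g x :
  pact (\sum_(i <- s) F i) h g x = \sum_(i <- s) pact (F i) h g x.
Proof.
elim: s => [|i s IH]; first by rewrite !big_nil pact0.
by rewrite !big_cons pactD IH.
Qed.

Lemma pactXnM n Q h g x : pact ('X^n * Q) h g x = pact Q h g (x + n%:R *: h).
Proof.
rewrite (@pact_widen (n + size Q)); last first.
  have [->|Q0] := eqVneq Q 0; first by rewrite mulr0 size_poly0.
  by rewrite size_monicM ?monicXn// size_polyXn addSn.
rewrite big_split_ord /= big1 ?add0r => [|i _]; last first.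
  by rewrite coefXnM ltn_ord mul0r.
apply: eq_bigr => i _; rewrite coefXnM ltnNge leq_addr /= addKn.
by rewrite natrD scalerDl addrA.
Qed.

Lemma pactXn n h g x : pact 'X^n h g x = g (x + n%:R *: h).
Proof.
rewrite -['X^n]mulr1 pactXnM /pact size_poly1 big_ord1 coef1 eqxx mul1r.
by rewrite scale0r addr0.
Qed.

Lemma pactM P Q h g x : pact (P * Q) h g x = pact P h (pact Q h g) x.
Proof.
rewrite -[P in LHS]coefK poly_def mulr_suml pact_sum; apply: eq_bigr => i _.
by rewrite -scalerAl pactZ pactXnM.
Qed.

Lemma pact_comp_Xn n P h g x : pact (P \Po 'X^n) h g x = pact P (n%:R *: h) g x.
Proof.
rewrite comp_polyE pact_sum; apply: eq_bigr => i _.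
by rewrite pactZ -exprM pactXn scalerA -natrM mulnC.
Qed.

Lemma fdiff_pact r h g x : fdiff r h g x = pact (('X - 1) ^+ r) h g x.
Proof.
rewrite addrC exprDn pact_sum /fdiff big_mkord; apply: eq_bigr => i _.
rewrite (_ : _ *+ _ = ((-1) ^+ (r - i) * 'C(r, i)%:R) *: 'X^i).
  by rewrite pactZ pactXn.
rewrite -[-1]/(- 1%:P) -polyCN -polyC_exp mul_polyC -scaler_nat scalerA.
by rewrite mulrC.
Qed.

Lemma fdiff0 h g x : fdiff 0 h g x = g x.
Proof. by rewrite /fdiff big_nat1 subn0 expr0 bin0 !mul1r scale0r addr0. Qed.

Lemma fdiffS r h g x : fdiff r.+1 h g x = fdiff r h g (x + h) - fdiff r h g x.
Proof.
rewrite !fdiff_pact exprS mulrBl mul1r pactB; congr (_ - _).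
by rewrite -{1}['X]expr1 pactXnM scale1r.
Qed.

Lemma fdiff_step0 r g x : (0 < r)%N -> fdiff r 0 g x = 0.
Proof. by case: r => // r _; rewrite fdiffS addr0 subrr. Qed.

(** Unlike in [pact], the steps may have different directions; this is needed to pass from steps [h]
    to coordinate steps. *)
Definition diffs (vs : seq 'rV[R]_d) g : 'rV[R]_d -> R :=
  foldr (fun v G x => G (x + v) - G x) g vs.

Lemma diffs_cat vs ws g : diffs (vs ++ ws) g = diffs vs (diffs ws g).
Proof. by rewrite /diffs foldr_cat. Qed.

Lemma fdiff_diffs r h g : fdiff r h g = diffs (nseq r h) g.
Proof.
elim: r => [|r IH]; apply/funext => x; first by rewrite fdiff0.
by rewrite fdiffS IH.
Qed.

Lemma diffs_step vs v g :
  diffs vs (fun x => g (x + v) - g x) = fun x => diffs vs g (x + v) - diffs vs g x.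
Proof.
elim: vs => [//|w vs IH] /=; apply/funext => x.
by rewrite IH [x + w + v]addrAC; ring.
Qed.

Lemma perm_diffs vs ws g : perm_eq vs ws -> diffs vs g = diffs ws g.
Proof.
elim: vs ws => [|v vs IH] ws; first by rewrite perm_sym => /perm_nilP ->.
move=> /[dup] /perm_mem /(_ v); rewrite mem_head => /esym/splitPr[w1 w2].
rewrite perm_sym perm_catC /= perm_cons perm_catC perm_sym => /IH {}IH.
by rewrite !diffs_cat /= diffs_step IH diffs_cat.
Qed.

Lemma fdiffC r m h v g : fdiff r h (fdiff m v g) = fdiff m v (fdiff r h g).
Proof.
by rewrite !fdiff_diffs -!diffs_cat; apply: perm_diffs; rewrite perm_catC.
Qed.

(* [('X^n - 1)^k = ('X - 1)^k S^k] with [S = 1 + ... + 'X^(n-1)], and ['X - 1]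
   divides [S^k - n^k]. *)
Lemma fdiff_doubling k n : (0 < n)%N -> exists (T : seq R),
  (size T + k <= n * k)%N /\ forall h g x,
  n%:R ^+ k * fdiff k h g x = fdiff k (n%:R *: h) g x -
    \sum_(i < size T) T`_i * fdiff k.+1 h g (x + i%:R *: h).
Proof.
move=> n0; pose S : {poly R} := \sum_(i < n) 'X^i.
have : root (S ^+ k - (n%:R ^+ k)%:P) 1.
  rewrite rootE hornerD hornerN hornerC horner_exp /S horner_sum.
  under eq_bigr do rewrite hornerXn expr1n.
  by rewrite sumr_const card_ord subrr.
move=> /factor_theorem[T TE].
(* [S ^+ k] has degree at most (n - 1) k, and dividing by 'X - 1 lowers it by one, so [size T] is at
   most (n - 1) k. Hence no difference in the sum reaches beyond x + n k h, the last point of the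
   difference with step n h. *)
exists (polyseq T); split.
  have [->|T0] := eqVneq T 0; first by rewrite size_poly0 leq_pmull.
  have /(congr1 (fun P : {poly R} => size P)) := TE.
  rewrite size_Mmonic ?monicXsubC// size_XsubC addn2 /= => sT.
  have sS : (size S <= n)%N.
    rewrite (_ : S = \poly_(i < n) 1) ?size_poly// poly_def.
    by apply: eq_bigr => i _; rewrite scale1r.
  have : (size T < (n.-1 * k).+1)%N.
    rewrite -[X in (X <= _)%N]sT; apply: leq_trans (size_polyD _ _) _.
    rewrite size_polyN geq_max; apply/andP; split; last first.
      exact: leq_trans (size_polyC_leq1 _) _.
    apply: leq_trans (size_poly_exp_leq _ _) _.
    by rewrite ltnS leq_mul2r -!subn1 leq_sub2r ?orbT.
  by rewrite ltnS => h; rewrite -[in leqRHS](prednK n0) mulSn addnC leq_add2l.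
move=> h g x.
have SX : ('X - 1) * S = 'X^n - 1 :> {poly R}.
  by rewrite subrX1; congr (_ * _).
rewrite !fdiff_pact -pact_comp_Xn -pactZ.
under eq_bigr do rewrite fdiff_pact.
rewrite -/(pact T h (pact (('X - 1) ^+ k.+1) h g) x) -pactM -pactB.
congr (pact _ h g x).
have -> : (('X - 1) ^+ k) \Po 'X^n = (('X - 1) * S) ^+ k :> {poly R}.
  by rewrite rmorphXn /= comp_polyB comp_polyX -[1 \Po _]/(1%:P \Po _) comp_polyC SX.
have -> : n%:R ^+ k *: ('X - 1) ^+ k = (n%:R ^+ k)%:P * ('X - 1) ^+ k :> {poly R}.
  by rewrite mul_polyC.
have -> : T * ('X - 1) ^+ k.+1 = (T * ('X - 1%:P)) * ('X - 1) ^+ k :> {poly R}.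
  by rewrite exprS mulrA.
rewrite -TE exprMn; ring.
Qed.

(** The coefficient of [g x] in the difference is 1 or -1, so [g x] can be isolated. With [v]
    pointing into the domain, a value near the boundary is traded for values further inside. *)
Lemma fdiff_inward m v g x :
  `|g x| <= `|fdiff m v g x| + \sum_(j < m) 'C(m, j.+1)%:R * `|g (x + j.+1%:R *: v)|.
Proof.
rewrite /fdiff big_nat_recl// subn0 bin0 mulr1 scale0r addr0 big_mkord.
set S := (X in _ <= `|_ + X| + _).
have -> : `|g x| = `|((-1) ^+ m * g x + S) - S|.
  by rewrite addrK normrM normrX normrN1 expr1n mul1r.
apply: le_trans (ler_normB _ _) _; rewrite lerD2l.
apply: le_trans (ler_norm_sum _ _ _) _; apply: ler_sum => j _.
by rewrite !normrM normrX normrN1 expr1n mul1r normr_nat.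
Qed.

End differences.

(** * Differences at points whose segments stay in the domain *)

Section segment_domains.
Context {R : realType} {d : nat}.
Implicit Types (Omega : set 'rV[R]_d) (h v x : 'rV[R]_d) (f g : 'rV[R]_d -> R).

Lemma segment_dom_in Omega N h x (i : nat) : segment_dom Omega N h x -> (i <= N)%N ->
  Omega (x + i%:R *: h).
Proof.
move=> Ox; rewrite leq_eqVlt => /predU1P[->|iN].
  by have := Ox 1; rewrite mul1r; apply; rewrite ler01 lexx.
have N0 : (0 < N)%N by exact: leq_ltn_trans iN.
have := Ox (i%:R / N%:R); rewrite divfK ?pnatr_eq0 -?lt0n//; apply.
by rewrite divr_ge0//= ler_pdivrMr ?ltr0n// mul1r ler_nat ltnW.
Qed.

Lemma segment_dom_shift Omega N r i h x : segment_dom Omega N h x -> (i + r <= N)%N ->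
  segment_dom Omega r h (x + i%:R *: h).
Proof.
move=> Ox irN t /andP[t0 t1]; rewrite -addrA -scalerDl.
have [N0|N0] := posnP N.
  have : (i + r = 0)%N by apply/eqP; rewrite -leqn0 -N0.
  move=> /eqP; rewrite addn_eq0 => /andP[/eqP -> /eqP ->].
  by have := Ox 0; rewrite lexx ler01 mul0r mulr0 addr0 => /(_ isT).
have := Ox ((i%:R + t * r%:R) / N%:R); rewrite divfK ?pnatr_eq0 -?lt0n//; apply.
rewrite divr_ge0 ?addr_ge0 ?mulr_ge0//= ler_pdivrMr ?ltr0n// mul1r.
by rewrite (@le_trans _ _ (i + r)%:R)// ?ler_nat// natrD lerD2l ler_piMl.
Qed.

Lemma segment_dom0 Omega h : segment_dom Omega 0 h = Omega.
Proof.
apply/seteqP; split => x; last by move=> Ox t _; rewrite mulr0 scale0r addr0.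
by move=> /(_ 0); rewrite mulr0 scale0r addr0; apply; rewrite lexx ler01.
Qed.

(** Compactness of the parameter interval makes the neighbourhood of [x] uniform in [t]. *)
Lemma segment_dom_open Omega r h : open Omega -> open (segment_dom Omega r h).
Proof.
move=> oO; rewrite openE => x Ox.
have := (compact_near_coveringP `[(0:R), 1]%classic).1 (@segment_compact R 0 1).
move=> /(_ _ (nbhs x) (fun y t => Omega (y + (t * r%:R) *: h))).
have H : forall t : R, `[0, 1]%classic t -> \near t & x, Omega (x + (t * r%:R) *: h).
  move=> t; rewrite /= in_itv /= => t01.
  have c : (fun z : R * 'rV[R]_d => z.2 + (z.1 * r%:R) *: h) @ (t, x) -->
      (x + (t * r%:R) *: h).
    apply: cvgD; first exact: cvg_snd.
    apply: cvgZr_tmp; apply: cvgMr_tmp; exact: cvg_fst.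
  exact: (c _ (open_nbhs_nbhs (conj oO (Ox t t01)))).
move=> /(_ _ H); apply: filterS => y Hy t t01.
by apply: Hy; rewrite /= in_itv.
Qed.

Lemma segment_dom_measurable Omega r h : open Omega -> measurable (segment_dom Omega r h).
Proof. by move=> oO; apply: open_measurable_rV; exact: segment_dom_open. Qed.

Lemma measurable_fdiff r h f : measurable_fun setT f -> measurable_fun setT (fdiff r h f).
Proof.
move=> mf; rewrite /fdiff; apply: measurable_sum => i.
apply: measurable_funM; first exact: measurable_cst.
exact: (measurableT_comp mf (measurable_rV_shift (i%:R *: h))).
Qed.

(** Factoring [('X - 1) ^+ N] through [('X - 1) ^+ r] writes the higher difference as a combination
    of translates of the lower one by i h with i <= N - r. The case [r = 0] is the bound by the
    function itself. *)
Lemma Lpow_fdiff_mono (q : R) (r N : nat) : 0 < q -> (r <= N)%N ->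
  exists2 C : R, 0 <= C & forall Omega h f, open Omega -> measurable_fun setT f ->
    (Lpow (segment_dom Omega N h) q (fdiff N h f) <=
     C%:E * Lpow (segment_dom Omega r h) q (fdiff r h f))%E.
Proof.
move=> q0 rN.
have [P [PE sP]] : exists P : {poly R}, P = ('X - 1) ^+ (N - r) /\ size P = (N - r).+1.
  by eexists; split; [reflexivity|rewrite -[1]/(1%:P) size_exp_XsubC].
exists (#|'I_(size P)|%:R `^ q * \sum_(i < size P) `|P`_i| `^ q).
  by rewrite mulr_ge0 ?powR_ge0// sumr_ge0// => i _; exact: powR_ge0.
move=> Omega h f oO mf.
apply: (@Lpow_shift_sum _ _ 'I_(size P) _ _ q _ (fdiff r h f) (fun i => P`_i)
  (fun i => i%:R *: h)) => //.
- exact: segment_dom_measurable.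
- exact: segment_dom_measurable.
- exact: measurable_fdiff.
- move=> i x Dx; apply: segment_dom_shift Dx _.
  by rewrite -(subnK rN) leq_add2r -ltnS -sP.
- move=> x _; rewrite -[X in fdiff X](subnK rN) fdiff_pact exprD pactM -PE.
  rewrite (_ : pact (('X - 1) ^+ r) h f = fdiff r h f); last first.
    by apply/funext => y; rewrite fdiff_pact.
  exact: ler_norm_sum.
Qed.

End segment_domains.
(** * Pointwise bounds from Hoelder regularity *)

Section taylor.
Context {R : realType} {d : nat}.
Implicit Types (g G : 'rV[R]_d -> R) (h v x y z : 'rV[R]_d).

Lemma derivable_shift g x u v : derivable g (x + u) v ->
  derivable (fun y => g (y + u)) x v.
Proof.
rewrite /derivable => H.
have -> : (fun h : R => h^-1 *: ((((fun y => g (y + u)) \o shift x) (h *: v)) - g (x + u))) =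
  (fun h : R => h^-1 *: ((g \o shift (x + u)) (h *: v) - g (x + u))).
  by apply/funext => a /=; rewrite addrA.
by [].
Qed.

Lemma derive_shift g x u v : 'D_v (fun y => g (y + u)) x = 'D_v g (x + u).
Proof.
rewrite /derive.
have -> : (fun h : R => h^-1 *: ((((fun y => g (y + u)) \o shift x) (h *: v)) - g (x + u))) =
  (fun h : R => h^-1 *: ((g \o shift (x + u)) (h *: v) - g (x + u))).
  by apply/funext => a /=; rewrite addrA.
by [].
Qed.

Lemma is_derive_line g y v (s : R) : derivable g (y + s *: v) v ->
  is_derive s 1 (fun t : R => g (y + t *: v)) ('D_v g (y + s *: v)).
Proof.
move=> H.
have E : (fun h : R => h^-1 *: (((fun t : R => g (y + t *: v)) \o shift s) (h *: 1) -
      g (y + s *: v))) =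
    (fun h : R => h^-1 *: ((g \o shift (y + s *: v)) (h *: v) - g (y + s *: v))).
  by apply/funext => a /=; rewrite [_ *: 1]mulr1 scalerDl addrCA.
by split; rewrite /derivable /derive E.
Qed.

Lemma line_mvt g y v (a : R) :
  (forall s : R, `|s| <= `|a| -> derivable g (y + s *: v) v) ->
  exists2 s : R, `|s| <= `|a| & g (y + a *: v) - g y = a * 'D_v g (y + s *: v).
Proof.
move=> dg.
pose F (t : R) := g (y + t *: v).
pose f (t : R) := 'D_v g (y + t *: v).
have F0 : F 0 = g y by rewrite /F scale0r addr0.
have key (b c : R) : b <= c -> (forall s, b <= s <= c -> `|s| <= `|a|) ->
    exists2 s : R, `|s| <= `|a| & F c - F b = f s * (c - b).
  move=> bc bca.
  have dF s : b <= s <= c -> is_derive s 1 F (f s).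
    by move=> /bca sa; apply: is_derive_line; exact: dg.
  have [| |s sbc ->] := @MVT_segment R F f b c bc.
  - by move=> s; rewrite in_itv/= => /andP[h1 h2]; apply: dF; rewrite !ltW.
  - apply: derivable_within_continuous => s; rewrite in_itv/= => h.
    by have [] := dF s h.
  - by exists s => //; apply: bca; rewrite in_itv/= in sbc.
have [a0|a0] := leP 0 a.
  have [|s sa E] := key 0 a a0.
    by move=> s /andP[s0 sa]; rewrite !ger0_norm.
  by exists s => //; rewrite -F0 -/(F a) E subr0 mulrC.
have [|s sa E] := key a 0 (ltW a0).
  by move=> s /andP[s1 s2]; rewrite !ler0_norm ?(ltW a0)// lerN2.
by exists s => //; rewrite -F0 -/(F a) -opprB E sub0r mulrN opprK mulrC.
Qed.

Lemma is_derive_diffs vs g v z :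
  (forall z', `|z' - z| <= \sum_(u <- vs) `|u| -> derivable g z' v) ->
  is_derive z v (diffs vs g) (diffs vs ('D_v g) z).
Proof.
elim: vs z => [|u vs IH] z H /=.
  have dz : derivable g z v by apply: H; rewrite subrr normr0 big_nil.
  by split.
have I1 : is_derive z v (diffs vs g) (diffs vs ('D_v g) z).
  by apply: IH => z' h; apply: H; rewrite big_cons (le_trans h)// lerDr.
have I2 : is_derive (z + u) v (diffs vs g) (diffs vs ('D_v g) (z + u)).
  apply: IH => z' h; apply: H; rewrite big_cons.
  have -> : z' - z = (z' - (z + u)) + u by rewrite opprD addrA subrK.
  by rewrite (le_trans (ler_normD _ _))// addrC lerD2l.
have I3 : is_derive z v (fun x => diffs vs g (x + u)) (diffs vs ('D_v g) (z + u)).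
  have [h1 h2] := I2; split; first exact: derivable_shift.
  by rewrite derive_shift.
exact: (is_deriveB I3 I1).
Qed.

Definition coord_step h (i : 'I_d) : 'rV[R]_d := h 0 i *: basis_vec i.

Lemma norm_scale_basis_vec (a : R) (i : 'I_d) : `|a *: (basis_vec i : 'rV[R]_d)| <= `|a|.
Proof.
apply: rV_norm_le => // j; rewrite !mxE normrM.
by rewrite ler_piMr//; case: (_ && _); rewrite /= ?normr1 ?normr0.
Qed.

Lemma norm_coord_step h i : `|coord_step h i| <= `|h|.
Proof. exact: le_trans (norm_scale_basis_vec _ _) (coord_le_norm _ _). Qed.

Lemma pderiv_rcons w i g : pderiv (rcons w i) g = pderiv w ('D_(basis_vec i) g).
Proof. by rewrite /pderiv foldr_rcons. Qed.

(** Each coordinate step of the word is turned by the one-dimensional mean value theorem into a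
    factor and a partial derivative, at a slightly displaced point. The letters are removed from the
    end because [pderiv] differentiates by the last letter first. The steps in [us] are carried
    along as differences. *)
Lemma diffs_word_mvt us (w : seq 'I_d) g h y :
  (forall w' i z, (size w' < size w)%N ->
     `|z - y| <= \sum_(u <- us) `|u| + (size w)%:R * `|h| ->
     derivable (pderiv w' g) z (basis_vec i)) ->
  exists2 xi, `|xi - y| <= (size w)%:R * `|h| &
    diffs (us ++ map (coord_step h) w) g y =
    (\prod_(i <- w) h 0 i) * diffs us (pderiv w g) xi.
Proof.
elim/last_ind: w g y => [|w i IH] g y dg.
  by exists y; rewrite ?cats0 ?big_nil ?mul1r// subrr normr0 mul0r.
pose vs := us ++ map (coord_step h) w.
have vsle : \sum_(u <- vs) `|u| <= \sum_(u <- us) `|u| + (size w)%:R * `|h|.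
  rewrite big_cat lerD2l big_map.
  elim: (w) => [|j t IHt]; first by rewrite big_nil mul0r.
  by rewrite big_cons /= -natr1 mulrDl mul1r addrC lerD// norm_coord_step.
have -> : diffs (us ++ map (coord_step h) (rcons w i)) g =
    diffs (coord_step h i :: vs) g.
  by apply: perm_diffs; rewrite map_rcons -cats1 catA cats1 perm_rcons.
have sw : (size (rcons w i))%:R = (size w)%:R + 1 :> R by rewrite size_rcons natr1.
have dgv (s : R) : `|s| <= `|h 0 i| ->
    is_derive (y + s *: basis_vec i) (basis_vec i) (diffs vs g)
      (diffs vs ('D_(basis_vec i) g) (y + s *: basis_vec i)).
  move=> sh; apply: is_derive_diffs => z zy.
  apply: (dg [::]); first by rewrite size_rcons.
  have -> : z - y = (z - (y + s *: basis_vec i)) + s *: basis_vec i.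
    by rewrite opprD addrA subrK.
  rewrite sw mulrDl mul1r addrA (le_trans (ler_normD _ _))// lerD ?(le_trans zy)//.
  by rewrite (le_trans (norm_scale_basis_vec _ _))// (le_trans sh)// coord_le_norm.
have [s|s sh E] := @line_mvt (diffs vs g) y (basis_vec i) (h 0 i).
  by move=> /dgv [].
have [w' j z ws zy|xi xiy E'] := IH ('D_(basis_vec i) g) (y + s *: basis_vec i).
  rewrite -pderiv_rcons; apply: dg; first by rewrite !size_rcons ltnS.
  have -> : z - y = (z - (y + s *: basis_vec i)) + s *: basis_vec i.
    by rewrite opprD addrA subrK.
  rewrite sw mulrDl mul1r addrA (le_trans (ler_normD _ _))// lerD//.
  by rewrite (le_trans (norm_scale_basis_vec _ _))// (le_trans sh)// coord_le_norm.
exists xi.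
  have -> : xi - y = (xi - (y + s *: basis_vec i)) + s *: basis_vec i.
    by rewrite opprD addrA subrK.
  rewrite sw mulrDl mul1r (le_trans (ler_normD _ _))// lerD//.
  by rewrite (le_trans (norm_scale_basis_vec _ _))// (le_trans sh)// coord_le_norm.
rewrite -cats1 big_cat big_seq1 /= E.
have [_ ->] := dgv s sh.
by rewrite E' cats1 pderiv_rcons; ring.
Qed.

Lemma diffs_shift vs g u z : diffs vs (fun x => g (x + u)) z = diffs vs g (z + u).
Proof. by elim: vs z => [//|v vs IH] z /=; rewrite !IH addrAC. Qed.

Lemma diffs_sum (I : Type) (s : seq I) vs (F : I -> 'rV[R]_d -> R) z :
  diffs vs (fun x => \sum_(i <- s) F i x) z = \sum_(i <- s) diffs vs (F i) z.
Proof. by elim: vs z => [//|v vs IH] z /=; rewrite !IH -sumrB. Qed.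

(** The corners of the path from 0 to [h] along the coordinate axes. *)
Definition row_prefix h (n : nat) : 'rV[R]_d := \row_j (if (j < n)%N then h 0 j else 0).

Lemma norm_row_prefix h n : `|row_prefix h n| <= `|h|.
Proof.
apply: rV_norm_le => // j; rewrite mxE.
by case: ifP => _; rewrite ?normr0// coord_le_norm.
Qed.

Lemma step_telescope g h x : g (x + h) - g x =
  \sum_(i < d) (g (x + row_prefix h i + coord_step h i) - g (x + row_prefix h i)).
Proof.
transitivity (\sum_(0 <= i < d) (g (x + row_prefix h i.+1) - g (x + row_prefix h i))).
  rewrite telescope_sumr//; congr (g (x + _) - g _).
    by apply/rowP => j; rewrite mxE ltn_ord.
  by rewrite [row_prefix _ _](_ : _ = 0) ?addr0//; apply/rowP => j; rewrite !mxE.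
rewrite big_mkord; apply: eq_bigr => i _; congr (g _ - _).
rewrite -addrA; congr (x + _); apply/rowP => j; rewrite !mxE eqxx /= ltnS.
rewrite -?val_eqE /=.
by case: ltngtP => [ji|ji|/val_inj ->]; rewrite ?mulr1 ?mulr0 ?addr0 ?add0r.
Qed.

(** Each of the [l] steps is split along the coordinate path into [d] coordinate steps, which gives
    [d ^ l] words; every splitting moves the base point by at most the norm of [h]. *)
Lemma fdiff_le_words (l : nat) h g y (B : R) :
  (forall w z, size w = l -> `|z - y| <= l%:R * `|h| ->
     `|diffs (map (coord_step h) w) g z| <= B) ->
  `|fdiff l h g y| <= d%:R ^+ l * B.
Proof.
elim: l g B => [|l IH] g B H.
  rewrite fdiff0 expr0 mul1r.
  by have := H [::] y erefl; rewrite subrr normr0 mul0r lexx => /(_ isT).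
have -> : fdiff l.+1 h g y = fdiff l h (fun x => g (x + h) - g x) y.
  by rewrite !fdiff_diffs -[l.+1]addn1 nseqD diffs_cat.
rewrite exprSr -mulrA; apply: IH => w z sw zy.
have -> : diffs (map (coord_step h) w) (fun x => g (x + h) - g x) z =
    \sum_(i < d) diffs (map (coord_step h) (rcons w i)) g (z + row_prefix h i).
  under eq_fun do rewrite step_telescope.
  rewrite diffs_sum; apply: eq_bigr => i _.
  rewrite -[LHS]/(diffs _ (fun x => (fun x0 => g (x0 + coord_step h i) - g x0)
    (x + row_prefix h i)) z) diffs_shift.
  by rewrite map_rcons -cats1 diffs_cat.
apply: le_trans (ler_norm_sum _ _ _) _.
rewrite mulr_natl -[X in _ *+ X]card_ord -sumr_const; apply: ler_sum => i _.
apply: H; first by rewrite size_rcons sw.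
rewrite addrAC -natr1 mulrDl mul1r (le_trans (ler_normD _ _))// lerD//.
exact: norm_row_prefix.
Qed.

Lemma fdiff_le_increment (m : nat) h g y (B : R) :
  (forall z, `|z - y| <= m%:R * `|h| -> `|g (z + h) - g z| <= B) ->
  `|fdiff m.+1 h g y| <= 2 ^+ m * B.
Proof.
elim: m y => [|m IH] y H.
  rewrite fdiffS !fdiff0 expr0 mul1r; apply: H; first by rewrite subrr normr0 mul0r.
rewrite fdiffS exprS -mulrA mulr_natl mulr2n (le_trans (ler_normB _ _))// lerD//.
  apply: IH => z zy; apply: H.
  have -> : z - y = (z - (y + h)) + h by rewrite opprD addrA subrK.
  by rewrite -natr1 mulrDl mul1r (le_trans (ler_normD _ _))// lerD.
apply: IH => z zy; apply: H; rewrite (le_trans zy)// ler_wpM2r// ler_nat//.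
Qed.

Lemma perm_word_of (w : seq 'I_d) : perm_eq w (word_of (fun i => count_mem i w)).
Proof.
apply/allP => i _; apply/eqP => /=.
rewrite /word_of count_flatten -map_comp sumnE big_map big_enum/=.
rewrite (bigD1 i)//= big1 ?addn0 => [|j ji]; last by rewrite count_nseq /= (negbTE ji).
by rewrite count_nseq /= eqxx mul1n.
Qed.

Lemma holder_quot_le (alpha : R) (K : set 'rV[R]_d) g x y (H : R) :
  (holder_quot_sup alpha K g <= H%:E)%E -> K x -> K y -> x != y ->
  `|g x - g y| <= H * enorm (x - y) `^ alpha.
Proof.
move=> gH Kx Ky xy.
have : ((`|g x - g y| / enorm (x - y) `^ alpha)%:E <= H%:E)%E.
  apply: le_trans gH; apply: ereal_sup_ubound; exists (x, y) => //=.
rewrite lee_fin ler_pdivrMr// powR_gt0// (lt_le_trans _ (norm_le_enorm _))//.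
by rewrite normr_gt0 subr_eq0.
Qed.

(** A supremum over no pairs is [-oo]; two distinct points in [K] exclude this. *)
Lemma holder_quot_ge0 (alpha : R) (K : set 'rV[R]_d) g x y :
  K x -> K y -> x != y -> (0 <= holder_quot_sup alpha K g)%E.
Proof.
move=> Kx Ky xy.
apply: (@le_trans _ _ (`|g x - g y| / enorm (x - y) `^ alpha)%:E).
  by rewrite lee_fin divr_ge0// powR_ge0.
by apply: ereal_sup_ubound; exists (x, y).
Qed.

(* Differences in coordinate directions commute, so the word of directions can be
   sorted before any derivative is taken; the symmetry of mixed partial
   derivatives is not needed. *)
Lemma holder_fdiff_le (l N : nat) (alpha : R) (K : set 'rV[R]_d) g h y (H : R) :
  (l < N)%N -> 0 <= H ->
  holder l alpha K g -> (holder_seminorm l alpha K g <= H%:E)%E ->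
  (forall z, `|z - y| <= (l + l + N)%:R * `|h| -> K z) ->
  `|fdiff N h g y| <= d%:R ^+ l * (`|h| ^+ l * (2 ^+ N * (H * enorm h `^ alpha))).
Proof.
move=> lN H0 [[dK _] _] gH yK.
have RHS0 : 0 <= 2 ^+ N * (H * enorm h `^ alpha).
  by rewrite mulr_ge0 ?exprn_ge0// mulr_ge0 ?powR_ge0.
have [h0|h0] := eqVneq h 0.
  have -> : fdiff N h g y = 0 by rewrite h0 fdiff_step0// (leq_ltn_trans _ lN).
  by rewrite normr0 mulr_ge0 ?exprn_ge0// mulr_ge0 ?exprn_ge0.
(* Of the [N] differences, [l] become derivatives, one becomes the Hoelder increment of these, and
   the others cost factors 2. In the radius, one [l] pays for splitting into words, one for the mean
   values, and [N] covers the remaining steps. *)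
have -> : fdiff N h g = fdiff l h (fdiff (N - l) h g).
  by rewrite !fdiff_diffs -diffs_cat -nseqD subnKC// ltnW.
apply: fdiff_le_words => w z sw zy.
pose nu (i : 'I_d) := count_mem i w.
pose w' := word_of nu.
have pw : perm_eq w w' by exact: perm_word_of.
have sw' : size w' = l by rewrite -(perm_size pw).
have -> : diffs [seq coord_step h i | i <- w] (fdiff (N - l) h g) =
    diffs (nseq (N - l) h ++ [seq coord_step h i | i <- w']) g.
  rewrite fdiff_diffs -diffs_cat; apply: perm_diffs.
  by rewrite perm_catC perm_cat2l perm_map.
have sus : \sum_(u <- nseq (N - l) h) `|u| = (N - l)%:R * `|h|.
  by rewrite big_nseq iter_addr_0 mulr_natl.
have [v i x vw xz|xi xiz ->] := @diffs_word_mvt (nseq (N - l) h) w' g h z.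
  apply: dK; first by rewrite -sw'.
  apply: yK; have -> : x - y = (x - z) + (z - y) by rewrite addrA subrK.
  rewrite (le_trans (ler_normD _ _))// (le_trans (lerD xz zy))//.
  rewrite sus sw' -!mulrDl -!natrD ler_wpM2r// ler_nat subnK ?(ltnW lN)//.
  by rewrite addnC leq_add2r leq_addr.
rewrite normrM; apply: ler_pM => //.
  rewrite normr_prod -sw'; elim: (w') => [|i t IH]; first by rewrite big_nil expr0.
  by rewrite big_cons /= exprS ler_pM ?prodr_ge0 ?coord_le_norm.
rewrite -fdiff_diffs.
pose nu' : {ffun 'I_d -> 'I_l.+1} := [ffun i => inord (nu i)].
have nuE i : nu' i = nu i :> nat.
  by rewrite ffunE inordK// ltnS -sw count_size.
have w'E : word_of (fun i => nu' i : nat) = w'.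
  by rewrite /w'; congr word_of; apply/funext => i; rewrite nuE.
have snu : (\sum_(i < d) nu' i)%N == l.
  apply/eqP; transitivity (size w'); last exact: sw'.
  rewrite /w' /word_of size_flatten /shape -map_comp sumnE big_map big_enum/=.
  by apply: eq_bigr => i _; rewrite nuE size_nseq.
have K0 : K y by apply: yK; rewrite subrr normr0 mulr_ge0.
have K1 : K (y + h).
  apply: yK; rewrite addrC addKr ler_peMl// ler1n.
  by rewrite addn_gt0 (leq_ltn_trans _ lN)// orbT.
have yh : y != y + h by rewrite -subr_eq0 opprD addNKr oppr_eq0.
have qH : (holder_quot_sup alpha K (pderiv w' g) <= H%:E)%E.
  apply: le_trans gH; rewrite /holder_seminorm (bigD1 nu')//= w'E leeDl//.
  by apply: sume_ge0 => i _; exact: holder_quot_ge0 K0 K1 yh.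
have -> : (N - l = (N - l.+1).+1)%N by rewrite -subSn// subSS.
apply: le_trans (fdiff_le_increment (B := H * enorm h `^ alpha) _) _; last first.
  rewrite ler_wpM2r ?mulr_ge0 ?powR_ge0// ler_eXn2l ?ltr1n//.
  by rewrite leq_subr.
move=> x xxi.
have xh : x + h != x by rewrite -subr_eq0 addrC addKr.
have := holder_quot_le qH _ _ xh.
rewrite [x + h - x]addrC addKr; apply.
  apply: yK.
  have -> : x + h - y = h + ((x - xi) + (xi - z) + (z - y)).
    by rewrite -!addrA addKr addKr addrCA addrA [h + x]addrC.
  rewrite (le_trans (ler_normD _ _))//.
  apply: le_trans (lerD (lexx _) (ler_normD _ _)) _.
  apply: le_trans (lerD (lexx _) (lerD (ler_normD _ _) (lexx _))) _.
  apply: le_trans (lerD (lexx `|h|) (lerD (lerD xxi xiz) zy)) _.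
  rewrite sw' -{1}[`|h|]mul1r -[1]/(1%:R) -!mulrDl -!natrD ler_wpM2r// ler_nat.
  by move: lN; clear; lia.
apply: yK.
have -> : x - y = ((x - xi) + (xi - z) + (z - y)) by rewrite !addrA !subrK.
apply: le_trans (ler_normD _ _) _.
apply: le_trans (lerD (ler_normD _ _) (lexx _)) _.
apply: le_trans (lerD (lerD xxi xiz) zy) _.
rewrite sw' -!mulrDl -!natrD ler_wpM2r// ler_nat.
by rewrite -addnA addnC leq_add2l leq_subr.
Qed.

End taylor.

(** * Real powers and dyadic scales *)

Section powR_extra.
Context {R : realType}.

Lemma powRDp (t x y : R) : 0 < t -> t `^ x * t `^ y = t `^ (x + y).
Proof. by move=> t0; rewrite powRD//; apply/implyP => _; rewrite gt_eqF. Qed.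

Lemma exprn_powR (a b : R) (n : nat) : 0 <= a -> (a ^+ n) `^ b = (a `^ b) ^+ n.
Proof.
move=> a0; elim: n => [|n IH]; first by rewrite !expr0 powR1.
by rewrite !exprS powRM ?exprn_ge0// IH.
Qed.

Lemma exists_dyadic (y : R) : 0 < y <= 1 ->
  exists n : nat, 2^-1 ^+ n.+1 < y <= 2^-1 ^+ n.
Proof.
move=> /andP[y0 y1].
have ex : exists n : nat, 2^-1 ^+ n.+1 < y.
  exists (Num.trunc y^-1).
  rewrite exprVn invf_plt ?posrE ?exprn_gt0//.
  apply: lt_le_trans (truncnS_gt _) _.
  by rewrite -natrX ler_nat ltnW// ltn_expl.
exists (ex_minn ex); case: ex_minnP => n -> nmin /=.
case: n nmin => [|n] nmin; first by rewrite expr0.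
by rewrite leNgt; apply/negP => /nmin; rewrite ltnn.
Qed.

End powR_extra.

(** * Differences of locally weighted Hoelder functions *)

Section holder_pointwise.
Context {R : realType} {d : nat}.
Implicit Types (Omega : set 'rV[R]_d).

(** An open set without boundary is also closed, so by connectedness a line that meets it never
    leaves it, against boundedness. The lower bound for the infimum [set_dist] requires a nonempty
    boundary. *)
Lemma boundary_nonempty Omega : (0 < d)%N -> open Omega -> bounded_set Omega ->
  Omega !=set0 -> boundary Omega !=set0.
Proof.
move=> d0 oO bO [x Ox].
apply: contrapT => /set0P/negP; rewrite negbK => /eqP b0.
have cO : closed Omega.
  move=> y cy; apply: contrapT => nOy.
  have : boundary Omega y by split => //; apply: contra_not nOy; exact: interior_subset.
  by rewrite b0.
pose v : 'rV[R]_d := delta_mx 0 (Ordinal d0).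
pose L (t : R) := x + t *: v.
have cL : continuous L.
  by move=> t; apply: cvgD; [exact: cvg_cst|apply: cvgZr_tmp; exact: cvg_id].
have /connected_intervalP : is_interval [set: R] by [].
move=> /(_ (L @^-1` Omega)) H.
have LT : L @^-1` Omega = setT.
  apply: H.
  - by exists 0; rewrite /L /= scale0r addr0.
  - exists (L @^-1` Omega); last by rewrite setTI.
    by apply: open_comp => // t _; exact: cL.
  - exists (L @^-1` Omega); last by rewrite setTI.
    by apply: closed_comp => // t _; exact: cL.
have [M M0 OM] := pinfty_ex_gt0 bO.
have OL : (L @^-1` Omega) (M + `|x| + 1) by rewrite LT.
have LM : `|L (M + `|x| + 1)| <= M := OM _ OL.
have nv : `|v| = 1.
  apply/eqP; rewrite eq_le; apply/andP; split.
    apply: rV_norm_le => // i; rewrite mxE.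
    by case: (_ && _); rewrite /= ?normr1 ?normr0.
  have := coord_le_norm v (Ordinal d0).
  by rewrite mxE !eqxx /= normr1.
have : `|(M + `|x| + 1) *: v| <= `|L (M + `|x| + 1)| + `|x|.
  have -> : (M + `|x| + 1) *: v = L (M + `|x| + 1) - x by rewrite /L [x + _]addrC addrK.
  exact: ler_normB.
rewrite normrZ nv mulr1 ger0_norm ?addr_ge0 ?(ltW M0)//.
by move=> /le_trans/(_ (lerD LM (lexx _))); lra.
Qed.

(** When [ball x eps] lies in [Omega], the closed Euclidean ball of radius eps/(2c) about [x] is
    admissible and at distance at least eps/2 from the boundary, so the weighted semi-norm controls
    the Hoelder semi-norm on it. *)
Lemma holder_loc_fdiff Omega (c alpha gamma : R) (l N : nat) :
  (0 < d)%N -> open Omega -> bounded_set Omega -> 1 < c -> 0 < gamma -> (l < N)%N ->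
  exists C0 C : R, [/\ 0 < C0, 0 < C & forall u A, 0 <= A ->
    holder_loc c Omega l alpha gamma u ->
    (holder_loc_seminorm c Omega l alpha gamma u <= A%:E)%E ->
    forall x eps h t, 0 < eps -> ball x eps `<=` Omega -> 0 < t -> enorm h <= t ->
      0 <= alpha -> C0 * t <= eps ->
      `|fdiff N h u x| <= C * A * t `^ (l%:R + alpha) * eps `^ (- gamma)].
Proof.
move=> d0 oO bO c1 g0 lN.
have c0 : 0 < c by rewrite (lt_trans _ c1).
have dd0 : 0 < (d%:R : R) by rewrite ltr0n.
(* The first constant keeps every point met by [holder_fdiff_le] within Euclidean distance eps/(2c),
   with [d] from the comparison of norms; the factor 2^gamma of the second comes from the distance
   eps/2. *)
exists (2 * c * d%:R * (l + l + N)%:R), (d%:R ^+ l * 2 ^+ N * 2 `^ gamma).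
have lN0 : 0 < ((l + l + N)%:R : R) by rewrite ltr0n addn_gt0 (leq_ltn_trans _ lN)// orbT.
split; first by rewrite !mulr_gt0.
  by rewrite mulr_gt0 ?powR_gt0// mulr_gt0// exprn_gt0.
move=> u A A0 [uh _] uA x eps h t e0 xO t0 ht a0 te.
pose rho := eps / (2 * c).
have rho0 : 0 < rho by rewrite divr_gt0// mulr_gt0.
have rhoe : rho <= eps / 2.
  rewrite /rho invfM mulrA ler_pdivrMr// ler_peMr ?divr_ge0 ?ltW//.
pose K := closed_eball x rho.
have Ox : Omega x by apply: xO; exact: ballxx.
have KO : K `<=` Omega.
  move=> y yx; apply: xO; rewrite ball_rVE.
  apply: le_lt_trans (norm_le_enorm _) _; apply: le_lt_trans yx _; lra.
have aK : admissible_balls c Omega K.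
  exists x, rho; split => // y /= yx; apply: xO; rewrite ball_rVE.
  apply: le_lt_trans (norm_le_enorm _) _; apply: lt_le_trans yx _.
  have -> : c * rho = eps / 2 by rewrite /rho; field; rewrite gt_eqF.
  lra.
have [b bb] : boundary Omega !=set0 by apply: boundary_nonempty => //; exists x.
have dist : eps / 2 <= set_dist K (boundary Omega).
  apply: lb_le_inf.
    exists (enorm (x - b)); exists (x, b) => //; split => //=.
    by rewrite /K /closed_eball /= subrr (le_trans (enorm_le_norm _))// normr0 mulr0 ltW.
  move=> _ [[y b'] [/= Ky [_ nb']] <-].
  have nOb : ~ Omega b' by move=> Ob; apply: nb'; rewrite -[X in X b'](iffLR (interior_id _) oO) in Ob.
  have bx : eps <= `|b' - x|.
    by rewrite leNgt; apply/negP => h1; apply: nOb; apply: xO; rewrite ball_rVE.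
  apply: le_trans (norm_le_enorm _).
  have yx : `|y - x| <= rho by apply: le_trans (norm_le_enorm _) _.
  have : `|b' - x| <= `|b' - y| + `|y - x|.
    by rewrite (le_trans _ (ler_normD _ _))// addrA subrK.
  by rewrite [`|b' - y|]distrC; lra.
have dist0 : 0 < set_dist K (boundary Omega) by rewrite (lt_le_trans _ dist)// divr_gt0.
pose H := A * (eps / 2) `^ (- gamma).
have H0 : 0 <= H by rewrite mulr_ge0// powR_ge0.
have KH : (holder_seminorm l alpha K u <= H%:E)%E.
  have : ((set_dist K (boundary Omega) `^ gamma)%:E * holder_seminorm l alpha K u <= A%:E)%E.
    by apply: le_trans uA; apply: ereal_sup_ubound; exists K.
  have [_ fin] := uh K aK.
  case E : (holder_seminorm l alpha K u) fin => [hs| |]//; last by rewrite leNye.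
  rewrite -EFinM !lee_fin => _ h1.
  have [hs0|hs0] := leP hs 0; first exact: le_trans hs0 H0.
  rewrite /H powRN ler_pdivlMr ?powR_gt0 ?divr_gt0//; apply: le_trans h1.
  rewrite mulrC ler_wpM2r ?(ltW hs0)//; apply: powR_le_nneg dist; first exact: ltW.
  by rewrite divr_ge0 ?ltW.
have hK z : `|z - x| <= (l + l + N)%:R * `|h| -> K z.
  move=> zx; rewrite /K /closed_eball /=; apply: le_trans (enorm_le_norm _) _.
  rewrite /rho ler_pdivlMr ?mulr_gt0//; apply: le_trans te.
  have ht' : `|h| <= t by apply: le_trans (norm_le_enorm _) ht.
  have -> : 2 * c * d%:R * (l + l + N)%:R * t = d%:R * ((l + l + N)%:R * t) * (2 * c) by ring.
  rewrite ler_wpM2r ?mulr_ge0 ?(ltW c0)// ler_wpM2l// (le_trans zx)//.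
  by rewrite ler_wpM2l.
apply: le_trans (holder_fdiff_le lN H0 (uh K aK) KH hK) _.
have ht' : `|h| <= t by apply: le_trans (norm_le_enorm _) ht.
have e1 : `|h| ^+ l <= t ^+ l by rewrite lerXn2r ?nnegrE ?(ltW t0).
have e2 : enorm h `^ alpha <= t `^ alpha by apply: powR_le_nneg => //; exact: enorm_ge0.
apply: (@le_trans _ _ (d%:R ^+ l * (t ^+ l * (2 ^+ N * (H * t `^ alpha))))).
  rewrite ler_wpM2l ?exprn_ge0// ler_pM ?exprn_ge0//.
    by rewrite mulr_ge0 ?exprn_ge0// mulr_ge0 ?powR_ge0.
  by rewrite ler_wpM2l ?exprn_ge0// ler_wpM2l.
rewrite -powRDp// powR_mulrn ?(ltW t0)// /H powRM ?invr_ge0 ?(ltW e0)//.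
have -> : 2^-1 `^ (- gamma) = 2 `^ gamma :> R.
  by rewrite -powR_inv1// -powRrM mulN1r opprK.
by rewrite le_eqVlt; apply/orP; left; apply/eqP; ring.
Qed.

End holder_pointwise.
(** * Interior and boundary layers *)

Section interior_boundary_splitting.
Context {R : realType} {d : nat}.
Implicit Types (Omega : set 'rV[R]_d) (f g : 'rV[R]_d -> R) (h x : 'rV[R]_d).
Implicit Types (t eps A : R).

Lemma Lpow_setU_le (A B C : set 'rV[R]_d) (q : R) f : 0 <= q ->
  measurable A -> measurable B -> measurable C -> measurable_fun setT f ->
  A `<=` B `|` C -> (Lpow A q f <= Lpow B q f + Lpow C q f)%E.
Proof.
move=> q0 mA mB mC mf ABC.
pose U (b : bool) := if b then B else C.
apply: le_trans (@Lpow_cover _ _ _ [:: true; false] U A q f mA _ mf _) _.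
- by case.
- by move=> x /ABC; rewrite !big_cons big_nil setU0.
rewrite !big_cons big_nil adde0; apply: leeD.
  by apply: Lpow_mono => // x [].
by apply: Lpow_mono => // x [].
Qed.

(** [Lpow_young] with [lam = A], the size of the [L_p] norm. *)
Lemma Lpow_le_lower Omega (q p A : R) f (V : R) : 0 < q -> q <= p -> 0 < A ->
  measurable Omega -> measurable_fun setT f ->
  (lebesgue_rV d Omega <= V%:E)%E -> (Lpow Omega p f <= (A `^ p)%:E)%E ->
  (Lpow Omega q f <= ((V + 1) * A `^ q)%:E)%E.
Proof.
move=> q0 qp A0 mO mf OV fA.
apply: le_trans (Lpow_young q0 qp A0 mO mf) _.
have -> : (V + 1) * A `^ q = A `^ q * V + A `^ (q - p) * A `^ p.
  by rewrite powRDp// subrK; ring.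
by rewrite EFinD !EFinM; apply: leeD; apply: lee_wpmul2l => //; rewrite lee_fin powR_ge0.
Qed.

Lemma segment_domW Omega N h x : segment_dom Omega N h x -> Omega x.
Proof. by move=> /segment_dom_in /(_ (leq0n N)); rewrite scale0r addr0. Qed.

Lemma not_layer_ball Omega eps x : Omega x -> ~ layer Omega eps x -> ball x eps `<=` Omega.
Proof.
move=> Ox nL y xy; apply: contrapT => nOy; apply: nL; split => //.
by exists y.
Qed.

Variables (Omega : set 'rV[R]_d) (V CL : R).
Hypotheses (oO : open Omega) (V0 : 0 <= V) (CL0 : 0 <= CL).
Hypothesis OV : (lebesgue_rV d Omega <= V%:E)%E.
Hypothesis layerC : forall eps, 0 < eps ->
  (lebesgue_rV d (layer Omega eps) <= (CL * eps)%:E)%E.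

Let mlayer eps : measurable (layer Omega eps) := layer_measurable eps oO.

(* [e] dominates the growth exponent [gamma * tau - 1] of the dyadic sum. *)
Lemma interior_bound (N : nat) (tau gamma e : R) : 0 < tau -> 0 < e ->
  gamma * tau - 1 <= e ->
  exists2 D : R, 0 <= D & forall g (M b : R) h, 0 <= M ->
    measurable_fun setT g ->
    (forall x eps, Omega x -> 0 < eps -> ball x eps `<=` Omega -> b <= eps ->
      `|g x| <= M * eps `^ (- gamma)) ->
    forall J : nat, b <= 2^-1 ^+ J ->
    (Lpow (segment_dom Omega N h `\` layer Omega (2^-1 ^+ J)) tau g <=
      (D * M `^ tau * (2 `^ e) ^+ J)%:E)%E.
Proof.
move=> tau0 e0 ge.
have e1 : 1 < 2 `^ e :> R.
  by have := @gt0_ltr_powR R e e0 1 2; rewrite powR1 !nnegrE; apply; rewrite ?ltr1n.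
(* [V] starts the induction on [J]; the second summand makes D (2^e - 1) dominate the contribution
   of one more shell. *)
pose D := V + (2 `^ gamma) `^ tau * CL / (2 `^ e - 1).
have D'0 : 0 <= (2 `^ gamma) `^ tau * CL / (2 `^ e - 1) :> R.
  by rewrite divr_ge0 ?mulr_ge0 ?powR_ge0// subr_ge0 ltW.
have D0 : 0 <= D by rewrite addr_ge0.
exists D => // g M b h M0 mg gM J.
pose S := segment_dom Omega N h.
have mS : measurable S by exact: segment_dom_measurable.
have i2 n : 0 < 2^-1 ^+ n :> R by rewrite exprn_gt0// invr_gt0.
elim: J => [|J IH] bJ.
  rewrite !expr0 mulr1; apply: le_trans (Lpow_bound (M := M) (ltW tau0) _ _) _.
  - exact: measurableD.
  - move=> x [Sx nL]; have Ox := segment_domW Sx.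
    have := gM x (2^-1 ^+ 0) Ox (i2 0%N) (not_layer_ball Ox nL) bJ.
    by rewrite expr0 powR1 mulr1.
  apply: (@le_trans _ _ ((M `^ tau)%:E * V%:E)%E).
    apply: lee_wpmul2l; first by rewrite lee_fin powR_ge0.
    apply: le_trans OV; apply: le_measure; rewrite ?inE.
    - exact: measurableD.
    - exact: open_measurable_rV.
    - by move=> x [/segment_domW].
  by rewrite -EFinM lee_fin mulrC ler_wpM2r ?powR_ge0// lerDl.
have bJ' : b <= 2^-1 ^+ J.
  by rewrite (le_trans bJ)// ler_wiXn2l ?invr_ge0 ?invf_le1 ?ler1n.
have {IH} := IH bJ' => IH.
(* The shell between two dyadic layers: the smaller width enters the pointwise bound, the larger one
   the measure. *)
pose B := (S `&` layer Omega (2^-1 ^+ J)) `\` layer Omega (2^-1 ^+ J.+1).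
have mB : measurable B by apply: measurableD => //; apply: measurableI.
apply: (@le_trans _ _ (Lpow (S `\` layer Omega (2^-1 ^+ J)) tau g + Lpow B tau g)%E).
  apply: Lpow_setU_le => //; [exact: ltW|exact: measurableD|exact: measurableD|].
  move=> x [Sx nL].
  by have [L|nL'] := pselect (layer Omega (2^-1 ^+ J) x); [right|left].
have BJ : (Lpow B tau g <= ((2 `^ gamma) `^ tau * CL * M `^ tau * (2 `^ e) ^+ J)%:E)%E.
  apply: le_trans (Lpow_bound (M := M * (2^-1 ^+ J.+1) `^ (- gamma)) (ltW tau0) mB _) _.
    move=> x [[Sx _] nL]; have Ox := segment_domW Sx.
    exact: (gM x _ Ox (i2 _) (not_layer_ball Ox nL) bJ).
  apply: (@le_trans _ _ (((M * (2^-1 ^+ J.+1) `^ (- gamma)) `^ tau)%:E * (CL * 2^-1 ^+ J)%:E)%E).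
    apply: lee_wpmul2l; first by rewrite lee_fin powR_ge0.
    apply: le_trans (layerC (i2 J)); apply: le_measure; rewrite ?inE//.
    by move=> x [[]].
  rewrite -EFinM lee_fin powRM ?powR_ge0//.
  have -> : (2^-1 ^+ J.+1) `^ (- gamma) = (2 `^ gamma) ^+ J.+1 :> R.
    by rewrite exprn_powR ?invr_ge0// -powR_inv1// -powRrM mulN1r opprK.
  rewrite (exprn_powR _ _ (powR_ge0 _ _)) exprS.
  set G := (2 `^ gamma) `^ tau; set Mt := M `^ tau.
  have GJ : G ^+ J * 2^-1 ^+ J <= (2 `^ e) ^+ J.
    rewrite -exprMn lerXn2r ?nnegrE ?mulr_ge0 ?powR_ge0 ?invr_ge0//.
    rewrite /G -powRrM -[2^-1]powR_inv1// powRDp//.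
    by apply: ler_powR => //; rewrite ler1n.
  have -> : Mt * (G * G ^+ J) * (CL * 2^-1 ^+ J) =
    (G * CL * Mt) * (G ^+ J * 2^-1 ^+ J) by ring.
  by rewrite ler_wpM2l// !mulr_ge0// powR_ge0.
apply: le_trans (leeD IH BJ) _.
rewrite -EFinD lee_fin exprS.
set G := (2 `^ gamma) `^ tau; set Mt := M `^ tau; set E := (2 `^ e) ^+ J.
have -> : D * Mt * E + G * CL * Mt * E = (D + G * CL) * (Mt * E) by ring.
have -> : D * Mt * (2 `^ e * E) = (D * 2 `^ e) * (Mt * E) by ring.
rewrite ler_wpM2r ?mulr_ge0 ?powR_ge0 ?exprn_ge0//.
have : G * CL <= D * (2 `^ e - 1).
  by rewrite -ler_pdivrMr ?subr_gt0// /D lerDr.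
by rewrite mulrBr mulr1; lra.
Qed.

(** The cut is made at the dyadic width w = 2^-J with w/2 < C0 t <= w. Inside, the growth rate e =
    (L - eta) tau gives t^(L tau) w^(-e), which is at most a constant times t^(eta tau). On the
    layer, of measure about t, the [L_p] bound on differences takes over. *)
Lemma splitting_bound (r N : nat) (p tau s gamma L eta C0 C1 C2 : R) :
  (r <= N)%N -> 0 < tau -> tau <= p -> 0 < C0 -> 0 <= C1 -> 0 <= C2 ->
  0 < eta -> eta < L -> gamma * tau - 1 <= (L - eta) * tau ->
  eta * tau <= s * tau - tau / p + 1 ->
  exists2 C : R, 0 < C & forall f A, 0 < A -> measurable_fun setT f ->
    (Lpow Omega p f <= (A `^ p)%:E)%E ->
    (forall t h, 0 < t -> enorm h <= t ->
      (Lpow (segment_dom Omega r h) p (fdiff r h f) <= ((C1 * A * t `^ s) `^ p)%:E)%E) ->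
    (forall x eps h t, Omega x -> 0 < eps -> ball x eps `<=` Omega -> 0 < t ->
      enorm h <= t -> C0 * t <= eps ->
      `|fdiff N h f x| <= C2 * A * t `^ L * eps `^ (- gamma)) ->
    forall t h, 0 < t -> enorm h <= t ->
    (Lpow (segment_dom Omega N h) tau (fdiff N h f) <=
      (C * A `^ tau * t `^ (eta * tau))%:E)%E.
Proof.
move=> rN tau0 taup C00 C10 C20 eta0 etaL ge etas.
have p0 : 0 < p by rewrite (lt_le_trans tau0).
have e0 : 0 < (L - eta) * tau by rewrite mulr_gt0// subr_gt0.
have [D D0 DP] := interior_bound N tau0 e0 ge.
have [K1 K10 K1P] := @Lpow_fdiff_mono R d tau 0 N tau0 (leq0n N).
have [K2 K20 K2P] := @Lpow_fdiff_mono R d p r N p0 rN.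
(* Below [t0] both t <= 1, used to lower the exponent on the layer, and C0 t <= 1, used to find [J].
   Above it the function itself bounds the difference. *)
pose t0 := Num.min 1 C0^-1.
have t00 : 0 < t0 by rewrite lt_min ltr01 invr_gt0.
pose Ca := K1 * (V + 1) / t0 `^ (eta * tau).
pose Cb := D * C2 `^ tau * C0 `^ (- ((L - eta) * tau)).
pose Cc := CL * 2 * C0 + K2 * C1 `^ p.
have Ca0 : 0 <= Ca by rewrite divr_ge0 ?powR_ge0// mulr_ge0// addr_ge0.
have Cb0 : 0 <= Cb by rewrite !mulr_ge0 ?powR_ge0.
have Cc0 : 0 <= Cc by rewrite addr_ge0 ?mulr_ge0 ?powR_ge0// ltW.
exists (Ca + Cb + Cc + 1); first by move: Ca0 Cb0 Cc0; clear; lra.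
move=> f A A0 mf fp fr fN t h t_gt0 ht.
have mO : measurable Omega by apply: open_measurable_rV.
have mg : measurable_fun setT (fdiff N h f) by exact: measurable_fdiff.
have At0 : 0 <= A `^ tau * t `^ (eta * tau) by rewrite mulr_ge0 ?powR_ge0.
have [tt0|tt0] := leP t0 t.
  apply: le_trans (K1P Omega h f oO mf) _.
  rewrite segment_dom0 (_ : fdiff 0 h f = f); last by apply/funext => x; rewrite fdiff0.
  apply: (@le_trans _ _ (K1%:E * ((V + 1) * A `^ tau)%:E)%E).
    by apply: lee_wpmul2l; [rewrite lee_fin|exact: (Lpow_le_lower tau0 taup A0 mO mf OV fp)].
  rewrite -EFinM lee_fin -mulrA.
  apply: (@le_trans _ _ (Ca * (A `^ tau * t `^ (eta * tau)))); last first.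
    by rewrite ler_wpM2r//; lra.
  rewrite /Ca.
  have -> : K1 * (V + 1) / t0 `^ (eta * tau) * (A `^ tau * t `^ (eta * tau)) =
     (K1 * ((V + 1) * A `^ tau)) * (t `^ (eta * tau) / t0 `^ (eta * tau)) by ring.
  rewrite ler_peMr ?mulr_ge0 ?powR_ge0 ?addr_ge0//.
  rewrite ler_pdivlMr ?powR_gt0// mul1r; apply: powR_le_nneg => //; last exact: ltW.
  by rewrite mulr_ge0 ?ltW.
have t1 : t <= 1 by move: tt0; rewrite lt_min => /andP[/ltW].
have C0t : 0 < C0 * t <= 1.
  rewrite mulr_gt0//= mulrC -ler_pdivlMr// div1r.
  by move: tt0; rewrite lt_min => /andP[_ /ltW].
have [J /andP[J1 J2]] := exists_dyadic C0t.
pose S := segment_dom Omega N h.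
have mS : measurable S by exact: segment_dom_measurable.
pose B := S `&` layer Omega (2^-1 ^+ J).
have mB : measurable B by exact: measurableI.
have i2 n : 0 < 2^-1 ^+ n :> R by rewrite exprn_gt0// invr_gt0.
apply: (@le_trans _ _ (Lpow (S `\` layer Omega (2^-1 ^+ J)) tau (fdiff N h f) +
    Lpow B tau (fdiff N h f))%E).
  apply: Lpow_setU_le => //; [exact: ltW|exact: measurableD|].
  move=> x Sx.
  by have [Lx|nLx] := pselect (layer Omega (2^-1 ^+ J) x); [right|left].
have inner : (Lpow (S `\` layer Omega (2^-1 ^+ J)) tau (fdiff N h f) <=
    (Cb * (A `^ tau * t `^ (eta * tau)))%:E)%E.
  have M0 : 0 <= C2 * A * t `^ L by rewrite !mulr_ge0 ?powR_ge0// ltW.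
  apply: le_trans (DP (fdiff N h f) (C2 * A * t `^ L) (C0 * t) h M0 mg _ J J2) _.
    by move=> x eps Ox eps0 xO epst; exact: (fN x eps h t).
  rewrite lee_fin.
  have -> : (C2 * A * t `^ L) `^ tau = C2 `^ tau * A `^ tau * t `^ (L * tau).
    by rewrite !powRM ?mulr_ge0 ?powR_ge0 ?(ltW A0)// -powRrM.
  have H : (2 `^ ((L - eta) * tau)) ^+ J <= C0 `^ (- ((L - eta) * tau)) * t `^ (- ((L - eta) * tau)).
    rewrite -powRM ?(ltW C00) ?(ltW t_gt0)// [leRHS]powRN.
    have -> : (2 `^ ((L - eta) * tau)) ^+ J = ((2^-1 ^+ J) `^ ((L - eta) * tau))^-1 :> R.
      by rewrite exprn_powR ?invr_ge0// -exprVn -powRN -[2^-1]powR_inv1// -powRrM mulN1r opprK.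
    rewrite lef_pV2 ?posrE ?powR_gt0 ?mulr_gt0//.
    by apply: powR_le_nneg J2; [exact: ltW|rewrite mulr_ge0 ?ltW].
  apply: (@le_trans _ _ (D * (C2 `^ tau * A `^ tau * t `^ (L * tau)) *
     (C0 `^ (- ((L - eta) * tau)) * t `^ (- ((L - eta) * tau))))).
    by rewrite ler_wpM2l// !mulr_ge0 ?powR_ge0.
  have -> : eta * tau = L * tau - (L - eta) * tau by ring.
  rewrite -(powRDp (L * tau) _ t_gt0) /Cb le_eqVlt; apply/orP; left; apply/eqP; ring.
have outer : (Lpow B tau (fdiff N h f) <= (Cc * (A `^ tau * t `^ (eta * tau)))%:E)%E.
  (* The balancing choice: lam^tau t and lam^(tau - p) (A t^s)^p are both A^tau t^(s tau - tau/p +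
     1). *)
  pose lam := A * t `^ (s - p^-1).
  have lam0 : 0 < lam by rewrite mulr_gt0// powR_gt0.
  apply: le_trans (Lpow_young tau0 taup lam0 mB mg) _.
  have muB : (lebesgue_rV d B <= (CL * 2 * C0 * t)%:E)%E.
    apply: (@le_trans _ _ (CL * 2^-1 ^+ J)%:E).
      apply: le_trans (layerC (i2 J)); apply: le_measure; rewrite ?inE//.
      by move=> x [].
    rewrite lee_fin -!mulrA ler_wpM2l//.
    by move: J1; rewrite exprS => J1; lra.
  have LB : (Lpow B p (fdiff N h f) <= (K2 * (C1 * A * t `^ s) `^ p)%:E)%E.
    apply: (@le_trans _ _ (Lpow S p (fdiff N h f))).
      by apply: Lpow_mono => //; [exact: ltW|move=> x []].
    apply: le_trans (K2P Omega h f oO mf) _.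
    rewrite EFinM; apply: lee_wpmul2l; first by rewrite lee_fin.
    exact: fr.
  apply: (@le_trans _ _ ((lam `^ tau)%:E * (CL * 2 * C0 * t)%:E +
     (lam `^ (tau - p))%:E * (K2 * (C1 * A * t `^ s) `^ p)%:E)%E).
    by apply: leeD; apply: lee_wpmul2l => //; rewrite lee_fin powR_ge0.
  rewrite -!EFinM -EFinD lee_fin.
  have -> : lam `^ tau = A `^ tau * t `^ ((s - p^-1) * tau).
    by rewrite /lam powRM ?powR_ge0 ?(ltW A0)// -powRrM.
  have -> : lam `^ (tau - p) = A `^ (tau - p) * t `^ ((s - p^-1) * (tau - p)).
    by rewrite /lam powRM ?powR_ge0 ?(ltW A0)// -powRrM.
  have -> : (C1 * A * t `^ s) `^ p = C1 `^ p * A `^ p * t `^ (s * p).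
    by rewrite !powRM ?mulr_ge0 ?powR_ge0 ?(ltW A0)// -powRrM.
  have -> : A `^ tau * t `^ ((s - p^-1) * tau) * (CL * 2 * C0 * t) =
     CL * 2 * C0 * (A `^ tau * t `^ (s * tau - tau / p + 1)).
    rewrite -(powRDp _ 1 t_gt0) powRr1 ?(ltW t_gt0)//.
    have -> : (s - p^-1) * tau = s * tau - tau / p by ring.
    ring.
  have -> : A `^ (tau - p) * t `^ ((s - p^-1) * (tau - p)) *
      (K2 * (C1 `^ p * A `^ p * t `^ (s * p))) =
      K2 * C1 `^ p * (A `^ tau * t `^ (s * tau - tau / p + 1)).
    have -> : A `^ tau = A `^ (tau - p) * A `^ p by rewrite powRDp// subrK.
    have -> : s * tau - tau / p + 1 = (s - p^-1) * (tau - p) + s * p.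
      by field; rewrite gt_eqF.
    rewrite -(powRDp ((s - p^-1) * (tau - p)) (s * p) t_gt0); ring.
  rewrite -mulrDl -/Cc ler_wpM2l// ler_wpM2l ?powR_ge0//.
  by apply: ger_powR => //; rewrite t_gt0.
apply: le_trans (leeD inner outer) _.
rewrite -EFinD lee_fin -mulrDl -mulrA ler_wpM2r//; lra.
Qed.

End interior_boundary_splitting.
(** * A Marchaud inequality *)

Section marchaud.
Context {R : realType} {d : nat}.
Implicit Types (f g : 'rV[R]_d -> R) (h v x y : 'rV[R]_d) (t A B M : R).
Variables (Omega : set 'rV[R]_d) (s : seq 'rV[R]_d) (rho : 'rV[R]_d -> R).
Variables (eps0 Lam : R) (e : 'rV[R]_d -> 'rV[R]_d) (T : 'rV[R]_d -> 'rV[R]_d -> R).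
Hypotheses (oO : open Omega) (atl : atlas Omega s rho eps0 Lam e T).

Let Lam_gt0 : 0 < Lam.
Proof. by have [_ h _ _] := atl; rewrite (lt_le_trans _ h). Qed.

(* The shift by [b *: e z] leaves room for steps in the arbitrary direction [h]. *)
Lemma atlas_inward z x w (a b : R) h : z \in s -> Omega x -> ball z (rho z) x ->
  0 < b -> Lam * (`|a| * `|h|) < b -> b * Lam + `|a| * `|h| < eps0 ->
  w = x + b *: e z + a *: h -> Omega w.
Proof.
move=> zs Ox zx b0 ab small ->.
have [_ _ _ /(_ z zs)[h1 h2 h3 h4]] := atl.
have eps00 : 0 < eps0 by have [] := atl.
have Tx : 0 < T z x by apply/(h1 x x zx) => //; rewrite subrr normr0.
apply/(h1 x _ zx).
  have -> : x + b *: e z + a *: h - x = b *: e z + a *: h.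
    by rewrite addrAC [x + _ - x]addrAC subrr add0r.
  apply: le_lt_trans (ler_normD _ _) _; apply: le_lt_trans small.
  by rewrite !normrZ lerD2r (ger0_norm (ltW b0)) ler_wpM2l// ltW.
rewrite addrAC h2.
have := h3 (x + a *: h) x; rewrite [x + _ - x]addrAC subrr add0r normrZ.
by rewrite ler_norml => /andP[+ _]; lra.
Qed.

Lemma Lpow_sum3 (A : set 'rV[R]_d) (q : R) g (f1 f2 f3 : 'rV[R]_d -> R) :
  0 < q -> measurable A -> measurable_fun setT f1 -> measurable_fun setT f2 ->
  measurable_fun setT f3 ->
  (forall x, A x -> `|g x| <= `|f1 x| + `|f2 x| + `|f3 x|) ->
  (Lpow A q g <= (3 `^ q)%:E * (Lpow A q f1 + Lpow A q f2 + Lpow A q f3))%E.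
Proof.
move=> q0 mA m1 m2 m3 gle.
pose F (i : nat) := nth f1 [:: f1; f2; f3] i.
have sum3 (G : nat -> \bar R) :
    (\sum_(i <- [:: 0%N; 1%N; 2%N]) G i = G 0%N + G 1%N + G 2%N)%E.
  by rewrite !big_cons big_nil adde0 addeA.
apply: le_trans (@Lpow_sum _ _ nat [:: 0%N; 1%N; 2%N] A q g F q0 mA _ _) _.
- by case=> [|[|[|i]]] //=; rewrite /F /= nth_nil.
- by move=> x /gle; rewrite !big_cons big_nil addr0 addrA.
by rewrite (sum3 (fun i => Lpow A q (F i))); exact: lexx.
Qed.

(** [fdiff_inward] is applied to [fdiff k h f], and only its inward values are rewritten by
    [fdiff_doubling]. The distant points of step n h are thus visited after the move by [v], and the
    bound on [size c] says how much room they need. *)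
Lemma fdiff_inward_doubling (k m n : nat) : (0 < n)%N -> exists c : seq R,
  (size c + k <= n * k)%N /\ forall f h v x,
  `|fdiff k h f x| <=
    \sum_(i < k.+1) `|(-1) ^+ (k - i) * 'C(k, i)%:R * fdiff m v f (x + i%:R *: h)| +
    \sum_(j < m) `|'C(m, j.+1)%:R / n%:R ^+ k *
        fdiff k (n%:R *: h) f (x + j.+1%:R *: v)| +
    \sum_(ji : 'I_m * 'I_(size c)) `|'C(m, ji.1.+1)%:R / n%:R ^+ k * c`_ji.2 *
        fdiff k.+1 h f (x + (ji.1.+1%:R *: v + ji.2%:R *: h))|.
Proof.
move=> n0; have [c [sc cE]] := @fdiff_doubling R d k n n0.
exists c; split => // f h v x.
have nk0 : 0 < (n%:R : R) ^+ k by rewrite exprn_gt0// ltr0n.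
apply: le_trans (fdiff_inward m v (fdiff k h f) x) _; rewrite -addrA lerD//.
  rewrite -fdiffC {1}/fdiff big_mkord.
  exact: ler_norm_sum.
rewrite -(pair_bigA _ (fun (j : 'I_m) (i : 'I_(size c)) => `|'C(m, j.+1)%:R / n%:R ^+ k * c`_i *
        fdiff k.+1 h f (x + (j.+1%:R *: v + i%:R *: h))|))/= -big_split /=.
apply: ler_sum => j _; set y := x + j.+1%:R *: v.
have -> : fdiff k h f y = (n%:R ^+ k)^-1 * (fdiff k (n%:R *: h) f y -
    \sum_(i < size c) c`_i * fdiff k.+1 h f (y + i%:R *: h)).
  by rewrite -cE mulrA mulVf ?mul1r// gt_eqF.
rewrite -{1}['C(m, j.+1)%:R]ger0_norm// -normrM mulrA mulrBr.
apply: le_trans (ler_normB _ _) _; rewrite lerD2l mulr_sumr.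
apply: le_trans (ler_norm_sum _ _ _) _; apply: ler_sum => i _.
by rewrite mulrA addrA.
Qed.

(** The factor of the n h term is explicit because it depends on [n] only through n^(-k tau), which
    drives the iteration; [t1], [E] and [lam] may depend on [n]. The inward difference also has
    order [k.+1], the order on which bounds are later assumed. *)
Lemma marchaud_chart (k n : nat) (tau : R) : (0 < n)%N -> 0 < tau ->
  exists t1 E lam : R, [/\ 0 < t1, 0 <= E, 0 < lam &
    forall z f t h, z \in s -> measurable_fun setT f -> 0 < t -> t < t1 -> enorm h <= t ->
    (Lpow (segment_dom Omega k h `&` ball z (rho z)) tau (fdiff k h f) <=
      (3 `^ tau * (k.+1%:R `^ tau * \sum_(j < k.+1) 'C(k.+1, j.+1)%:R `^ tau) *
         n%:R `^ (- (k%:R * tau)))%:E *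
        Lpow (segment_dom Omega k (n%:R *: h)) tau (fdiff k (n%:R *: h) f) +
      E%:E * (Lpow (segment_dom Omega k.+1 ((lam * t) *: e z)) tau
                (fdiff k.+1 ((lam * t) *: e z) f) +
              Lpow (segment_dom Omega k.+1 h) tau (fdiff k.+1 h f)))%E].
Proof.
move=> n0 tau0.
have [c [sc cle]] := fdiff_inward_doubling k k.+1 n0.
have [eps00 Lam1 _ _] := atl.
have nR : 0 < (n%:R : R) by rewrite ltr0n.
(* A shift by [lam * t] along [e z] raises the height by more than steps of total length (n k) t can
   lower it. *)
have [lam lamE] : exists lam : R, lam = Lam * (n * k)%:R + 1 by eexists.
have lam0 : 0 < lam by rewrite lamE ltr_wpDl// mulr_ge0// ltW.
pose m := k.+1.
(* [small * t] bounds all displacements from [x]: up to [m] inward shifts, n k steps [h] after them,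
   or [k] steps before them. Dividing [eps0] by [small + 1] keeps them in the chart. *)
pose small := m%:R * lam * Lam + (n * k)%:R + k%:R.
have small0 : 0 <= small.
  by rewrite !addr_ge0// !mulr_ge0// ltW.
pose a1 (i : 'I_k.+1) : R := (-1) ^+ (k - i) * 'C(k, i)%:R.
pose a2 (j : 'I_m) : R := 'C(m, j.+1)%:R / n%:R ^+ k.
pose a3 (ji : 'I_m * 'I_(size c)) : R := 'C(m, ji.1.+1)%:R / n%:R ^+ k * c`_ji.2.
pose E1 := #|'I_k.+1|%:R `^ tau * \sum_i `|a1 i| `^ tau.
pose E3 := #|{: 'I_m * 'I_(size c)}|%:R `^ tau * \sum_i `|a3 i| `^ tau.
have E10 : 0 <= E1 by rewrite mulr_ge0 ?powR_ge0// sumr_ge0// => i _; exact: powR_ge0.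
have E30 : 0 <= E3 by rewrite mulr_ge0 ?powR_ge0// sumr_ge0// => i _; exact: powR_ge0.
exists (eps0 / (small + 1)), (3 `^ tau * (E1 + E3)), lam; split => //.
- by rewrite divr_gt0// ltr_wpDl.
- by rewrite mulr_ge0 ?powR_ge0// addr_ge0.
move=> z f t h zs mf t0 tt1 ht.
pose v := (lam * t) *: e z.
have h_t : `|h| <= t by exact: le_trans (norm_le_enorm _) ht.
have lt0 : 0 < lam * t by rewrite mulr_gt0.
have st : small * t < eps0.
  move: tt1; rewrite ltr_pdivlMr ?ltr_wpDl// mulrDr mulr1 => h1.
  by rewrite mulrC; lra.
have inO x (j : nat) (a : R) : Omega x -> ball z (rho z) x -> (0 < j <= m)%N ->
    0 <= a <= (n * k)%:R -> Omega (x + j%:R *: v + a *: h).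
  move=> Ox zx /andP[j0 jm] /andP[a0 ank].
  have ah : `|a| * `|h| <= (n * k)%:R * t by rewrite ler_pM// ger0_norm.
  have j1 : lam * t <= j%:R * (lam * t) by rewrite ler_peMl ?(ltW lt0)// ler1n.
  have jm' : j%:R * (lam * t) <= m%:R * (lam * t) by rewrite ler_wpM2r ?(ltW lt0)// ler_nat.
  apply: (@atlas_inward z x _ a (j%:R * (lam * t)) h zs Ox zx).
  - by rewrite mulr_gt0// ltr0n.
  - apply: (le_lt_trans (ler_wpM2l (ltW Lam_gt0) ah)); apply: lt_le_trans j1.
    by rewrite lamE mulrDl mul1r mulrA ltrDl.
  - apply: le_lt_trans st; rewrite /small !mulrDl.
    have X := ler_wpM2r (ltW Lam_gt0) jm'.
    have kt0 : 0 <= k%:R * t by rewrite mulr_ge0// ltW.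
    have -> : m%:R * lam * Lam * t = m%:R * (lam * t) * Lam by ring.
    by rewrite -addrA lerD// (le_trans ah)// lerDl.
  - by rewrite scalerA.
(* From a point already in [Omega] only the size of the displacement matters, since the height does
   not decrease along [v]. *)
have inO' x (i : nat) (b : R) : Omega (x + i%:R *: h) -> ball z (rho z) x -> (i <= k)%N ->
    0 <= b <= m%:R -> Omega (x + i%:R *: h + b *: v).
  move=> Ox zx ik /andP[b0 bm].
  have [_ _ _ /(_ z zs)[h1 h2 h3 h4]] := atl.
  have ih : `|i%:R *: h| <= k%:R * t.
    by rewrite normrZ ger0_norm// ler_pM// ler_nat.
  have kt : k%:R * t < eps0.
    apply: le_lt_trans st; rewrite /small ler_wpM2r ?(ltW t0)// lerDr.
    by rewrite addr_ge0// !mulr_ge0// ltW.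
  have Tx : 0 < T z (x + i%:R *: h).
    apply/(h1 x _ zx) => //; rewrite addrAC subrr add0r.
    exact: le_lt_trans kt.
  apply/(h1 x _ zx).
    have -> : x + i%:R *: h + b *: v - x = i%:R *: h + b *: v.
      by rewrite addrAC [x + _ - x]addrAC subrr add0r.
    apply: le_lt_trans (ler_normD _ _) _; apply: le_lt_trans st.
    have bv : `|b *: v| <= m%:R * lam * Lam * t.
      have blt : 0 <= b * (lam * t) by apply: mulr_ge0 => //; exact: ltW.
      rewrite /v scalerA normrZ ger0_norm//.
      have -> : m%:R * lam * Lam * t = (m%:R * (lam * t)) * Lam by ring.
      apply: ler_pM => //; apply: ler_wpM2r => //; exact: ltW.
    apply: le_trans (lerD ih bv) _; rewrite /small !mulrDl.
    have : 0 <= (n * k)%:R * t :> R by rewrite mulr_ge0// ltW.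
    lra.
  by rewrite /v scalerA h2 ltr_pwDl// mulr_ge0// ltW.
pose S := segment_dom Omega k h.
pose A := S `&` ball z (rho z).
have mA : measurable A.
  apply: measurableI; first exact: segment_dom_measurable.
  by apply: open_measurable_rV; exact: ball_open.
pose D2 := fdiff k (n%:R *: h) f.
pose D3 := fdiff m h f.
pose D1 := fdiff m v f.
have mD1 : measurable_fun setT D1 by exact: measurable_fdiff.
have mD2 : measurable_fun setT D2 by exact: measurable_fdiff.
have mD3 : measurable_fun setT D3 by exact: measurable_fdiff.
pose P1 x := \sum_(i < k.+1) `|a1 i * D1 (x + i%:R *: h)|.
pose P2 x := \sum_(j < m) `|a2 j * D2 (x + j.+1%:R *: v)|.
pose P3 x := \sum_(ji : 'I_m * 'I_(size c)) `|a3 ji * D3 (x + (ji.1.+1%:R *: v + ji.2%:R *: h))|.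
have mP (I : finType) (a : I -> R) (F : 'rV[R]_d -> R) (u : I -> 'rV[R]_d) :
    measurable_fun setT F -> measurable_fun setT (fun x => \sum_i `|a i * F (x + u i)|).
  move=> mF; apply: measurable_sum => i; apply: measurableT_comp => //.
  apply: measurable_funM; first exact: measurable_cst.
  exact: (measurableT_comp mF (measurable_rV_shift (u i))).
have Pge0 (I : finType) (a : I -> R) (F : 'rV[R]_d -> R) (u : I -> 'rV[R]_d) x :
    `|\sum_i `|a i * F (x + u i)| | = \sum_i `|a i * F (x + u i)|.
  by rewrite ger0_norm// sumr_ge0.
have B1 : (Lpow A tau P1 <= E1%:E * Lpow (segment_dom Omega m v) tau D1)%E.
  apply: (@Lpow_shift_sum _ _ 'I_k.+1 A (segment_dom Omega m v) tau P1 D1 a1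
    (fun i => i%:R *: h)) => //.
  - exact: segment_dom_measurable.
  - move=> i x [Sx zx] a /andP[a0 a1'].
    have ik : (i <= k)%N by rewrite -ltnS.
    apply: inO' => //; first exact: segment_dom_in Sx ik.
    by rewrite mulr_ge0//= ler_piMl.
  - by move=> x _; rewrite /P1 Pge0.
have B2 : (Lpow A tau P2 <= (m%:R `^ tau * \sum_(j < m) `|a2 j| `^ tau)%:E *
     Lpow (segment_dom Omega k (n%:R *: h)) tau D2)%E.
  rewrite -[X in X%:R `^ tau]card_ord.
  apply: (@Lpow_shift_sum _ _ 'I_m A (segment_dom Omega k (n%:R *: h)) tau P2 D2 a2
    (fun j => j.+1%:R *: v)) => //.
  - exact: segment_dom_measurable.
  - move=> j x [Sx zx] a /andP[a0 a1'].
    rewrite scalerA; apply: inO; [exact: segment_domW Sx|exact: zx|exact: ltn_ord|].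
    by rewrite !mulr_ge0//= natrM mulrC ler_wpM2l// ler_piMl.
  - by move=> x _; rewrite /P2 Pge0.
have B3 : (Lpow A tau P3 <= E3%:E * Lpow (segment_dom Omega m h) tau D3)%E.
  apply: (@Lpow_shift_sum _ _ ('I_m * 'I_(size c))%type A (segment_dom Omega m h) tau P3 D3 a3
    (fun ji => ji.1.+1%:R *: v + ji.2%:R *: h)) => //.
  - exact: segment_dom_measurable.
  - move=> [j i] x [Sx zx] a /andP[a0 a1'] /=.
    rewrite addrA -[X in Omega X]addrA -scalerDl; apply: inO; [exact: segment_domW Sx|exact: zx|exact: ltn_ord|].
    rewrite addr_ge0 ?mulr_ge0//=.
    apply: (@le_trans _ _ (i%:R + m%:R)); first by rewrite lerD2l ler_piMl.
    rewrite -natrD ler_nat; apply: leq_trans sc.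
    by rewrite /m addnS -addSn leq_add2r.
  - by move=> x _; rewrite /P3 Pge0.
apply: le_trans (@Lpow_sum3 A tau (fdiff k h f) P1 P2 P3 tau0 mA _ _ _ _) _.
- exact: mP.
- exact: mP.
- exact: mP.
- by move=> x _; rewrite !Pge0; exact: cle.
apply: (@le_trans _ _ ((3 `^ tau)%:E *
  (E1%:E * Lpow (segment_dom Omega m v) tau D1 +
   (m%:R `^ tau * \sum_(j < m) `|a2 j| `^ tau)%:E *
     Lpow (segment_dom Omega k (n%:R *: h)) tau D2 +
   E3%:E * Lpow (segment_dom Omega m h) tau D3))%E).
  apply: lee_wpmul2l; first by rewrite lee_fin powR_ge0.
  exact: (leeD (leeD B1 B2) B3).
have -> : \sum_(j < m) `|a2 j| `^ tau =
    (\sum_(j < m) 'C(m, j.+1)%:R `^ tau) * n%:R `^ (- (k%:R * tau)).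
  rewrite mulr_suml; apply: eq_bigr => j _.
  rewrite /a2 ger0_norm ?divr_ge0// powRM ?invr_ge0//; congr (_ * _).
  by rewrite -powR_mulrn// -powRN -powRrM mulNr.
have := Lpow_ge0 (segment_dom Omega m v) tau D1.
have := Lpow_ge0 (segment_dom Omega k (n%:R *: h)) tau D2.
have := Lpow_ge0 (segment_dom Omega m h) tau D3.
move: (Lpow _ _ D1) (Lpow _ _ D2) (Lpow _ _ D3) => X1 X2 X3 X30 X20 X10.
set c2 := m%:R `^ tau * _.
clearbody E1 E3.
have c20 : 0 <= c2.
  by rewrite !mulr_ge0 ?powR_ge0// sumr_ge0// => j _; exact: powR_ge0.
have pos (a : R) (X : \bar R) : 0 <= a -> (0 <= X)%E -> (0 <= a%:E * X)%E.
  by move=> a0 X0; apply: mule_ge0 => //; rewrite lee_fin.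
rewrite addeAC ge0_muleDr; [|by apply: adde_ge0; apply: pos|exact: pos].
rewrite [leLHS]addeC; apply: leeD.
  by rewrite muleA -EFinM /c2 !mulrA.
rewrite EFinM -muleA; apply: lee_wpmul2l; first by rewrite lee_fin powR_ge0.
rewrite ge0_muleDr//; apply: leeD; apply: lee_wpmul2r.
- exact: X10.
- by rewrite lee_fin lerDl.
- exact: X30.
- by rewrite lee_fin lerDr.
Qed.

End marchaud.
Lemma sume_le_size {R : realType} {I : eqType} (s : seq I) (F : I -> \bar R) (X : \bar R) :
  (forall i, i \in s -> (F i <= X)%E) -> (0 <= X)%E ->
  (\sum_(i <- s) F i <= (size s)%:R%:E * X)%E.
Proof.
move=> FX X0; elim: s FX => [|i s IH] FX; first by rewrite big_nil mul0e.
rewrite big_cons /= -natr1 [((size s)%:R + 1)%R]addrC EFinD ge0_muleDl ?lee_fin// mul1e; apply: leeD.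
  by apply: FX; rewrite mem_head.
by apply: IH => j js; apply: FX; rewrite inE js orbT.
Qed.

(** * Iterating the Marchaud inequality *)

Section marchaud_iteration.
Context {R : realType} {d : nat}.
Implicit Types (f g : 'rV[R]_d -> R) (h v x y : 'rV[R]_d) (t A B M : R).
Variables (Omega : set 'rV[R]_d) (s : seq 'rV[R]_d) (rho : 'rV[R]_d -> R).
Variables (eps0 Lam : R) (e : 'rV[R]_d -> 'rV[R]_d) (T : 'rV[R]_d -> 'rV[R]_d -> R).
Hypotheses (oO : open Omega) (atl : atlas Omega s rho eps0 Lam e T).

(** [marchaud_chart] is summed over the atlas. The inward steps have Euclidean length at most
    [mu * t], so the assumed bound applies to them with [mu * t] in place of [t]. *)
Lemma marchaud_local (k : nat) (tau eta : R) : (0 < d)%N -> 0 < tau -> 0 < eta ->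
  exists2 C : R, 0 <= C & forall n : nat, (0 < n)%N ->
    exists t1 E : R, [/\ 0 < t1, 0 <= E & forall f B, 0 <= B -> measurable_fun setT f ->
      (forall t h, 0 < t -> enorm h <= t ->
        (Lpow (segment_dom Omega k.+1 h) tau (fdiff k.+1 h f) <=
          (B * t `^ (eta * tau))%:E)%E) ->
      forall t h, 0 < t -> t < t1 -> enorm h <= t ->
      (Lpow (segment_dom Omega k h) tau (fdiff k h f) <=
        (C * n%:R `^ (- (k%:R * tau)))%:E *
          Lpow (segment_dom Omega k (n%:R *: h)) tau (fdiff k (n%:R *: h) f) +
        (E * B * t `^ (eta * tau))%:E)%E].
Proof.
move=> d0 tau0 eta0; have [eps00 Lam1 cov charts] := atl.
have Lam0 : 0 < Lam by rewrite (lt_le_trans _ Lam1).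
pose C1 : R := 3 `^ tau * (k.+1%:R `^ tau * \sum_(j < k.+1) 'C(k.+1, j.+1)%:R `^ tau).
have C10 : 0 <= C1.
  by rewrite !mulr_ge0 ?powR_ge0// sumr_ge0// => j _; exact: powR_ge0.
exists ((size s)%:R * C1) => [|n n0]; first by rewrite mulr_ge0.
have [t1 [E [lam [t10 E0 lam0 HE]]]] := marchaud_chart oO atl k n0 tau0.
pose mu := lam * (d%:R * Lam).
have mu0 : 0 < mu by rewrite !mulr_gt0// ltr0n.
exists t1, ((size s)%:R * (E * (mu `^ (eta * tau) + 1))); split => //.
  by rewrite !mulr_ge0// addr_ge0// powR_ge0.
move=> f B B0 mf fB t h t0 tt1 ht.
have mS : measurable (segment_dom Omega k h) by exact: segment_dom_measurable.
apply: le_trans (@Lpow_cover _ _ _ s (fun z => ball z (rho z)) (segment_dom Omega k h)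
  tau (fdiff k h f) mS _ _ _) _.
- by move=> z; apply: open_measurable_rV; exact: ball_open.
- exact: measurable_fdiff.
- by move=> x /segment_domW /cov.
pose L := Lpow (segment_dom Omega k (n%:R *: h)) tau (fdiff k (n%:R *: h) f).
have L0 : (0 <= L)%E by exact: Lpow_ge0.
have nt0 : 0 <= C1 * n%:R `^ (- (k%:R * tau)) by rewrite mulr_ge0 ?powR_ge0.
have Bt0 : 0 <= B * t `^ (eta * tau) by rewrite mulr_ge0 ?powR_ge0.
have m10 : 0 <= mu `^ (eta * tau) + 1 by rewrite addr_ge0// powR_ge0.
pose X := ((C1 * n%:R `^ (- (k%:R * tau)))%:E * L +
   (E * (mu `^ (eta * tau) + 1) * (B * t `^ (eta * tau)))%:E)%E.
have a0 : (0 <= (C1 * n%:R `^ (- (k%:R * tau)))%:E * L)%E.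
  by apply: mule_ge0; rewrite ?lee_fin.
have b0 : (0 <= (E * (mu `^ (eta * tau) + 1) * (B * t `^ (eta * tau)))%:E)%E.
  by rewrite lee_fin mulr_ge0// mulr_ge0.
apply: le_trans (@sume_le_size R _ s _ X _ _) _.
- move=> z zs; apply: le_trans (HE z f t h zs mf t0 tt1 ht) _.
  apply: leeD; first exact: lexx.
  rewrite -mulrA EFinM; apply: lee_wpmul2l; first by rewrite lee_fin.
  rewrite mulrDl mul1r EFinD; apply: leeD; last exact: fB.
  have vt : enorm ((lam * t) *: e z) <= mu * t.
    have lt0 : 0 < lam * t by rewrite mulr_gt0.
    have -> : mu * t = lam * t * (d%:R * Lam) by rewrite /mu; ring.
    rewrite enormZ ger0_norm ?(ltW lt0)// ler_wpM2l ?(ltW lt0)//.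
    apply: le_trans (enorm_le_norm _) _; rewrite ler_wpM2l//.
    by have [] := charts z zs.
  have mut0 : 0 < mu * t by rewrite mulr_gt0.
  apply: le_trans (fB _ _ mut0 vt) _.
  by rewrite lee_fin powRM ?(ltW mu0) ?(ltW t0)// mulrCA.
- by apply: adde_ge0.
rewrite /X ge0_muleDr//; apply: leeD.
  by rewrite muleA -EFinM mulrA; exact: lexx.
rewrite -EFinM lee_fin le_eqVlt; apply/orP; left; apply/eqP; ring.
Qed.

(* [C] in [marchaud_local] does not depend on [n], so the first term is a
   contraction for [t^eta]-bounds as soon as [C * n^((eta - k) * tau) <= 1/2]. *)
Lemma marchaud_step (k : nat) (tau eta : R) : (0 < d)%N -> 0 < tau -> 0 < eta ->
  eta < k%:R -> exists2 C : R, 0 < C & forall f B, 0 <= B -> measurable_fun setT f ->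
    (Lpow Omega tau f <= B%:E)%E ->
    (forall t h, 0 < t -> enorm h <= t ->
      (Lpow (segment_dom Omega k.+1 h) tau (fdiff k.+1 h f) <=
        (B * t `^ (eta * tau))%:E)%E) ->
    forall t h, 0 < t -> enorm h <= t ->
      (Lpow (segment_dom Omega k h) tau (fdiff k h f) <=
        (C * B * t `^ (eta * tau))%:E)%E.
Proof.
move=> d0 tau0 eta0 etak.
have [C C0 HC] := marchaud_local k d0 tau0 eta0.
have [K1 K10 K1P] := @Lpow_fdiff_mono R d tau 0 k tau0 (leq0n k).
pose del := (k%:R - eta) * tau.
have del0 : 0 < del by rewrite mulr_gt0// subr_gt0.
have et0 : 0 < eta * tau by rewrite mulr_gt0.
have [n [n2 nC]] : exists n : nat, (2 <= n)%N /\ C * n%:R `^ (- del) <= 2^-1.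
  pose a := (2 * C + 1) `^ del^-1.
  exists (Num.trunc a).+2; split => //.
  have aS : a <= (Num.trunc a).+2%:R.
    by rewrite (le_trans (ltW (truncnS_gt a)))// ler_nat.
  have ha : 2 * C + 1 <= (Num.trunc a).+2%:R `^ del.
    have -> : 2 * C + 1 = a `^ del.
      by rewrite /a -powRrM mulVf ?powRr1 ?gt_eqF// addr_ge0// mulr_ge0.
    by apply: powR_le_nneg aS; [exact: ltW|exact: powR_ge0].
  rewrite powRN ler_pdivrMr ?powR_gt0//; lra.
have n0 : (0 < n)%N by exact: leq_trans n2.
have nR : 0 < (n%:R : R) by rewrite ltr0n.
have [t1 [E [t10 E0 HE]]] := HC n n0.
(* [2 * E] closes the induction through D/2 + E <= D; the first summand covers [t >= t1]. *)
pose D := K1 * t1 `^ (- (eta * tau)) + 2 * E + 1.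
have D0 : 0 < D by rewrite ltr_wpDl// addr_ge0// mulr_ge0 ?powR_ge0.
exists D => // f B B0 mf fB0 fB.
have large t h : 0 < t -> t1 <= t -> enorm h <= t ->
    (Lpow (segment_dom Omega k h) tau (fdiff k h f) <=
        (D * B * t `^ (eta * tau))%:E)%E.
  move=> t0 t1t ht; apply: le_trans (K1P Omega h f oO mf) _.
  rewrite segment_dom0 (_ : fdiff 0 h f = f); last by apply/funext => x; rewrite fdiff0.
  apply: (@le_trans _ _ (K1%:E * B%:E)%E).
    by apply: lee_wpmul2l; [rewrite lee_fin|exact: fB0].
  rewrite -EFinM lee_fin.
  have h1 : 1 <= t1 `^ (- (eta * tau)) * t `^ (eta * tau).
    rewrite powRN mulrC ler_pdivlMr ?powR_gt0// mul1r.
    by apply: powR_le_nneg => //; exact: ltW.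
  have h2 : K1 * t1 `^ (- (eta * tau)) <= D.
    rewrite /D -addrA lerDl addr_ge0// mulr_ge0//.
  have KB : 0 <= K1 * B by rewrite mulr_ge0.
  apply: (@le_trans _ _ (K1 * B * (t1 `^ (- (eta * tau)) * t `^ (eta * tau)))).
    by rewrite ler_peMr.
  have -> : K1 * B * (t1 `^ (- (eta * tau)) * t `^ (eta * tau)) =
    (K1 * t1 `^ (- (eta * tau))) * (B * t `^ (eta * tau)) by ring.
  by rewrite -[leRHS]mulrA ler_wpM2r// mulr_ge0 ?powR_ge0.
(* Induction on the number of factors [n] that carry [t] beyond [t1], so that no possibly infinite
   supremum has to be absorbed. *)
have main (m : nat) : forall t h, 0 < t -> t1 <= n%:R ^+ m * t -> enorm h <= t ->
    (Lpow (segment_dom Omega k h) tau (fdiff k h f) <=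
        (D * B * t `^ (eta * tau))%:E)%E.
  elim: m => [|m IH] t h t0 t1t ht; first by apply: large => //; rewrite expr0 mul1r in t1t.
  have [tt1|tt1] := leP t1 t; first exact: large.
  apply: le_trans (HE f B B0 mf fB t h t0 tt1 ht) _.
  have nt0 : 0 < n%:R * t by rewrite mulr_gt0.
  have nht : enorm (n%:R *: h) <= n%:R * t by rewrite enormZ ger0_norm// ler_wpM2l.
  have IH' := IH (n%:R * t) (n%:R *: h) nt0 _ nht.
  apply: (@le_trans _ _ ((C * n%:R `^ (- (k%:R * tau)))%:E *
      (D * B * (n%:R * t) `^ (eta * tau))%:E + (E * B * t `^ (eta * tau))%:E)%E).
    apply: leeD; last exact: lexx.
    apply: lee_wpmul2l; first by rewrite lee_fin mulr_ge0 ?powR_ge0.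
    by apply: IH'; rewrite mulrA -exprSr.
  rewrite -EFinM -EFinD lee_fin powRM ?(ltW t0)//.
  have -> : C * n%:R `^ (- (k%:R * tau)) * (D * B * (n%:R `^ (eta * tau) * t `^ (eta * tau))) =
     (C * n%:R `^ (- del)) * D * (B * t `^ (eta * tau)).
    have -> : - del = - (k%:R * tau) + eta * tau by rewrite /del; ring.
    rewrite -(powRDp _ _ nR); ring.
  rewrite -(mulrA E) -(mulrA D) -mulrDl ler_wpM2r ?mulr_ge0 ?powR_ge0//.
  have : C * n%:R `^ (- del) * D <= 2^-1 * D by rewrite ler_wpM2r// ltW.
  have : 2 * E <= D by rewrite /D addrAC lerDr addr_ge0// mulr_ge0// powR_ge0.
  lra.
move=> t h t0 ht; pose m := (Num.trunc (t1 / t)).+1.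
apply: (main m) => //.
rewrite -ler_pdivrMr//; apply: le_trans (ltW (truncnS_gt _)) _.
by rewrite -/m -natrX ler_nat ltnW// ltn_expl.
Qed.

Lemma marchaud (k j : nat) (tau eta : R) : (0 < d)%N -> 0 < tau -> 0 < eta ->
  eta < k%:R -> exists2 C : R, 0 < C & forall f B, 0 <= B -> measurable_fun setT f ->
    (Lpow Omega tau f <= B%:E)%E ->
    (forall t h, 0 < t -> enorm h <= t ->
      (Lpow (segment_dom Omega (k + j) h) tau (fdiff (k + j) h f) <=
        (B * t `^ (eta * tau))%:E)%E) ->
    forall t h, 0 < t -> enorm h <= t ->
      (Lpow (segment_dom Omega k h) tau (fdiff k h f) <=
        (C * B * t `^ (eta * tau))%:E)%E.
Proof.
move=> d0 tau0 eta0 etak; elim: j => [|j [C C0 IH]].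
  by exists 1 => // f B B0 mf fB0 fB t h t0 ht; rewrite mul1r -(addn0 k); exact: fB.
have kj : eta < (k + j)%:R by rewrite (lt_le_trans etak)// ler_nat leq_addr.
have [C' C'0 step] := marchaud_step d0 tau0 eta0 kj.
(* The summand 1 keeps the bound on [f] itself valid for the enlarged [B]. *)
exists (C * (C' + 1)) => [|f B B0 mf fB0 fB t h t0 ht].
  by rewrite mulr_gt0// addr_gt0.
rewrite -[C * _ * B]mulrA; apply: IH => //.
- by rewrite mulr_ge0// addr_ge0// ltW.
- by apply: le_trans fB0 _; rewrite lee_fin ler_peMl// lerDr ltW.
move=> t' h' t'0 ht'.
have := step f B B0 mf fB0 _ t' h' t'0 ht'.
rewrite -addnS => /(_ fB) /le_trans; apply.
rewrite lee_fin; apply: ler_wpM2r; first exact: powR_ge0.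
by apply: ler_wpM2r => //; rewrite lerDl.
Qed.

End marchaud_iteration.
(** * Besov semi-norms *)

Section besov_bounds.
Context {R : realType} {d : nat}.
Implicit Types (Omega A : set 'rV[R]_d) (f g : 'rV[R]_d -> R) (h x : 'rV[R]_d).

Lemma poweR_mono (x y : \bar R) (r : R) : 0 <= r -> (0 <= x)%E -> (x <= y)%E ->
  (x `^ r <= y `^ r)%E.
Proof.
move=> r0 x0 xy; apply: gt0_ler_poweR => //; rewrite in_itv/= ?x0 ?leey//.
by rewrite (le_trans x0 xy) ?leey.
Qed.

Lemma poweRK (x : \bar R) (r : R) : r != 0 -> (0 <= x)%E -> ((x `^ r) `^ r^-1)%E = x.
Proof. by move=> r0 x0; rewrite -poweRrM mulfV// poweRe1. Qed.

Lemma Lpow_le_of_Lp_norm A q f (B : R) : 0 < q ->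
  (Lp_norm A q%:E f <= B%:E)%E -> (Lpow A q f <= (B `^ q)%:E)%E.
Proof.
move=> q0; rewrite Lp_normE ?gt_eqF// => h.
rewrite -(@poweRK (Lpow A q f) q^-1) ?invr_eq0 ?gt_eqF ?Lpow_ge0// invrK.
by rewrite -poweR_EFin; apply: poweR_mono => //; [exact: ltW|exact: poweR_ge0].
Qed.

Lemma Lp_norm_le_of_Lpow A q f (B : R) : 0 < q -> 0 <= B ->
  (Lpow A q f <= (B `^ q)%:E)%E -> (Lp_norm A q%:E f <= B%:E)%E.
Proof.
move=> q0 B0 h; rewrite Lp_normE ?gt_eqF//.
rewrite -(@poweRK B%:E q) ?gt_eqF ?lee_fin//.
by apply: poweR_mono; [rewrite invr_ge0 ltW|exact: Lpow_ge0|].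
Qed.

Lemma eq_Lpow A q f g : (forall x, A x -> f x = g x) -> Lpow A q f = Lpow A q g.
Proof. by move=> fg; apply: eq_integral => x; rewrite inE => Ax; rewrite fg. Qed.

(** Every point of the difference lies in [Omega]. So a function measurable on [Omega] only may be
    replaced by its extension by zero, which is measurable everywhere. *)
Lemma fdiff_restrict Omega r h f x : segment_dom Omega r h x ->
  fdiff r h (f \_ Omega) x = fdiff r h f x.
Proof.
move=> Sx; rewrite /fdiff !big_mkord; apply: eq_bigr => i _.
by rewrite patchE mem_set//; apply: segment_dom_in Sx _; rewrite -ltnS.
Qed.

Lemma Lp_norm_le_modulus Omega r (p : \bar R) g h t : enorm h <= t ->
  (Lp_norm (segment_dom Omega r h) p (fdiff r h g) <= modulus Omega r p g t)%E.
Proof. by move=> ht; apply: ereal_sup_ubound; exists h. Qed.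

Lemma modulus_ge0 Omega r (p : \bar R) g t : 0 <= t -> (0 <= modulus Omega r p g t)%E.
Proof.
move=> t0; apply: (@le_trans _ _ (Lp_norm (segment_dom Omega r 0) p (fdiff r 0 g))).
  exact: Lnorm_ge0.
apply: Lp_norm_le_modulus.
by rewrite -[0](scale0r 0) enormZ normr0 mul0r.
Qed.

(** On [[t, 2 t]] the modulus dominates every difference with step at most [t], and the weight is at
    least its value at 2t. Integrating over this interval alone gives 2^(s p + 1) t^(s p) A^p,
    whence the constant 2^(s + 1/p). *)
Lemma besov_seminorm_difference Omega r (s p : R) g (A : R) t h :
  0 < s -> 0 < p -> 0 <= A -> (besov_seminorm Omega r s p%:E p%:E g <= A%:E)%E ->
  0 < t -> enorm h <= t ->
  (Lpow (segment_dom Omega r h) p (fdiff r h g) <=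
    (((2 `^ (s + p^-1)) * A * t `^ s) `^ p)%:E)%E.
Proof.
move=> s0 p0 A0 gA t0 ht.
set X := Lpow _ _ _; have X0 : (0 <= X)%E by exact: Lpow_ge0.
pose w (t : R) := ((t `^ (- s))%:E * modulus Omega r p%:E g t)%E.
have Iw : (\int[lebesgue_measure]_(t in `]0%R, +oo[) (w t `^ p * (t^-1)%:E) <= (A `^ p)%:E)%E.
  have I0 : (0 <= \int[lebesgue_measure]_(t in `]0%R, +oo[) (w t `^ p * (t^-1)%:E))%E.
    apply: integral_ge0 => u /=; rewrite in_itv/= andbT => u0.
    by apply: mule_ge0; [exact: poweR_ge0|rewrite lee_fin invr_ge0 ltW].
  rewrite -(@poweRK _ p^-1 _ I0) ?invr_eq0 ?gt_eqF// invrK -poweR_EFin.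
  by apply: poweR_mono gA; [exact: ltW|exact: poweR_ge0].
pose c := (2 * t) `^ (- s * p) * (2 * t)^-1.
have t2 : 0 < 2 * t by rewrite mulr_gt0.
have c0 : 0 < c by rewrite mulr_gt0 ?powR_gt0 ?invr_gt0.
have low : (c%:E * X * t%:E <= (A `^ p)%:E)%E.
  apply: le_trans Iw.
  have -> : t%:E = lebesgue_measure (`[t, (2 * t)%R]%classic : set R).
    rewrite lebesgue_measure_itv/= lte_fin ltr_pMl ?ltr1n// -EFinD; congr _%:E; ring.
  (* Measurability of the modulus in its scale has not been established, hence this form of
     monotonicity. *)
  rewrite -integral_cst//=; apply: ge0_integral_mono.
  - move=> u /=; rewrite !in_itv/= andbT => /andP[+ _]; exact: lt_le_trans.
  - move=> u /=; rewrite in_itv/= => /andP[tu ut].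
    have u0 : 0 < u by rewrite (lt_le_trans t0).
    have XM : (X <= (modulus Omega r p%:E g u) `^ p)%E.
      rewrite -(@poweRK X p^-1) ?invr_eq0 ?gt_eqF// invrK.
      apply: poweR_mono; [exact: ltW|exact: poweR_ge0|].
      rewrite /X -Lp_normE ?gt_eqF//; apply: Lp_norm_le_modulus.
      exact: le_trans tu.
    apply/andP; split; first by apply: mule_ge0 => //; rewrite lee_fin ltW.
    rewrite /w poweRM ?lee_fin ?powR_ge0 ?modulus_ge0 ?(ltW u0)//.
    rewrite poweR_EFin -powRrM muleAC -EFinM.
    apply: lee_pmul => //; first by rewrite lee_fin ltW.
    rewrite lee_fin /c ler_pM ?powR_ge0 ?invr_ge0 ?(ltW t2)//; last first.
      by rewrite lef_pV2 ?posrE.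
    rewrite mulNr !powRN lef_pV2 ?posrE ?powR_gt0//.
    by apply: powR_le_nneg ut; [rewrite mulr_ge0 ?ltW|exact: ltW].
  - move=> u /=; rewrite in_itv/= andbT => u0.
    by apply: mule_ge0; [exact: poweR_ge0|rewrite lee_fin invr_ge0 ltW].
have ct0 : 0 < c * t by rewrite mulr_gt0.
pose k := (c * t)^-1.
have kK : k * (c * t) = 1 by rewrite mulVf// gt_eqF.
have -> : X = (k%:E * (c%:E * X * t%:E))%E.
  by rewrite [(_ * X * _)%E]muleAC -EFinM muleA -EFinM kK mul1e.
apply: le_trans (lee_wpmul2l _ low) _; first by rewrite lee_fin invr_ge0 ltW.
rewrite /k -EFinM lee_fin !powRM ?mulr_ge0 ?powR_ge0//.
have -> : (c * t)^-1 = 2 * ((2 * t) `^ (s * p)).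
  rewrite /c mulNr powRN; have := powR_gt0 (s * p) t2; move=> /gt_eqF z.
  by field; rewrite z gt_eqF.
rewrite powRM ?(ltW t0)// -!powRrM.
have -> : (s + p^-1) * p = s * p + 1 by field; rewrite gt_eqF.
rewrite -(powRDp _ 1)// powRr1//.
by rewrite le_eqVlt; apply/orP; left; apply/eqP; ring.
Qed.

End besov_bounds.

(** * Integrals of power weights *)

Section power_weight_integral.
Context {R : realType}.
Local Notation mu := (@lebesgue_measure R).

Lemma integral_powR_itv (c x y : R) : c != 0 -> 0 < x -> x < y ->
  (\int[mu]_(t in `[x, y]) (t `^ (c - 1))%:E = (y `^ c / c - x `^ c / c)%:E)%E.
Proof.
move=> c0 x0 xy.
have pos t : t \in `[x, y] -> 0 < t.
  by rewrite in_itv/= => /andP[xt _]; exact: lt_le_trans xt.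
have dpow (b t : R) : 0 < t -> derivable (fun t : R => t `^ b) t 1.
  by move=> t0; apply: derivable_powR; rewrite in_itv/= t0.
have cpow (b t : R) : 0 < t -> {for t, continuous (fun t : R => t `^ b)}.
  by move=> t0; apply: differentiable_continuous; apply/derivable1_diffP; exact: dpow.
have dF t : 0 < t -> derivable (fun t : R => t `^ c / c) t 1.
  by move=> t0; apply: derivableM; [exact: dpow|exact: derivable_cst].
have cF t : 0 < t -> {for t, continuous (fun t : R => t `^ c / c)}.
  by move=> t0; apply: differentiable_continuous; apply/derivable1_diffP; exact: dF.
rewrite (@continuous_FTC2 _ (fun t => t `^ (c - 1)) (fun t => t `^ c / c) x y xy)//.
- apply: continuous_in_subspaceT => t; rewrite inE/= => /pos; exact: cpow.
- split.
  + by move=> t txy; apply: dF; apply: pos; apply: subset_itv_oo_cc.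
  + by apply: cvg_at_right_filter; exact: cF.
  + by apply: cvg_at_left_filter; apply: cF; exact: lt_trans xy.
- move=> t txy; have t0 : 0 < t by apply: pos; apply: subset_itv_oo_cc.
  rewrite derive1E deriveM//; [|exact: dpow].
  have t01 : t \in `]0, +oo[ by rewrite in_itv/= t0.
  rewrite derive_cst scaler0 add0r -derive1E (powR_derive1 c t01).
  by rewrite -[_ *: _]/(_ * _) mulrA mulVf ?mul1r.
Qed.

(** The first branch of the minimum is integrable near 0 and the second near infinity. The half-line
    is exhausted by [[1 / (n + 2), n + 2]], which has 1 in its interior and on whose two pieces
    antiderivatives are available. *)
Lemma integral_min_powR_le (a b : R) : 0 < a -> 0 < b ->
  (\int[mu]_(t in `]0%R, +oo[) (Num.min (t `^ (a - 1)) (t `^ (- b - 1)))%:E <=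
    (a^-1 + b^-1)%:E)%E.
Proof.
move=> a0 b0; pose f (t : R) := (Num.min (t `^ (a - 1)) (t `^ (- b - 1)))%:E.
have f0 t : (0 <= f t)%E by rewrite lee_fin le_min !powR_ge0.
have mf (D : set R) : measurable_fun D f.
  apply/measurable_EFinP; apply: measurable_minr.
    by apply: measurable_funTS; exact: measurable_powR.
  by apply: measurable_funTS; exact: measurable_powR.
pose S (n : nat) : set R := `[n.+2%:R^-1, n.+2%:R]%classic.
have SU : `]0%R, +oo[%classic = \bigcup_n S n.
  apply/seteqP; split => t; rewrite /= in_itv/= andbT.
    move=> t0; exists (Num.trunc t + Num.trunc t^-1)%N; rewrite // /S /= in_itv/=.
    apply/andP; split.
      rewrite invf_ple ?posrE// (le_trans (ltW (truncnS_gt _)))//.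
      by rewrite ler_nat ltnS leqW// leq_addl.
    rewrite (le_trans (ltW (truncnS_gt _)))//.
    by rewrite ler_nat ltnS leqW// leq_addr.
  by move=> [n _]; rewrite /S/= in_itv/= => /andP[h _]; apply: lt_le_trans h; rewrite invr_gt0.
rewrite SU; have cvgS : (\int[mu]_(t in S i) f t)%E @[i --> \oo] -->
    (\int[mu]_(t in \bigcup_i S i) f t)%E.
  apply: ge0_nondecreasing_set_cvg_integral => //.
  - move=> m n mn; apply/subsetPset => t; rewrite /S/= !in_itv/= => /andP[h1 h2].
    apply/andP; split.
      by apply: le_trans h1; rewrite lef_pV2 ?posrE// ler_nat !ltnS.
    by apply: le_trans h2 _; rewrite ler_nat !ltnS.
  - by move=> n; exact: measurable_itv.
  - by move=> n; exact: mf.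
rewrite -(cvg_lim _ cvgS)//; apply: lime_le; first by apply/cvg_ex; eexists; exact: cvgS.
apply: nearW => n.
have n1 : 1 < (n.+2%:R : R) by rewrite ltr1n.
have ni0 : 0 < (n.+2%:R : R)^-1 by rewrite invr_gt0.
have ni1 : (n.+2%:R : R)^-1 < 1 by rewrite invf_lt1.
have -> : S n = `[n.+2%:R^-1, 1%R]%classic `|` `]1%R, n.+2%:R]%classic.
  apply/seteqP; split => t; rewrite /S/= !in_itv/=.
    by move=> /andP[h1 h2]; have [t1|t1] := leP t 1; [left|right]; rewrite ?h1 ?h2.
  move=> [/andP[h1 h2]|/andP[h1 h2]]; apply/andP; split => //.
    by rewrite (le_trans h2)// ltW.
  by rewrite (le_trans (ltW ni1))// ltW.
rewrite ge0_integral_setU//; last first.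
  apply/disj_setPRL => t /=; rewrite !in_itv/= => /andP[t1 _] /andP[_].
  by rewrite leNgt t1.
  exact: mf.
rewrite EFinD; apply: leeD.
  apply: (@le_trans _ _ (\int[mu]_(t in `[(n.+2%:R^-1)%R, 1%R]) (t `^ (a - 1))%:E)%E).
    apply: ge0_integral_mono => [//|t _|t _]; last by rewrite lee_fin powR_ge0.
    by rewrite f0/= lee_fin ge_min lexx.
  rewrite integral_powR_itv ?gt_eqF// powR1 lee_fin mul1r gerBl.
  by rewrite divr_ge0 ?powR_ge0// ltW.
apply: (@le_trans _ _ (\int[mu]_(t in `[1%R, n.+2%:R]) (t `^ (- b - 1))%:E)%E).
  apply: ge0_integral_mono => [t|t _|t _].
  - by rewrite /= !in_itv/= => /andP[/ltW -> ->].
  - by rewrite f0/= lee_fin ge_min lexx orbT.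
  - by rewrite lee_fin powR_ge0.
rewrite integral_powR_itv// ?oppr_eq0 ?gt_eqF// powR1 lee_fin.
rewrite invrN !mulrN mul1r opprK gerDr oppr_le0.
by rewrite divr_ge0 ?powR_ge0// ltW.
Qed.

End power_weight_integral.

(** * Semi-norm bounds from bounds on differences *)

Section besov_from_differences.
Context {R : realType} {d : nat}.
Implicit Types (Omega : set 'rV[R]_d) (g : 'rV[R]_d -> R) (h : 'rV[R]_d).

Lemma modulus_powR_le Omega r (q B t : R) g : 0 < q -> 0 <= t ->
  (forall h, enorm h <= t ->
    (Lpow (segment_dom Omega r h) q (fdiff r h g) <= B%:E)%E) ->
  ((modulus Omega r q%:E g t) `^ q <= B%:E)%E.
Proof.
move=> q0 t0 H.
have B0 : 0 <= B.
  have := H 0; rewrite -[X in enorm X](scale0r 0) enormZ normr0 mul0r => /(_ t0).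
  by move=> /(le_trans (Lpow_ge0 _ _ _)); rewrite lee_fin.
rewrite -(@poweRK R B%:E q^-1) ?invr_eq0 ?gt_eqF ?lee_fin// invrK.
apply: poweR_mono; [exact: ltW|exact: modulus_ge0|].
apply: ub_ereal_sup => _ [h /= ht <-].
apply: Lp_norm_le_of_Lpow => //; first exact: powR_ge0.
by rewrite -powRrM mulVf ?gt_eqF// powRr1//; exact: H.
Qed.

(** The power bound makes the integral converge at 0, as [eta > sigma], and the constant bound makes
    it converge at infinity, as [sigma > 0]. Both hold for all [t], so their minimum may be
    integrated. *)
Lemma besov_seminorm_le_differences Omega r (sigma eta tau K : R) g :
  0 < tau -> 0 < sigma -> sigma < eta -> 0 <= K ->
  (forall t h, 0 < t -> enorm h <= t ->
    (Lpow (segment_dom Omega r h) tau (fdiff r h g) <= (K * t `^ (eta * tau))%:E)%E) ->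
  (forall t h, 0 < t -> enorm h <= t ->
    (Lpow (segment_dom Omega r h) tau (fdiff r h g) <= K%:E)%E) ->
  (besov_seminorm Omega r sigma tau%:E tau%:E g <=
    ((K * (((eta - sigma) * tau)^-1 + (sigma * tau)^-1)) `^ tau^-1)%:E)%E.
Proof.
move=> tau0 sigma0 se K0 H1 H2.
pose a := (eta - sigma) * tau; pose b := sigma * tau.
have a0 : 0 < a by rewrite mulr_gt0// subr_gt0.
have b0 : 0 < b by rewrite mulr_gt0.
rewrite /besov_seminorm -poweR_EFin; apply: poweR_mono.
- by rewrite invr_ge0 ltW.
- apply: integral_ge0 => t /=; rewrite in_itv/= andbT => t0.
  by apply: mule_ge0; [exact: poweR_ge0|rewrite lee_fin invr_ge0 ltW].
have J := integral_min_powR_le a0 b0.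
apply: (@le_trans _ _ (\int[lebesgue_measure]_(t in `]0%R, +oo[)
    (K%:E * (Num.min (t `^ (a - 1)) (t `^ (- b - 1)))%:E))%E); last first.
  rewrite ge0_integralZl//.
  - by rewrite EFinM; apply: lee_wpmul2l => //; rewrite lee_fin.
  - apply/measurable_EFinP; apply: measurable_minr;
      by apply: measurable_funTS; exact: measurable_powR.
  - by move=> t _; rewrite lee_fin le_min !powR_ge0.
apply: ge0_integral_mono => [//|t|t _]; last first.
  by rewrite -EFinM lee_fin mulr_ge0// le_min !powR_ge0.
rewrite /= in_itv/= andbT => t0; apply/andP; split.
  by apply: mule_ge0; [exact: poweR_ge0|rewrite lee_fin invr_ge0 ltW].
rewrite poweRM ?lee_fin ?powR_ge0 ?modulus_ge0 ?(ltW t0)//.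
have key (B : R) : ((modulus Omega r tau%:E g t) `^ tau <= B%:E)%E ->
    ((t `^ (- sigma))%:E `^ tau * modulus Omega r tau%:E g t `^ tau * (t^-1)%:E <=
      (B * t `^ (- b - 1))%:E)%E.
  move=> HB; rewrite poweR_EFin -powRrM mulNr -/b.
  have -> : B * t `^ (- b - 1) = t `^ (- b) * B * t^-1.
    by rewrite -(powRDp _ _ t0) powR_inv1 ?(ltW t0)//; ring.
  rewrite !EFinM; apply: lee_wpmul2r; first by rewrite lee_fin invr_ge0 ltW.
  by apply: lee_wpmul2l => //; rewrite lee_fin powR_ge0.
rewrite -EFinM minr_pMr//.
have m1 := modulus_powR_le tau0 (ltW t0) (fun h => H1 t h t0).
have m2 := modulus_powR_le tau0 (ltW t0) (fun h => H2 t h t0).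
have k1 := key _ m1; have k2 := key _ m2.
rewrite /Num.min; case: ifP => _; last exact: k2.
apply: le_trans k1 _; rewrite lee_fin -mulrA powRDp//.
by rewrite (_ : eta * tau + (- b - 1) = a - 1)// /a /b; ring.
Qed.

End besov_from_differences.

(** [eta0] collects the constraints: [r'] from lowering the order, [L] from the Hoelder smoothness,
    L - gamma + 1/tau from the interior sum, s + sigma/d from the layer. In each case of
    [sigma_star] one of the second and third is assumed, and the threshold for [gamma] makes it
    imply the other. *)
Lemma exists_exponent {R : realType} (d r' l : nat) (s p alpha gamma sigma tau : R) :
  (2 <= d)%N -> 0 < s -> 1 < p -> 0 < sigma -> 0 < tau ->
  sigma < Num.min (sigma_star d l alpha p gamma) (d%:R / (d%:R - 1) * s) ->
  tau^-1 = sigma / d%:R + p^-1 -> Num.floor sigma + 1 <= r'%:Z ->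
  exists eta : R, [/\ sigma < eta, eta < r'%:R, eta < l%:R + alpha,
    gamma * tau - 1 <= (l%:R + alpha - eta) * tau &
    eta * tau <= s * tau - tau / p + 1].
Proof.
move=> d2 s0 p1 sigma0 tau0 + tauE rsigma.
set L := l%:R + alpha; set D : R := d%:R.
have D2 : 2 <= D by rewrite ler_nat.
have D1 : 0 < D - 1 by lra.
have D0 : 0 < D by lra.
rewrite lt_min => /andP[sL ss].
have sigr : sigma < r'%:R.
  apply: (@lt_le_trans _ _ (Num.floor sigma + 1)%:~R); first exact: floorD1_gt.
  by rewrite -[r'%:R]/((r'%:Z)%:~R) ler_int.
have L1 : sigma < L.
  move: sL; rewrite /sigma_star -/L -/D; case: (ltP gamma (L / D + p^-1)) => // g sL.
  apply: lt_le_trans sL _; rewrite mulrAC ler_pdivrMr//.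
  have : D * (L / D + p^-1) <= D * gamma by rewrite ler_pM2l.
  rewrite mulrDr mulrCA divff ?mulr1 ?gt_eqF//; lra.
(* The factor d/(d - 1) accounts exactly for the term sigma/d in 1/tau. *)
have key x : sigma < D / (D - 1) * x -> sigma - sigma / D < x.
  rewrite mulrAC ltr_pdivlMr// => h.
  have -> : sigma - sigma / D = (sigma * (D - 1)) / D by field; rewrite gt_eqF.
  by rewrite ltr_pdivrMr// [x * D]mulrC.
have L2 : sigma < L - gamma + tau^-1.
  rewrite tauE; suff : sigma - sigma / D < L + p^-1 - gamma by lra.
  move: sL; rewrite /sigma_star -/L -/D; case: (ltP gamma (L / D + p^-1)) => [g _|_ /key//].
  have : sigma * (1 - D^-1) < L * (1 - D^-1).
    by rewrite ltr_pM2r// subr_gt0 invf_lt1//; lra.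
  by rewrite !mulrBr !mulr1; lra.
have L3 : sigma < s + sigma / D by have := key _ ss; lra.
pose eta0 := Num.min (Num.min r'%:R L) (Num.min (L - gamma + tau^-1) (s + sigma / D)).
have e0 : sigma < eta0 by rewrite !lt_min sigr L1 L2 L3.
have : (sigma + eta0) / 2 < eta0 by lra.
rewrite {2}/eta0 !lt_min => /andP[/andP[h1 h2] /andP[h3 h4]].
exists ((sigma + eta0) / 2).
move: h1 h2 h3 h4; set eta := (sigma + eta0) / 2 => h1 h2 h3 h4.
have se : sigma < eta by rewrite /eta; lra.
split => //.
  have : (eta - (L - gamma)) * tau <= tau^-1 * tau.
    by rewrite ler_wpM2r ?(ltW tau0)//; lra.
  rewrite mulVf ?gt_eqF//.
  have -> : (L - eta) * tau = gamma * tau - (eta - (L - gamma)) * tau by ring.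
  lra.
have : eta * tau <= (s + (tau^-1 - p^-1)) * tau.
  by rewrite ler_wpM2r ?(ltW tau0)// tauE; lra.
have -> : (s + (tau^-1 - p^-1)) * tau = s * tau - tau / p + tau^-1 * tau by ring.
by rewrite mulVf ?gt_eqF.
Qed.

(** * Assembly of the estimates *)

Lemma besov_norm_bound (R : realType) (d : nat) (hd : (2 <= d)%N)
  (Omega : set 'rV[R]_d) (hOmega : lipschitz_domain Omega)
  (hbOmega : bounded_set Omega)
  (s p : R) (hs : 0 < s) (hp : 1 < p)
  (l : nat) (alpha : R) (halpha0 : 0 < alpha)
  (gamma : R) (hgamma0 : 0 < gamma)
  (sigma tau : R) (hsigma0 : 0 < sigma)
  (hsigma1 : sigma <
     Num.min (sigma_star d l alpha p gamma) (d%:R / (d%:R - 1) * s))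
  (htau : tau^-1 = sigma / d%:R + p^-1)
  (c : R) (hc : 1 < c)
  (r r' : nat) (hr' : Num.floor sigma + 1 <= r'%:Z) :
  exists C1 C2 : R, [/\ 0 <= C1, 0 <= C2 & forall (u : 'rV[R]_d -> R) (A : R), 0 < A ->
      measurable_fun Omega u ->
      (besov_norm Omega r s p%:E p%:E u <= A%:E)%E ->
      holder_loc c Omega l alpha gamma u ->
      (holder_loc_seminorm c Omega l alpha gamma u <= A%:E)%E ->
      (Lp_norm Omega tau%:E u <= (C1 * A)%:E)%E /\
      (besov_seminorm Omega r' sigma tau%:E tau%:E u <= (C2 * A)%:E)%E].
Proof.
have d0 : (0 < d)%N by exact: leq_trans hd.
have D0 : 0 < (d%:R : R) by rewrite ltr0n.
have p0 : 0 < p by rewrite (lt_trans _ hp).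
have [[oO _] lO] := hOmega.
have tau0 : 0 < tau.
  by rewrite -invr_gt0 htau addr_gt0 ?invr_gt0// divr_gt0.
have taup : tau <= p.
  by rewrite -[tau]invrK -[leRHS]invrK lef_pV2 ?posrE ?invr_gt0// htau lerDr divr_ge0 ?ltW.
have [eta [se er eL ge etas]] := exists_exponent hd hs hp hsigma0 tau0 hsigma1 htau hr'.
have eta0 : 0 < eta by rewrite (lt_trans hsigma0).
have mO : measurable Omega by apply: open_measurable_rV.
have [sq [rho [eps0 [Lam [e [T atl]]]]]] := exists_atlas d0 oO lO hbOmega.
have [CL CL0 layerC] := layer_measure_le oO hbOmega atl.
have [M M0 OM] := pinfty_ex_gt0 hbOmega.
pose Bl := ball (0 : 'rV[R]_d) (M + 1).
have mBl : measurable Bl by apply: open_measurable_rV; exact: ball_open.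
have Bfin : (lebesgue_rV d Bl \is a fin_num)%E.
  by rewrite ge0_fin_numE// lebesgue_rV_ball_lty.
pose V := fine (lebesgue_rV d Bl).
have V0 : 0 <= V by apply: fine_ge0.
have OV : (lebesgue_rV d Omega <= V%:E)%E.
  rewrite fineK//; apply: le_measure; rewrite ?inE// => x /OM xM.
  by rewrite /Bl ball_rVE subr0 (le_lt_trans xM)// ltrDl.
(* At least [r] for the [L_p] differences, above [l] for the Hoelder bound, and of the form [r']
   plus something so that [marchaud] descends to [r']. *)
pose N := (r' + maxn r l.+1)%N.
have rN : (r <= N)%N by rewrite (leq_trans (leq_maxl r l.+1))// leq_addl.
have lN : (l < N)%N by rewrite (leq_trans (leq_maxr r l.+1))// leq_addl.
have [C0 [Ch [C00 Ch0 HCh]]] :=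
  @holder_loc_fdiff R d Omega c alpha gamma l N d0 oO hbOmega hc hgamma0 lN.
(* The extra N + 1 keeps the segment from x to x + N h inside [ball x eps], so that the differences
   of [f] and [u] agree at x. *)
pose C0' := C0 + N%:R + 1.
have C0'0 : 0 < C0' by rewrite /C0' -addrA ltr_pwDl// addr_ge0.
have C1p0 : 0 <= 2 `^ (s + p^-1) :> R by exact: powR_ge0.
have [Cs Cs0 HCs] := splitting_bound oO V0 (ltW CL0) OV layerC rN tau0 taup C0'0 C1p0
  (ltW Ch0) eta0 eL ge etas.
have [Cm Cm0 HCm] := marchaud oO atl (maxn r l.+1) d0 tau0 eta0 er.
have [K1 K10 K1P] := @Lpow_fdiff_mono R d tau 0 r' tau0 (leq0n r').
pose B0 := V + 1 + Cs.
have B00 : 0 < B0 by rewrite ltr_wpDl// addr_ge0.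
pose K0 := Cm * B0 + K1 * B0.
have K00 : 0 <= K0 by apply: addr_ge0; apply: mulr_ge0 => //; exact: ltW.
pose I0 := ((eta - sigma) * tau)^-1 + (sigma * tau)^-1.
have I00 : 0 <= I0.
  by apply: addr_ge0; rewrite invr_ge0; apply: mulr_ge0; rewrite ?subr_ge0 ltW.
exists ((V + 1) `^ tau^-1), ((K0 * I0) `^ tau^-1); split; [exact: powR_ge0|exact: powR_ge0|].
move=> u A A0 mu uB uh uH.
pose f := u \_ Omega.
have mf : measurable_fun setT f by apply/(measurable_restrictT u mO).
have fE x : Omega x -> f x = u x by move=> Ox; rewrite /f patchE mem_set.
have LfE q : Lpow Omega q f = Lpow Omega q u by apply: eq_Lpow => x; exact: fE.
have DfE q k h : Lpow (segment_dom Omega k h) q (fdiff k h f) =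
    Lpow (segment_dom Omega k h) q (fdiff k h u).
  by apply: eq_Lpow => x; exact: fdiff_restrict.
have Np0 : (0 <= Lp_norm Omega p%:E u)%E by exact: Lnorm_ge0.
have Bp0 : (0 <= besov_seminorm Omega r s p%:E p%:E u)%E by exact: poweR_ge0.
have uLp : (Lp_norm Omega p%:E u <= A%:E)%E by apply: le_trans uB; rewrite leeDl.
have uBp : (besov_seminorm Omega r s p%:E p%:E u <= A%:E)%E by apply: le_trans uB; rewrite leeDr.
have fp : (Lpow Omega p f <= (A `^ p)%:E)%E by rewrite LfE; exact: Lpow_le_of_Lp_norm.
have At0 : 0 <= A `^ tau by exact: powR_ge0.
have ftau : (Lpow Omega tau f <= ((V + 1) * A `^ tau)%:E)%E.
  exact: Lpow_le_lower tau0 taup A0 mO mf OV fp.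
have V1 : 0 <= V + 1 by rewrite addr_ge0.
split.
  apply: Lp_norm_le_of_Lpow => //.
    by rewrite mulr_ge0 ?powR_ge0 ?ltW.
  rewrite powRM ?powR_ge0 ?(ltW A0)// -powRrM mulVf ?gt_eqF// powRr1//.
  by rewrite -LfE.
have fr t h : 0 < t -> enorm h <= t ->
    (Lpow (segment_dom Omega r h) p (fdiff r h f) <=
      ((2 `^ (s + p^-1) * A * t `^ s) `^ p)%:E)%E.
  move=> t0 ht; rewrite DfE.
  exact: (besov_seminorm_difference hs p0 (ltW A0) uBp t0 ht).
have fN x eps h t : Omega x -> 0 < eps -> ball x eps `<=` Omega -> 0 < t ->
    enorm h <= t -> C0' * t <= eps ->
    `|fdiff N h f x| <= Ch * A * t `^ (l%:R + alpha) * eps `^ (- gamma).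
  move=> Ox e0 xO t0 ht te.
  rewrite fdiff_restrict.
    apply: (HCh u A (ltW A0) uh uH x eps h t e0 xO t0 ht (ltW halpha0)).
    apply: le_trans te; rewrite ler_wpM2r ?(ltW t0)// /C0' -addrA lerDl addr_ge0//.
  move=> a /andP[a0 a1]; apply: xO; rewrite ball_rVE [x + _]addrC addrK normrZ.
  apply: (@lt_le_trans _ _ (C0' * t)) => //.
  apply: (@le_lt_trans _ _ (N%:R * t)).
    rewrite ger0_norm ?mulr_ge0// ler_pM ?mulr_ge0//; first by rewrite ler_piMl.
    exact: le_trans (norm_le_enorm _) ht.
  by rewrite ltr_pM2r// /C0' addrAC ltrDr addr_gt0.
have top t h : 0 < t -> enorm h <= t ->
    (Lpow (segment_dom Omega (r' + maxn r l.+1) h) tau (fdiff (r' + maxn r l.+1) h f) <=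
      (B0 * A `^ tau * t `^ (eta * tau))%:E)%E.
  move=> t0 ht; apply: le_trans (HCs f A A0 mf fp fr fN t h t0 ht) _.
  rewrite lee_fin; apply: ler_wpM2r; first exact: powR_ge0.
  by apply: ler_wpM2r => //; rewrite /B0 lerDr.
have ftau' : (Lpow Omega tau f <= (B0 * A `^ tau)%:E)%E.
  apply: le_trans ftau _; rewrite lee_fin; apply: ler_wpM2r => //.
  by rewrite /B0 lerDl ltW.
have BA0 : 0 <= B0 * A `^ tau by rewrite mulr_ge0// ltW.
have -> : (K0 * I0) `^ tau^-1 * A = (K0 * A `^ tau * I0) `^ tau^-1.
  have AE : A = (A `^ tau) `^ tau^-1.
    by rewrite -powRrM mulfV ?gt_eqF// powRr1// ltW.
  rewrite {1}AE -powRM ?mulr_ge0//; congr (_ `^ _); ring.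
apply: besov_seminorm_le_differences => //.
- by rewrite mulr_ge0.
- move=> t h t0 ht; rewrite -DfE.
  apply: le_trans (HCm f (B0 * A `^ tau) BA0 mf ftau' top t h t0 ht) _.
  rewrite lee_fin; apply: ler_wpM2r; first exact: powR_ge0.
  rewrite mulrA; apply: ler_wpM2r => //.
  by rewrite /K0 lerDl mulr_ge0// ltW.
- move=> t h t0 ht; rewrite -DfE.
  apply: le_trans (K1P Omega h f oO mf) _.
  rewrite segment_dom0 (_ : fdiff 0 h f = f); last by apply/funext => x; rewrite fdiff0.
  apply: (@le_trans _ _ (K1%:E * (B0 * A `^ tau)%:E)%E).
    by apply: lee_wpmul2l; [rewrite lee_fin|exact: ftau'].
  rewrite -EFinM lee_fin mulrA; apply: ler_wpM2r => //.
  by rewrite /K0 lerDr mulr_ge0// ltW.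
Qed.

Theorem theorem3p1 (R : realType) (d : nat) (hd : (2 <= d)%N)
  (Omega : set 'rV[R]_d) (hOmega : lipschitz_domain Omega)
  (hbOmega : bounded_set Omega)
  (s p : R) (hs : 0 < s) (hp : 1 < p)
  (l : nat) (alpha : R) (halpha0 : 0 < alpha) (halpha1 : alpha <= 1)
  (gamma : R) (hgamma0 : 0 < gamma)
  (hgamma1 : gamma < l%:R + alpha + p^-1)
  (sigma tau : R) (hsigma0 : 0 < sigma)
  (hsigma1 : sigma <
     Num.min (sigma_star d l alpha p gamma) (d%:R / (d%:R - 1) * s))
  (htau : tau^-1 = sigma / d%:R + p^-1)
  (* the auxiliary parameters in the definitions of the spaces *)
  (c : R) (hc : 1 < c)
  (r r' : nat) (hr : Num.floor s + 1 <= r%:Z)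
  (hr' : Num.floor sigma + 1 <= r'%:Z) :
  exists C : R, 0 < C /\
    forall u : 'rV[R]_d -> R,
      besov Omega r s p%:E p%:E u ->
      holder_loc c Omega l alpha gamma u ->
      besov Omega r' sigma tau%:E tau%:E u /\
      (besov_norm Omega r' sigma tau%:E tau%:E u <=
       C%:E * maxe (besov_norm Omega r s p%:E p%:E u)
                   (holder_loc_seminorm c Omega l alpha gamma u))%E.
Proof.
have [C1 [C2 [C10 C20 H]]] := besov_norm_bound hd hOmega hbOmega hs hp halpha0
  hgamma0 hsigma0 hsigma1 htau hc r hr'.
exists (C1 + C2 + 1); split; first by rewrite ltr_wpDl// addr_ge0.
move=> u [mu uLp uB] uh; have [_ uH] := uh.
set bn := besov_norm Omega r s p%:E p%:E u.
set hn := holder_loc_seminorm c Omega l alpha gamma u.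
have bn0 : (0 <= bn)%E by rewrite adde_ge0//; [exact: Lnorm_ge0|exact: poweR_ge0].
have Mfin : maxe bn hn \is a fin_num.
  rewrite ge0_fin_numE; last by rewrite le_max bn0.
  by rewrite gt_max /bn/besov_norm lte_add_pinfty.
pose M := fine (maxe bn hn).
have ME : maxe bn hn = M%:E by rewrite fineK.
have M0 : 0 <= M by apply: fine_ge0; rewrite le_max bn0.
have bM : (bn <= M%:E)%E by rewrite -ME le_max lexx.
have hM : (hn <= M%:E)%E by rewrite -ME le_max lexx orbT.
(* The maximum [M] may be 0, whereas the estimates require a positive [A]; they are used for every
   [A > M], and the excess is made arbitrarily small at the end. *)
have HM A : M < A -> (Lp_norm Omega tau%:E u <= (C1 * A)%:E)%E /\
      (besov_seminorm Omega r' sigma tau%:E tau%:E u <= (C2 * A)%:E)%E.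
  move=> MA; apply: H => //; first exact: le_lt_trans MA.
    by apply: (le_trans bM); rewrite lee_fin ltW.
  by apply: (le_trans hM); rewrite lee_fin ltW.
split.
  have [|h1 h2] := HM (M + 1); first by rewrite ltrDl.
  by split => //; [apply: le_lt_trans h1 _|apply: le_lt_trans h2 _]; rewrite ltry.
rewrite ME -EFinM; apply/lee_addgt0Pr => eps eps0.
pose C := C1 + C2 + 1.
have C0 : 0 < C by rewrite ltr_wpDl// addr_ge0.
have [|h1 h2] := HM (M + eps / C); first by rewrite ltrDl divr_gt0.
apply: le_trans (leeD h1 h2) _; rewrite -!EFinD lee_fin -mulrDl -/C.
have -> : C * M + eps = C * (M + eps / C).
  by rewrite mulrDr mulrCA divff ?mulr1// gt_eqF.
have Me0 : 0 <= M + eps / C by apply: addr_ge0 => //; apply: divr_ge0; exact: ltW.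
by apply: ler_wpM2r => //; rewrite /C lerDl.
Qed.
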